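(* Let $r,s>0$, let $J$ be a finite index set, and let $\mathbf{T}=(t_j)_{j\in J}$ with $t_j\ge0$. For each $N$ let $(B^{j,N}_{r,s})_{j\in J}$ be independent $(r,s)$-Brownian motions on $\mathrm{GL}_N(\mathbb{C})$ and $B^N(\mathbf{T})=(B^{j,N}_{r,s}(t_j))_{j\in J}$. For $P,Q\in\mathscr{P}(J)$ set $$X_P^N = N\left([P]_N(B^N(\mathbf{T}))-\mathbb{E}\big[[P]_N(B^N(\mathbf{T}))\big]\right),$$ $$\sigma_{\mathbf{T}}(P,Q)=2\int_0^1 \left[e^{t\mathcal{D}^{\mathbf{T}}}\left(\Gamma^{\mathbf{T}}\big(e^{(1-t)\mathcal{D}^{\mathbf{T}}}P,\,e^{(1-t)\mathcal{D}^{\mathbf{T}}}Q\big)\right)\right](\mathbf{1})\,dt .$$ Then for any $k\ge1$ and $P_1,\ldots,P_k\in\mathscr{P}(J)$, as $N\to\infty$, $$\mathbb{E}(X^N_{P_1}\cdots X^N_{P_k})=\sum_{\pi\in\mathcal{P}_2(k)}\prod_{\{i,j\}\in\pi}\sigma_{\mathbf{T}}(P_i,P_j)+O\left(\frac1N\right),$$ where $\mathcal{P}_2(k)$ is the set of (unordered) pairings of $\{1,\ldots,k\}$ (empty if $k$ is odd), and the implied constant may depend on $r,s,J,\mathbf{T},P_1,\ldots,P_k$ but not on $N$.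
   Context: Brownian motions. $\mathbb{M}_N$ is the space of $N\times N$ complex matrices, $\mathrm{tr}=\frac1N\mathrm{Tr}$. The real inner product $\langle A,B\rangle_{r,s}^N=\frac{1}{2}(\frac{1}{s}+\frac{1}{r})N\,\Re \mathrm{Tr}(AB^* )+\frac{1}{2}(\frac{1}{s}-\frac{1}{r})N\,\Re \mathrm{Tr}(AB)$ on $\mathbb{M}_N$ has an orthonormal basis $\beta^N_{r,s}$. With $(\partial_\xi f)(g)=\frac{d}{dt}|_{t=0}f(ge^{t\xi})$ and $\Delta^N_{r,s}=\sum_{\xi\in\beta^N_{r,s}}\partial_\xi^2$, an $(r,s)$-Brownian motion on $\mathrm{GL}_N(\mathbb{C})$ is a diffusion started at $I_N$ with generator $\frac12\Delta_{r,s}^N$. On $\mathrm{GL}_N(\mathbb{C})^J$ let $\Delta_j^N$ be the operator $\Delta_{r,s}^N$ acting on the $j$th factor, and $\mathbf{T}\cdot\Delta^N=\frac12\sum_{j\in J}t_j\Delta_j^N$; the process $t\mapsto B^N(t\mathbf{T})=(B^{j,N}_{r,s}(tt_j))_{j\in J}$ is the diffusion with generator $\mathbf{T}\cdot\Delta^N$ started at the identity. The algebra $\mathscr{P}(J)$. Let $\mathscr{E}(J)=\bigcup_{n\ge1}(J\times\{1,\ast\})^n$ (nonempty words) and $\mathscr{P}(J)=\mathbb{C}[v_\varepsilon:\varepsilon\in\mathscr{E}(J)]$, the commutative polynomial algebra. The degree of $v_{\varepsilon^{(1)}}\cdots v_{\varepsilon^{(k)}}$ is $|\varepsilon^{(1)}|+\cdots+|\varepsilon^{(k)}|$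 (sum of word lengths). For $\mathbf{A}=(A_j)_{j\in J}\in\mathrm{GL}_N(\mathbb{C})^J$, $P\mapsto[P]_N(\mathbf{A})$ is the algebra homomorphism $\mathscr{P}(J)\to\mathbb{C}$ with $[v_\varepsilon]_N(\mathbf{A})=\mathrm{tr}(A_{j_1}^{\varepsilon_1}\cdots A_{j_n}^{\varepsilon_n})$ for $\varepsilon=((j_1,\varepsilon_1),\ldots,(j_n,\varepsilon_n))$. $P(\mathbf{1})$ (also $[P](\mathbf{1})$) is the value of $P$ when every $v_\varepsilon=1$, i.e. its evaluation at $(I_N)_{j\in J}$. The operators. It is known that there exist linear operators $\mathcal{D}^{\mathbf{T}},\mathcal{L}^{\mathbf{T}}$ on $\mathscr{P}(J)$, independent of $N$ and not increasing degree, such that: (1) $\mathcal{D}^{\mathbf{T}}(PQ)=\mathcal{D}^{\mathbf{T}}(P)Q+P\mathcal{D}^{\mathbf{T}}(Q)$; (2) $\mathcal{L}^{\mathbf{T}}(PQR)=\mathcal{L}^{\mathbf{T}}(PQ)R+P\mathcal{L}^{\mathbf{T}}(QR)+\mathcal{L}^{\mathbf{T}}(PR)Q-\mathcal{L}^{\mathbf{T}}(P)QR-P\mathcal{L}^{\mathbf{T}}(Q)R-PQ\mathcal{L}^{\mathbf{T}}(R)$; (3) $(\mathbf{T}\cdot\Delta^N)([P]_N)=[(\mathcal{D}^{\mathbf{T}}+\frac1{N^2}\mathcal{L}^{\mathbf{T}})(P)]_N$ for all $N$ and $P$. Fix such operators. Exponentials of $\mathcal{D}^{\mathbf{T}}$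 make sense because each finite-dimensional subspace of elements of bounded degree is invariant. Set $\Gamma^{\mathbf{T}}(P,Q)=\frac12\left(\mathcal{L}^{\mathbf{T}}(PQ)-\mathcal{L}^{\mathbf{T}}(P)Q-P\mathcal{L}^{\mathbf{T}}(Q)\right)$. *)

(* Defs.v *)
From HB Require Import structures.
From mathcomp Require Import all_boot all_order all_algebra.
From mathcomp Require Import complex finmap.
From mathcomp Require Import all_classical all_reals all_analysis.
(* The notations of monalg clash with those of MathComp-Analysis. *)
From mathcomp Require Import -(notations) monalg.

Set Implicit Arguments.
Unset Strict Implicit.
Unset Printing Implicit Defensive.

Import Order.TTheory GRing.Theory Num.Theory.
Import numFieldNormedType.Exports.

Local Open Scope ring_scope.

(* The complex numbers, packed as a [numClosedFieldType] so that complex numbers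
   and complex matrices receive their topology from MathComp-Analysis. *)
Definition CC (R : realType) : numClosedFieldType := complex R.
Definition cplx (R : realType) (x y : R) : CC R := Complex x y.
Definition RtoC (R : realType) (x : R) : CC R := cplx x 0.
Definition re (R : realType) (z : CC R) : R := complex.Re z.
Definition im (R : realType) (z : CC R) : R := complex.Im z.

Section Pairings.

Definition is_pairing (k : nat) (p : {set {set 'I_k}}) : bool :=
  finset.partition p [set: 'I_k]%SET && [forall b in p, #|b| == 2%N].

(* In a pairing every block b = {i, j} contributes exactly one factor, the one
   with i < j. *)
Definition pairing_sum (R : realType) (k : nat) (c : 'I_k -> 'I_k -> CC R) : CC R :=
  \sum_(p : {set {set 'I_k}} | is_pairing p)
    \prod_(b in p) \prod_(i in b) \prod_(j in b | (i < j)%N) c i j.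

End Pairings.

Local Open Scope classical_set_scope.

Section ComplexIntegral.
Context {d : measure_display} {T : measurableType d} {R : realType}.

Definition cintegral (mu : {measure set T -> \bar R}) (A : set T) (F : T -> CC R)
  : CC R :=
  cplx (Rintegral mu A (fun x => re (F x))) (Rintegral mu A (fun x => im (F x))).

Definition cintegrable (mu : {measure set T -> \bar R}) (A : set T) (F : T -> CC R)
  : Prop :=
  mu.-integrable A (fun x => (re (F x))%:E) /\
  mu.-integrable A (fun x => (im (F x))%:E).

Definition cexpectation (P : probability T R) (F : T -> CC R) : CC R :=
  cintegral P setT F.

End ComplexIntegral.

Section Matrices.
Context {R : realType} {N : nat}.
Local Notation M := ('M[CC R]_N).

Definition adjmx (A : M) : M := map_mx (@Num.conj (CC R)) A^T.

Definition ntr (A : M) : CC R := N%:R^-1 * \tr A.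

Definition expmx (A : M) : M :=
  lim (series (fun k : nat => (k`!%:R)^-1 *: A ^+ k) @ \oo).

Definition inner_rs (r s : R) (A B : M) : R :=
  2%:R^-1 * (s^-1 + r^-1) * N%:R * re (\tr (A *m adjmx B))
  + 2%:R^-1 * (s^-1 - r^-1) * N%:R * re (\tr (A *m B)).

(* A basis of the REAL vector space of complex matrices. *)
Definition orthonormal_basis_rs (r s : R) (beta : seq M) : Prop :=
  (forall i j, (i < size beta)%N -> (j < size beta)%N ->
     inner_rs r s beta`_i beta`_j = (i == j)%:R) /\
  (forall A : M, exists c : nat -> R,
     A = \sum_(i < size beta) RtoC (c i) *: beta`_i).

Definition partial_xi (xi : M) (f : M -> R) (g : M) : R :=
  derive1 (fun t : R => f (g *m expmx (RtoC t *: xi))) 0.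

Definition laplacian (beta : seq M) (f : M -> R) (g : M) : R :=
  \sum_(xi <- beta) partial_xi xi (partial_xi xi f) g.

Definition claplacian (beta : seq M) (F : M -> CC R) (g : M) : CC R :=
  cplx (laplacian beta (fun h => re (F h)) g)
       (laplacian beta (fun h => im (F h)) g).

Definition dir_derive (v : M) (f : M -> R) (g : M) : R :=
  derive1 (fun t : R => f (g + RtoC t *: v)) 0.

(* All iterated directional derivatives, along real lines, exist and are
   continuous. *)
Definition smooth (f : M -> R) : Prop :=
  forall vs : seq M, let h := foldr dir_derive f vs in
    continuous h /\
    forall v g : M, derivable (fun t : R => h (g + RtoC t *: v)) 0 1.

(* Smooth functions with compact support in the open set of invertible
   matrices, extended by 0 to all matrices. *)
Definition test_function (f : M -> R) : Prop :=
  let supp := closure [set g : M | f g != 0] in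
  [/\ smooth f, compact supp & supp `<=` [set g : M | g \in unitmx]].

End Matrices.

Section Processes.
Context {d : measure_display} {Omega : measurableType d} {R : realType}.
Variable Pr : probability Omega R.

Definition martingale (F : R -> set (set Omega)) (Z : R -> Omega -> R) : Prop :=
  [/\ forall t, 0 <= t -> Pr.-integrable setT (EFin \o Z t),
      forall t, 0 <= t -> forall Y : set R, measurable Y -> F t (Z t @^-1` Y) &
      forall (u t : R) (A : set Omega), 0 <= u -> u <= t -> F u A ->
        (\int[Pr]_(w in A) (Z t w)%:E = \int[Pr]_(w in A) (Z u w)%:E)%E].

Context {N : nat}.
Local Notation M := ('M[CC R]_N).
Implicit Type B : R -> Omega -> M.

(* The sigma-algebra generated by the B_u, for u in the set I of times. *)
Definition sigma_process B (I : set R) : set (set Omega) :=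
  <<s [set S | exists (u : R) (U : set M), [/\ I u, open U & S = B u @^-1` U]] >>.

Definition natural_filtration B (t : R) : set (set Omega) :=
  sigma_process B [set u | 0 <= u <= t].

(* Continuous GL_N(C)-valued process solving the martingale problem for the
   generator G, started at g0. *)
Definition diffusion (G : (M -> R) -> M -> R) (g0 : M) B : Prop :=
  [/\ forall t, 0 <= t -> forall U : set M, open U -> measurable (B t @^-1` U),
      forall t, 0 <= t -> forall w, B t w \in unitmx,
      forall w, B 0 w = g0,
      forall w, {within [set t : R | 0 <= t], continuous (fun t : R => B t w)} &
      forall f : M -> R, test_function f ->
        martingale (natural_filtration B) (fun t w =>
          f (B t w) - f (B 0 w)
          - Rintegral (@lebesgue_measure R) [set` `[0, t]]
              (fun u => G f (B u w)))].

Definition brownian_motion (beta : seq M) B : Prop :=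
  diffusion (fun f g => 2%:R^-1 * laplacian beta f g) 1%:M B.

Definition independent_processes (J : finType) (B : J -> R -> Omega -> M) : Prop :=
  forall A : J -> set Omega,
    (forall j, sigma_process (B j) [set u | 0 <= u] (A j)) ->
    fine (Pr (\bigcap_(j in [set: J]) A j)) = \prod_(j : J) fine (Pr (A j)).

End Processes.

(* A letter (j, false) is (j, 1) and a letter (j, true) is (j, * ). *)
Definition word (J : finType) : choiceType := {w : seq (J * bool) | w != [::]}.

Notation cmon J := (cmonom (word J)).
Notation trpoly R J := (malg (cmon J) (CC R)).

Section TracePolynomials.
Context {R : realType} {J : finType}.
Implicit Type P Q : trpoly R J.

(* Evaluation homomorphism sending each indeterminate v_e to v e. *)
Definition peval (v : word J -> CC R) P : CC R :=
  mmap idfun (fun m : cmon J => \prod_(e <- finsupp m) v e ^+ m e) P.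

Definition peval1 P : CC R := peval (fun=> 1) P.

Definition word_mx {N : nat} (A : J -> 'M[CC R]_N) (e : word J) : 'M[CC R]_N :=
  \prod_(l <- sval e) (if l.2 then adjmx (A l.1) else A l.1).

Definition trace_eval {N : nat} P (A : J -> 'M[CC R]_N) : CC R :=
  peval (fun e => ntr (word_mx A e)) P.

Definition mon_degree (m : cmon J) : nat :=
  (\sum_(e <- finsupp m) size (sval e) * m e)%N.

Definition degree_le (n : nat) P : Prop :=
  forall m, m \in msupp P -> (mon_degree m <= n)%N.

Definition degree_nonincreasing (D : trpoly R J -> trpoly R J) : Prop :=
  forall n P, degree_le n P -> degree_le n (D P).

(* (T . Delta^N) F = (1/2) sum_j t_j Delta_j F, where Delta_j acts on the j-th
   factor, the other factors being frozen. *)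
Definition T_laplacian {N : nat} (beta : seq 'M[CC R]_N) (T : J -> R)
    (F : (J -> 'M[CC R]_N) -> CC R) (A : J -> 'M[CC R]_N) : CC R :=
  2%:R^-1 * \sum_(j : J) RtoC (T j) *
    claplacian beta (fun g => F (@dfwith J (fun=> 'M[CC R]_N) A j g)) (A j).

(* The exponential series of D at P, with limits taken coefficientwise; for D
   not increasing degrees the limit takes place in a finite-dimensional space of
   polynomials. *)
Definition exp_op (D : trpoly R J -> trpoly R J) P : trpoly R J :=
  xget 0 [set Q : trpoly R J | forall m : cmon J,
    (fun n : nat => mcoeff m (\sum_(k < n) (k`!%:R)^-1 *: iter k D P)) @ \oo
      --> mcoeff m Q].

Definition carre_du_champ (L : trpoly R J -> trpoly R J) P Q : trpoly R J :=
  2%:R^-1 *: (L (P * Q) - L P * Q - P * L Q).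

Definition sigma_T (D L : trpoly R J -> trpoly R J) P Q : CC R :=
  let etD (t : R) := exp_op (fun P' => RtoC t *: D P') in
  2%:R * cintegral (@lebesgue_measure R) [set` `[0, 1]] (fun t : R =>
    peval1 (etD t (carre_du_champ L (etD (1 - t) P) (etD (1 - t) Q)))).

(* [w |-> X_P^N(w)], where B w stands for B^N(T)(w). *)
Definition fluctuation {N : nat} {d : measure_display} {Omega : measurableType d}
    (Pr : probability Omega R) (B : Omega -> J -> 'M[CC R]_N) P (w : Omega)
  : CC R :=
  N%:R * (trace_eval P (B w) - cexpectation Pr (fun w' => trace_eval P (B w'))).

End TracePolynomials.

(* Main.v *)
(* Write tau_N(P) for the expectation of [P]_N at B^N(T). Polynomials are not
   admissible in the martingale problem, so they are multiplied by cut-offs in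
   1 + |g|^2 and |det g|^2; left-invariant fields move both functions by at most a
   constant multiple of themselves, so Gronwall's lemma bounds all moments and
   Dynkin's formula survives the removal of the cut-offs. Independence of the
   factors then gives tau_N(P) = (e^A P)(1) with A = D + N^-2 L.

   For a set S of indices consider
   s |-> N^|S| (e^{sA} prod_{i in S} (e^{(1-s)A} P_i - tau_N(P_i)))(1),
   which is 0 at s = 0 (for nonempty S) and the centred moment at s = 1. As L has
   order two, its derivative is the sum over pairs {i,j} of the same expression with
   the factors i and j replaced by 2 Gamma(e^{(1-s)A} P_i, e^{(1-s)A} P_j), and N^|S|
   replaced by N^(|S|-2). By induction on |S| centred moments are bounded uniformly
   in N, so replacing the new factor by its mean costs O(1/N). In the limit the
   moments solve H_S' = sum_{{i,j}} 2 c_{ij} H_{S - {i,j}}, as do the pairing sums. *)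

Require Import Defs.
From HB Require Import structures.
From mathcomp Require Import all_boot all_order all_algebra.
From mathcomp Require Import complex finmap.
From mathcomp Require Import all_classical all_reals all_analysis.
From mathcomp Require Import -(notations) monalg.
From mathcomp Require Import perm measurable_realfun ring lra.

Set Implicit Arguments.
Unset Strict Implicit.
Unset Printing Implicit Defensive.

Import Order.TTheory GRing.Theory Num.Theory.
Import numFieldNormedType.Exports.

Local Open Scope ring_scope.

Local Open Scope classical_set_scope.

(** * Complex scalars and exponential series *)

(** Uniformity in N shapes the proof. N enters only through powers of N and the parameter e = N^-2
    of A = D + e L. Every operator estimate is made on polynomials of degree at most d, a
    finite-dimensional space, with one constant for all 0 <= e <= 1. As Gamma doubles the degree,
    the moment bound is proved for all degrees and all coefficient norms at once. Passing from A to
    D costs only N^-2, by Duhamel's formula.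

    The identity tau_N(P) = (e^A P)(1) is a duality argument: the expectation of [e^{(1-s)A} P]_N at
    B(sT) has derivative 0 in s, because the generator acts on [P]_N as A acts on P.

    On the analytic side, a test function must have all its iterated derivatives; they come from a
    syntax of expressions closed under derivation. Gronwall's lemma cannot be run on the weight
    itself, whose integrability is part of the claim. It is run on bounded truncations, with growth
    constants independent of the truncation level, and Fatou's lemma removes the truncation. *)

Section ComplexScalars.
Context {R : realType}.
Implicit Types (z w : CC R) (F G : R -> CC R).

Lemma CC_eq z w : re z = re w -> im z = im w -> z = w.
Proof. by case: z w => [a b] [c d] /= -> ->. Qed.

Lemma reD z w : re (z + w) = re z + re w. Proof. by case: z w => [a b] [c d]. Qed.
Lemma imD z w : im (z + w) = im z + im w. Proof. by case: z w => [a b] [c d]. Qed.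
Lemma reN z : re (- z) = - re z. Proof. by case: z. Qed.
Lemma imN z : im (- z) = - im z. Proof. by case: z. Qed.
Lemma reM z w : re (z * w) = re z * re w - im z * im w.
Proof. by case: z w => [a b] [c d]. Qed.
Lemma imM z w : im (z * w) = re z * im w + im z * re w.
Proof. by case: z w => [a b] [c d]. Qed.
Lemma re0 : re (0 : CC R) = 0. Proof. by []. Qed.
Lemma im0 : im (0 : CC R) = 0. Proof. by []. Qed.
Lemma re1 : re (1 : CC R) = 1. Proof. by []. Qed.
Lemma im1 : im (1 : CC R) = 0. Proof. by []. Qed.

Lemma re_sum I (r : seq I) (p : pred I) (f : I -> CC R) :
  re (\sum_(i <- r | p i) f i) = \sum_(i <- r | p i) re (f i).
Proof. exact: (big_morph (@re R) reD re0). Qed.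
Lemma im_sum I (r : seq I) (p : pred I) (f : I -> CC R) :
  im (\sum_(i <- r | p i) f i) = \sum_(i <- r | p i) im (f i).
Proof. exact: (big_morph (@im R) imD im0). Qed.

Lemma re_conj z : re (Num.conj z) = re z. Proof. by case: z. Qed.
Lemma im_conj z : im (Num.conj z) = - im z. Proof. by case: z. Qed.

Lemma RtoC_is_zmod : zmod_morphism (@RtoC R).
Proof. by move=> x y; apply: CC_eq; rewrite /= ?subrr. Qed.
Lemma RtoC_is_monoid : monoid_morphism (@RtoC R).
Proof.
by split=> [|x y] //; apply: CC_eq; rewrite ?reM ?imM /= ?mulr0 ?mul0r ?subr0 ?addr0.
Qed.
HB.instance Definition _ := GRing.isZmodMorphism.Build R (CC R) (@RtoC R) RtoC_is_zmod.
HB.instance Definition _ := GRing.isMonoidMorphism.Build R (CC R) (@RtoC R) RtoC_is_monoid.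

Lemma re_RtoCM (x : R) z : re (RtoC x * z) = x * re z.
Proof. by rewrite reM /= mul0r subr0. Qed.
Lemma im_RtoCM (x : R) z : im (RtoC x * z) = x * im z.
Proof. by rewrite imM /= mul0r addr0. Qed.

Lemma RtoC_nat n : RtoC (n%:R : R) = n%:R :> CC R.
Proof. exact: rmorph_nat. Qed.

Lemma RtoC_inv (x : R) : RtoC x^-1 = (RtoC x)^-1 :> CC R.
Proof. exact: fmorphV. Qed.

Lemma lecR (x y : R) : x <= y -> RtoC x <= RtoC y :> CC R.
Proof. by move=> xy; rewrite lecE /= eqxx xy. Qed.

(** The norm of [CC R] takes its values in [CC R]. This l^1 norm has values in [R], is
    submultiplicative and bounds both parts, so that estimates are made over the reals. *)
Definition n1 z : R := `|re z| + `|im z|.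

Lemma n1_ge0 z : 0 <= n1 z. Proof. exact: addr_ge0. Qed.
Lemma n1D z w : n1 (z + w) <= n1 z + n1 w.
Proof. by rewrite /n1 reD imD addrACA lerD // ler_normD. Qed.
Lemma n1N z : n1 (- z) = n1 z. Proof. by rewrite /n1 reN imN !normrN. Qed.
Lemma n10 : n1 0 = 0. Proof. by rewrite /n1 re0 im0 normr0 addr0. Qed.
Lemma n11 : n1 1 = 1. Proof. by rewrite /n1 re1 im1 normr0 normr1 addr0. Qed.
Lemma n1M z w : n1 (z * w) <= n1 z * n1 w.
Proof.
rewrite /n1 reM imM mulrDl !mulrDr -!normrM.
apply: (le_trans (lerD (ler_normB _ _) (ler_normD _ _))).
by rewrite [X in _ <= X](_ : _ = `|re z * re w| + `|im z * im w| +
  (`|re z * im w| + `|im z * re w|)) //; ring.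
Qed.
Lemma n1_sum I (r : seq I) (p : pred I) (f : I -> CC R) :
  n1 (\sum_(i <- r | p i) f i) <= \sum_(i <- r | p i) n1 (f i).
Proof.
elim/big_rec2: _ => [|i y z _ H]; first by rewrite n10.
by apply: (le_trans (n1D _ _)); rewrite lerD2l.
Qed.
Lemma n1_RtoC (x : R) : n1 (RtoC x) = `|x|.
Proof. by rewrite /n1 /= normr0 addr0. Qed.
Lemma re_le_n1 z : `|re z| <= n1 z. Proof. by rewrite lerDl. Qed.
Lemma im_le_n1 z : `|im z| <= n1 z. Proof. by rewrite lerDr. Qed.

Lemma norm_le_n1 z : `|z| <= RtoC (n1 z).
Proof.
have zE : z = RtoC (re z) + 'i * RtoC (im z).
  by apply: CC_eq; rewrite ?reD ?imD ?reM ?imM /= ?mulr0 ?mul0r ?mul1r; ring.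
have E (x : R) : `|RtoC x| = RtoC `|x| :> CC R.
  by rewrite normc_def /= expr0n /= addr0 sqrtr_sqr.
rewrite {1}zE; apply: (le_trans (ler_normD _ _)).
by rewrite normrM normCi mul1r !E -rmorphD.
Qed.

(** Taken componentwise, so that real results such as the mean value theorem apply to each part. *)
Definition cderiv F (t : R) (l : CC R) : Prop :=
  is_derive t 1 (fun s => re (F s)) (re l) /\
  is_derive t 1 (fun s => im (F s)) (im l).

Lemma cderiv_eq F t l l' : cderiv F t l -> l = l' -> cderiv F t l'.
Proof. by move=> ? <-. Qed.

Lemma is_derive_ext (f g : R -> R) (t l : R) :
  f =1 g -> is_derive t 1 f l -> is_derive t 1 g l.
Proof. by move=> /funext ->. Qed.

Lemma cderiv_ext F G t l : F =1 G -> cderiv F t l -> cderiv G t l.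
Proof. by move=> /funext ->. Qed.

Lemma cderiv_cst z t : cderiv (fun=> z) t 0.
Proof. by split; exact: is_derive_cst. Qed.

Lemma is_deriveM' (f g : R -> R) (t a b : R) :
  is_derive t 1 f a -> is_derive t 1 g b ->
  is_derive t 1 (fun s => f s * g s) (a * g t + f t * b).
Proof.
move=> fa gb; apply: (is_derive_eq (is_deriveM fa gb)).
by change (f t * b + g t * a = a * g t + f t * b); ring.
Qed.

Lemma is_deriveB' (f g : R -> R) (t a b : R) :
  is_derive t 1 f a -> is_derive t 1 g b ->
  is_derive t 1 (fun s => f s - g s) (a - b).
Proof. by move=> fa gb; exact: is_deriveB. Qed.

Lemma is_deriveD' (f g : R -> R) (t a b : R) :
  is_derive t 1 f a -> is_derive t 1 g b ->
  is_derive t 1 (fun s => f s + g s) (a + b).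
Proof. by move=> fa gb; exact: is_deriveD. Qed.

Lemma cderivD F G t a b :
  cderiv F t a -> cderiv G t b -> cderiv (fun s => F s + G s) t (a + b).
Proof.
move=> [ra ia] [rb ib]; split; rewrite ?reD ?imD.
  by apply: is_derive_ext (is_deriveD' ra rb) => s; rewrite reD.
by apply: is_derive_ext (is_deriveD' ia ib) => s; rewrite imD.
Qed.

Lemma cderivM F G t a b :
  cderiv F t a -> cderiv G t b -> cderiv (fun s => F s * G s) t (a * G t + F t * b).
Proof.
move=> [ra ia] [rb ib]; split.
  apply: (@is_derive_ext (fun s => re (F s) * re (G s) - im (F s) * im (G s))).
    by move=> s; rewrite reM.
  have := is_deriveB' (is_deriveM' ra rb) (is_deriveM' ia ib).
  by move=> /is_derive_eq; apply; rewrite reD !reM; ring.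
apply: (@is_derive_ext (fun s => re (F s) * im (G s) + im (F s) * re (G s))).
  by move=> s; rewrite imM.
have := is_deriveD' (is_deriveM' ra ib) (is_deriveM' ia rb).
by move=> /is_derive_eq; apply; rewrite imD !imM; ring.
Qed.

Lemma cderivZ z F t a : cderiv F t a -> cderiv (fun s => z * F s) t (z * a).
Proof.
move=> Fa; apply: cderiv_eq (cderivM (cderiv_cst z t) Fa) _.
by rewrite mul0r add0r.
Qed.

Lemma cderiv_sum I (r : seq I) (p : pred I) (F : I -> R -> CC R) t (a : I -> CC R) :
  (forall i, p i -> cderiv (F i) t (a i)) ->
  cderiv (fun s => \sum_(i <- r | p i) F i s) t (\sum_(i <- r | p i) a i).
Proof.
move=> H; elim: r => [|i r IH].
  rewrite big_nil; apply: cderiv_ext (cderiv_cst 0 t) => s.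
  by rewrite big_nil.
rewrite big_cons; case: ifPn => pi.
  by apply: cderiv_ext (cderivD (H i pi) IH) => s; rewrite big_cons pi.
by apply: cderiv_ext IH => s; rewrite big_cons (negbTE pi).
Qed.

Lemma cderiv_rev F (c t : R) a :
  cderiv F (c - t) a -> cderiv (fun s => F (c - s)) t (- a).
Proof.
have H (f : R -> R) l : is_derive (c - t) 1 f l -> is_derive t 1 (fun s => f (c - s)) (- l).
  move=> fl.
  have h : is_derive t 1 (fun s : R => c - s) (- 1).
    by have := is_deriveB (is_derive_cst c t 1) (is_derive_id t 1);
      rewrite sub0r.
  have := @is_derive1_comp _ f (fun s => c - s) t _ _ fl h.
  by move=> /is_derive_eq; apply; rewrite mulrN1.
by move=> [ra ia]; split; rewrite ?reN ?imN; [exact: (H _ _ ra)|exact: (H _ _ ia)].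
Qed.

(** The mean value theorem fails for complex values and is applied to the two parts separately,
    whence the factor 2. Derivatives are asked only inside the interval, since expectations are
    differentiated only at positive times. *)
Lemma cderiv_bound F (dF : R -> CC R) (a b M : R) : a <= b ->
  {within `[a, b], continuous (fun t => re (F t))} ->
  {within `[a, b], continuous (fun t => im (F t))} ->
  (forall t, a < t < b -> cderiv F t (dF t)) ->
  (forall t, a < t < b -> n1 (dF t) <= M) ->
  n1 (F b - F a) <= 2 * (M * (b - a)).
Proof.
move=> ab cr ci dF1 dFM.
have H (f df : R -> R) : {within `[a, b], continuous f} ->
    (forall t, a < t < b -> is_derive t 1 f (df t)) ->
    (forall t, a < t < b -> `|df t| <= M) -> `|f b - f a| <= M * (b - a).
  move=> cf dfE dfM; move: ab; rewrite le_eqVlt => /orP[/eqP ->|ab'].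
    by rewrite !subrr normr0 mulr0.
  have [c cab ->] := MVT ab' (fun x xab => dfE x ltac:(by move: xab; rewrite in_itv)) cf.
  have abc : a < c < b by move: cab; rewrite in_itv.
  have ba : 0 <= b - a by rewrite subr_ge0 ltW.
  by rewrite normrM (ger0_norm ba) ler_wpM2r // dfM.
rewrite /n1 reD imD reN imN mulr_natl mulr2n lerD //.
  apply: (H (fun t => re (F t)) (fun t => re (dF t))) => // t tab; first by have [] := dF1 t tab.
  exact: le_trans (re_le_n1 _) (dFM t tab).
apply: (H (fun t => im (F t)) (fun t => im (dF t))) => // t tab; first by have [] := dF1 t tab.
exact: le_trans (im_le_n1 _) (dFM t tab).
Qed.

Lemma is_derive_continuous (f : R -> R) (t l : R) :
  is_derive t 1 f l -> {for t, continuous f}.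
Proof. by move=> H; apply: differentiable_continuous; apply/derivable1_diffP; apply: ex_derive. Qed.

End ComplexScalars.

Section ExponentialSeries.
Context {R : realType}.

Definition expser_term (c : nat -> R) (t : R) (k : nat) : R := c k / k`!%:R * t ^+ k.
(** Exponential generating function of [c]. If [c k] is a coordinate of the k-th power of an
    operator, this is that coordinate of the exponential, and derivation becomes the shift of
    [c]. *)
Definition expser (c : nat -> R) (t : R) : R := limn (series (expser_term c t)).

(** The growth of the coordinates of the powers of a bounded operator; comparison with the series of
    a exp(C |t|) gives convergence for every t. *)
Definition geo_bounded (c : nat -> R) (a C : R) :=
  0 <= C /\ forall k, `|c k| <= a * C ^+ k.

Lemma expser_term_le c a C t k : geo_bounded c a C ->
  `|expser_term c t k| <= a * exp_coeff (C * `|t|) k.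
Proof.
move=> [C0 cC]; rewrite /expser_term !normrM normrX normfV.
rewrite (@ger0_norm _ (k`!%:R)) // /exp_coeff /= exprMn.
rewrite (_ : a * _ = a * C ^+ k / k`!%:R * `|t| ^+ k); last by field.
by rewrite !ler_wpM2r ?invr_ge0 ?exprn_ge0.
Qed.

Lemma is_cvg_scaled_exp_coeff (a x : R) : cvgn (series (fun k => a * exp_coeff x k)).
Proof. exact: (@is_cvg_seriesZ _ _ a (@is_cvg_series_exp_coeff _ x)). Qed.

Lemma is_cvg_expser_norm c a C t : geo_bounded c a C ->
  cvgn [normed series (expser_term c t)].
Proof.
move=> H; apply: (@series_le_cvg _ _ (fun k => a * exp_coeff (C * `|t|) k)) => [n|n|n|].
- exact: normr_ge0.
- exact: le_trans (normr_ge0 _) (expser_term_le t n H).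
- exact: expser_term_le.
- exact: is_cvg_scaled_exp_coeff.
Qed.

Lemma is_cvg_expser c a C t : geo_bounded c a C -> cvgn (series (expser_term c t)).
Proof. by move=> H; apply: normed_cvg; exact: is_cvg_expser_norm H. Qed.

Lemma expser_le c a C t : geo_bounded c a C -> `|expser c t| <= a * expR (C * `|t|).
Proof.
move=> H; rewrite /expser.
apply: le_trans; first by apply: lim_series_norm; exact: (@is_cvg_expser_norm c a C t H).
suff <- : limn (series (fun k => a * exp_coeff (C * `|t|) k)) = a * expR (C * `|t|).
  apply: lim_series_le; [exact: (@is_cvg_expser_norm c a C t H)|exact: is_cvg_scaled_exp_coeff|].
  by move=> k; exact: expser_term_le.
exact: (@lim_seriesZ _ _ a (@is_cvg_series_exp_coeff _ (C * `|t|))).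
Qed.

Lemma geo_bounded_shift c a C : geo_bounded c a C -> geo_bounded (fun k => c k.+1) (a * C) C.
Proof. by move=> [C0 H]; split=> // k; rewrite -mulrA -exprS. Qed.

Lemma pseries_diffs_expser c :
  pseries_diffs (fun k => c k / k`!%:R) = fun k => c k.+1 / k`!%:R :> R.
Proof.
apply/funext => k; rewrite /pseries_diffs factS natrM invfM mulrCA.
by rewrite [_.+1%:R * _]mulrA mulfV ?mul1r.
Qed.

Lemma is_derive_expser c a C (t : R) : geo_bounded c a C ->
  is_derive t 1 (expser c) (expser (fun k => c k.+1) t).
Proof.
move=> H; rewrite /expser.
have H1 := geo_bounded_shift H; have H2 := geo_bounded_shift H1.
have E : forall c', (fun s => limn (series (expser_term c' s))) =
  (fun s => limn (pseries (fun k => c' k / k`!%:R) s)) by [].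
rewrite (E c); have -> : limn (series (expser_term (fun k => c k.+1) t)) =
  limn (pseries (pseries_diffs (fun k => c k / k`!%:R)) t).
  by rewrite pseries_diffs_expser.
(* Any radius beyond |t| would do. Shifting preserves geometric bounds, which settles convergence of
   the two derived series. *)
apply: (@pseries_snd_diffs _ _ (`|t| + 1)); rewrite ?pseries_diffs_expser.
- exact: (@is_cvg_expser _ _ _ (`|t| + 1) H).
- exact: (@is_cvg_expser _ _ _ (`|t| + 1) H1).
- exact: (@is_cvg_expser _ _ _ (`|t| + 1) H2).
- by rewrite [ltRHS]ger0_norm ?addr_ge0 // ltrDl.
Qed.

Lemma cvg_expser c a C t : geo_bounded c a C ->
  (fun n => \sum_(k < n) expser_term c t k) @ \oo --> expser c t.
Proof.
move=> H; have := cvg_toP (@is_cvg_expser _ _ _ t H) erefl; rewrite -/(expser c t).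
apply: cvg_trans; apply: near_eq_cvg; near=> n; by rewrite /series /= big_mkord.
Unshelve. all: by end_near. Qed.

Lemma expser0 c : expser c 0 = c 0%N.
Proof.
rewrite /expser; apply/cvg_lim => //; rewrite -(cvg_shiftS).
apply: cvg_near_cst; near=> n; rewrite /series /= big_nat_recl // big1 => [|k _].
  by rewrite /expser_term expr0 fact0 divr1 mulr1 addr0.
by rewrite /expser_term exprS mul0r mulr0.
Unshelve. all: by end_near. Qed.

Lemma expserD c c' a a' C t : geo_bounded c a C -> geo_bounded c' a' C ->
  expser (fun k => c k + c' k) t = expser c t + expser c' t.
Proof.
move=> H H'; rewrite /expser -lim_seriesD; [|exact: is_cvg_expser H|exact: is_cvg_expser H'].
by congr (limn (series _)); apply/funext => k; rewrite /expser_term !fctE !mulrDl.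
Qed.

Lemma expserZ x c a C t : geo_bounded c a C ->
  expser (fun k => x * c k) t = x * expser c t.
Proof.
move=> H; rewrite /expser -[RHS](@lim_seriesZ _ _ x (@is_cvg_expser _ _ _ t H)).
by congr (limn (series _)); apply/funext => k; rewrite /expser_term !fctE /= -!mulrA.
Qed.

Definition cgeo_bounded (c : nat -> CC R) (a C : R) :=
  0 <= C /\ forall k, n1 (c k) <= a * C ^+ k.

Lemma cgeo_re c a C : cgeo_bounded c a C -> geo_bounded (fun k => re (c k)) a C.
Proof. by move=> [C0 H]; split=> // k; apply: le_trans (H k); exact: re_le_n1. Qed.
Lemma cgeo_im c a C : cgeo_bounded c a C -> geo_bounded (fun k => im (c k)) a C.
Proof. by move=> [C0 H]; split=> // k; apply: le_trans (H k); exact: im_le_n1. Qed.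

Definition cexpser (c : nat -> CC R) (t : R) : CC R :=
  cplx (expser (fun k => re (c k)) t) (expser (fun k => im (c k)) t).

Lemma n1_cexpser c a C t : cgeo_bounded c a C ->
  n1 (cexpser c t) <= 2 * (a * expR (C * `|t|)).
Proof.
move=> H; rewrite /n1 /= mulr_natl mulr2n lerD //.
  exact: (expser_le t (cgeo_re H)).
exact: (expser_le t (cgeo_im H)).
Qed.

Lemma cderiv_cexpser c a C t : cgeo_bounded c a C ->
  cderiv (cexpser c) t (cexpser (fun k => c k.+1) t).
Proof.
by move=> H; split; [exact: (is_derive_expser t (cgeo_re H))|
  exact: (is_derive_expser t (cgeo_im H))].
Qed.

Lemma cexpser0 c : cexpser c 0 = c 0%N.
Proof. by apply: CC_eq; rewrite /= expser0. Qed.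

Lemma cgeoD c c' a a' C : cgeo_bounded c a C -> cgeo_bounded c' a' C ->
  cgeo_bounded (fun k => c k + c' k) (a + a') C.
Proof.
by move=> [C0 H] [_ H']; split=> // k; rewrite mulrDl; apply: le_trans (n1D _ _) _; exact: lerD.
Qed.

Lemma cgeoZ x c a C : cgeo_bounded c a C ->
  cgeo_bounded (fun k => x * c k) (n1 x * a) C.
Proof.
by move=> [C0 H]; split=> // k; rewrite -mulrA; apply: le_trans (n1M _ _) _;
  rewrite ler_wpM2l ?n1_ge0.
Qed.

Lemma cexpserD c c' a a' C t : cgeo_bounded c a C -> cgeo_bounded c' a' C ->
  cexpser (fun k => c k + c' k) t = cexpser c t + cexpser c' t.
Proof.
move=> H H'; apply: CC_eq; rewrite ?reD ?imD /=.
  rewrite -(expserD t (cgeo_re H) (cgeo_re H')).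
  by congr (expser _ t); apply/funext => k; rewrite reD.
rewrite -(expserD t (cgeo_im H) (cgeo_im H')).
by congr (expser _ t); apply/funext => k; rewrite imD.
Qed.

Lemma geoZ x (c : nat -> R) a C : geo_bounded c a C ->
  geo_bounded (fun k => x * c k) (`|x| * a) C.
Proof. by move=> [C0 H]; split=> // k; rewrite -mulrA normrM ler_wpM2l. Qed.

Lemma cexpserZ x c a C t : cgeo_bounded c a C ->
  cexpser (fun k => x * c k) t = x * cexpser c t.
Proof.
move=> H; have Hr := cgeo_re H; have Hi := cgeo_im H.
apply: CC_eq; rewrite ?reM ?imM /=.
  rewrite -!mulNr -(expserZ _ t Hr) -(expserZ _ t Hi) -(expserD t (geoZ _ Hr) (geoZ _ Hi)).
  by congr (expser _ t); apply/funext => k; rewrite reM mulNr.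
rewrite -(expserZ _ t Hr) -(expserZ _ t Hi) -(expserD t (geoZ _ Hi) (geoZ _ Hr)).
by congr (expser _ t); apply/funext => k; rewrite imM.
Qed.

Lemma cgeo0 (C : R) : 0 <= C -> cgeo_bounded (fun=> 0) 0 C.
Proof. by move=> C0; split=> // k; rewrite n10 mul0r. Qed.

Lemma cexpser_sum (I : eqType) (r : seq I) (z : I -> CC R) (c : I -> nat -> CC R)
    (a : I -> R) C t :
  0 <= C -> (forall i, i \in r -> cgeo_bounded (c i) (a i) C) ->
  cexpser (fun k => \sum_(i <- r) z i * c i k) t = \sum_(i <- r) z i * cexpser (c i) t.
Proof.
move=> C0 H.
(* A geometric bound for the partial combination is carried through the induction, since additivity
   of [cexpser] requires it. *)
suff [_ ->] : cgeo_bounded (fun k => \sum_(i <- r) z i * c i k)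
    (\sum_(i <- r) n1 (z i) * a i) C /\
  cexpser (fun k => \sum_(i <- r) z i * c i k) t = \sum_(i <- r) z i * cexpser (c i) t by [].
elim: r H => [|i r IH] H.
  rewrite !big_nil (_ : (fun k => _) = fun=> 0); last by apply/funext => k; rewrite big_nil.
  split; first exact: cgeo0.
  by have := cexpserZ 0 t (cgeo0 C0); rewrite mul0r /= mul0r.
have [|B E] := IH; first by move=> j jr; apply: H; rewrite inE jr orbT.
have Hi : cgeo_bounded (c i) (a i) C by apply: H; rewrite inE eqxx.
rewrite !big_cons -E -(cexpserZ _ t Hi) -(cexpserD t (cgeoZ _ Hi) B).
rewrite (_ : (fun k => _) = fun k => z i * c i k + \sum_(j <- r) z j * c j k).
  by split=> //; exact: cgeoD (cgeoZ _ Hi) B.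
by apply/funext => k; rewrite big_cons.
Qed.

Lemma CC_cvg {T : Type} {F : set_system T} {FF : Filter F} (u : T -> CC R) (l : CC R) :
  re (u n) @[n --> F] --> re l -> im (u n) @[n --> F] --> im l ->
  u n @[n --> F] --> l.
Proof.
move=> ur ui; apply/cvgrPdist_lt => e e0.
have [er ei] : 0 < re e /\ im e = 0.
  by move: e0; rewrite ltcE /= => /andP[/eqP ? ?].
have e20 : 0 < re e / 2 by rewrite divr_gt0.
near=> n.
have -> : e = RtoC (re e) by apply: CC_eq.
apply: (le_lt_trans (norm_le_n1 _)); rewrite ltcE /= eqxx /=.
rewrite [ltRHS]splitr /n1 ltrD //.
  rewrite reD reN; near: n; exact: (cvgr_dist_lt _ _ ur).
rewrite imD imN; near: n; exact: (cvgr_dist_lt _ _ ui).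
Unshelve. all: by end_near. Qed.

(** The partial sums have the shape produced by [expmx] and by [exp_op] at a scaled argument, so
    both exponentials are identified coordinatewise through this limit. *)
Lemma cvg_cexpser c a C t : cgeo_bounded c a C ->
  (fun n => \sum_(k < n) (k`!%:R)^-1 * (RtoC t ^+ k * c k)) @ \oo --> cexpser c t.
Proof.
move=> H.
have E k : (k`!%:R)^-1 * (RtoC t ^+ k * c k) = RtoC (t ^+ k / k`!%:R) * c k.
  by rewrite rmorphM [X in _ = _ * X * _]RtoC_inv RtoC_nat rmorphXn mulrA [_^-1 * _]mulrC.
apply: CC_cvg.
  have := @cvg_expser _ _ _ t (cgeo_re H); apply: cvg_trans; apply: near_eq_cvg; near=> n.
  rewrite re_sum; apply: eq_bigr => k _.
  by rewrite E re_RtoCM /expser_term mulrC [in RHS]mulrC mulrCA mulrA.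
have := @cvg_expser _ _ _ t (cgeo_im H); apply: cvg_trans; apply: near_eq_cvg; near=> n.
rewrite im_sum; apply: eq_bigr => k _.
by rewrite E im_RtoCM /expser_term mulrC [in RHS]mulrC mulrCA mulrA.
Unshelve. all: by end_near. Qed.

End ExponentialSeries.

(** * The matrix exponential *)

Section MatrixTopology.
Context {R : realType}.

Lemma n1_le_norm (z : CC R) (e : R) : `|z| < RtoC e -> `|re z| < e /\ `|im z| < e.
Proof.
rewrite normc_def ltcE /= => /andP[_ H].
by split; apply: le_lt_trans H; rewrite -sqrtr_sqr ler_wsqrtr // ?lerDl ?lerDr sqr_ge0.
Qed.

Lemma continuous_re : continuous (@re R).
Proof.
move=> z; apply: (@cvgrPdist_lt _ R^o _ (nbhs z) _ (@re R) (re z)).2 => e e0.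
apply/(@nbhs_ballP _ (CC R)); exists (RtoC e); first by rewrite /= ltcE /= eqxx.
by move=> w; rewrite -ball_normE /= => /n1_le_norm; rewrite !reD !reN => -[].
Qed.

Lemma continuous_im : continuous (@im R).
Proof.
move=> z; apply: (@cvgrPdist_lt _ R^o _ (nbhs z) _ (@im R) (im z)).2 => e e0.
apply/(@nbhs_ballP _ (CC R)); exists (RtoC e); first by rewrite /= ltcE /= eqxx.
by move=> w; rewrite -ball_normE /= => /n1_le_norm; rewrite !imD !imN => -[].
Qed.

Lemma mx_cvg {T : Type} {F : set_system T} {FF : Filter F} m n
    (u : T -> 'M[CC R]_(m, n)) (l : 'M[CC R]_(m, n)) :
  (forall i j, u x i j @[x --> F] --> l i j) -> u x @[x --> F] --> l.
Proof.
move=> H; apply/cvg_ballP => e e0.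
have : \forall x \near F, forall i j, ball (l i j) e (u x i j).
  apply: filter_forall => i; apply: filter_forall => j.
  by have /cvg_ballP := H i j; apply.
by apply: filterS => x Hx; split.
Qed.

Definition mcoord {N} (g : 'M[CC R]_N) (v : 'I_N * 'I_N * bool) : R :=
  if v.2 then im (g v.1.1 v.1.2) else re (g v.1.1 v.1.2).

Lemma continuous_mcoord N v : continuous (fun g : 'M[CC R]_N => mcoord g v).
Proof.
move=> g; rewrite /mcoord; case: v => [[i j] []] /=.
  by apply: (@continuous_comp _ _ _ (fun h : 'M[CC R]_N => h i j) (@im R));
    [exact: coord_continuous|exact: continuous_im].
by apply: (@continuous_comp _ _ _ (fun h : 'M[CC R]_N => h i j) (@re R));
  [exact: coord_continuous|exact: continuous_re].
Qed.

Lemma mcoord_cvg {T : Type} {F : set_system T} {FF : Filter F} N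
    (u : T -> 'M[CC R]_N) (l : 'M[CC R]_N) :
  (forall v, mcoord (u x) v @[x --> F] --> mcoord l v) -> u x @[x --> F] --> l.
Proof.
move=> H; apply: mx_cvg => i j; apply: CC_cvg.
  exact: (H (i, j, false)).
exact: (H (i, j, true)).
Qed.

Lemma mcoord_inj N (g h : 'M[CC R]_N) : mcoord g =1 mcoord h -> g = h.
Proof.
move=> H; apply/matrixP => i j; apply: CC_eq.
  exact: (H (i, j, false)).
exact: (H (i, j, true)).
Qed.

(* A closed set on which all coordinates are bounded is the closed subset of the
   image of a compact cube. *)
Lemma mx_bounded_closed_compact N (A : set 'M[CC R]_N) (M : R) :
  closed A -> (forall g, A g -> forall v, `|mcoord g v| <= M) -> compact A.
Proof.
move=> Acl AM.
pose V := ('I_N * 'I_N * bool)%type.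
pose K := [set x : 'rV[R]_#|{: V}| | forall i, `[- M, M]%classic (x ord0 i)].
have Kc : compact K by apply: (@rV_compact _ _ (fun=> `[- M, M]%classic)) => _; exact: segment_compact.
pose f (x : 'rV[R]_#|{: V}|) : 'M[CC R]_N :=
  \matrix_(i, j) cplx (x ord0 (enum_rank (i, j, false))) (x ord0 (enum_rank (i, j, true))).
have fE x v : mcoord (f x) v = x ord0 (enum_rank v).
  by case: v => [[i j] []]; rewrite /mcoord /f mxE.
have fc : continuous f.
  move=> x; apply: (@mcoord_cvg _ (nbhs x) _ _ f (f x)) => v.
  rewrite (funext (fun y => fE y v) : (fun y => mcoord (f y) v) = _) fE.
  exact: coord_continuous.
apply: (subclosed_compact Acl (continuous_compact (continuous_subspaceT fc) Kc)).
move=> g Ag; exists (\row_i mcoord g (enum_val i)).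
  by move=> i; rewrite /= mxE in_itv /= -ler_norml AM.
by apply: mcoord_inj => v; rewrite fE mxE enum_rankK.
Qed.

End MatrixTopology.

Section MatrixExponential.
Context {R : realType} {N : nat}.
Local Notation M := ('M[CC R]_N).
Implicit Type X g : M.

Definition mx_n1 X : R := \sum_i \sum_j n1 (X i j).

Lemma mx_n1_ge0 X : 0 <= mx_n1 X.
Proof. by do 2!apply: sumr_ge0 => ? _; exact: n1_ge0. Qed.

Lemma row_le_mx_n1 X i : \sum_j n1 (X i j) <= mx_n1 X.
Proof.
rewrite /mx_n1 [leRHS](bigD1 i) //= lerDl; do 2!apply: sumr_ge0 => ? _; exact: n1_ge0.
Qed.

(** The entries of the identity are at most 1, and each further factor costs at most a row sum of
    [X]. *)
Lemma mx_pow_geo X i j : cgeo_bounded (fun k => (X ^+ k) i j) 1 (mx_n1 X).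
Proof.
split=> [|k]; first exact: mx_n1_ge0.
rewrite mul1r; elim: k i j => [|k IH] i j.
  rewrite !expr0 mxE; case: (i == j); first by rewrite /= n11.
  by rewrite /= n10.
rewrite exprS exprS mxE; apply: (le_trans (n1_sum _ _ _)).
apply: (@le_trans _ _ (\sum_l n1 (X i l) * mx_n1 X ^+ k)).
  apply: ler_sum => l _; apply: (le_trans (n1M _ _)).
  by rewrite ler_wpM2l ?n1_ge0.
by rewrite -mulr_suml ler_wpM2r ?exprn_ge0 ?mx_n1_ge0 ?row_le_mx_n1.
Qed.

Lemma exprZmx (z : CC R) X k : (z *: X) ^+ k = z ^+ k *: X ^+ k.
Proof.
elim: k => [|k IH]; first by rewrite !expr0 scale1r.
by rewrite !exprS IH; change ((z *: X) *m (z ^+ k *: X ^+ k) = (z * z ^+ k) *: (X *m X ^+ k));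
  rewrite -scalemxAl -scalemxAr scalerA.
Qed.

Lemma expmxE X t i j : expmx (RtoC t *: X) i j = cexpser (fun k => (X ^+ k) i j) t.
Proof.
suff -> : expmx (RtoC t *: X) = \matrix_(i, j) cexpser (fun k => (X ^+ k) i j) t.
  by rewrite mxE.
apply/cvg_lim; first exact: norm_hausdorff.
apply: mx_cvg => a b; rewrite mxE.
have := @cvg_cexpser _ _ _ _ t (mx_pow_geo X a b).
apply: cvg_trans; apply: near_eq_cvg; near=> n.
rewrite /series /= big_mkord summxE; apply: eq_bigr => k _.
by rewrite exprZmx !mxE.
Unshelve. all: by end_near. Qed.

Lemma cderiv_mcoord (f : R -> M) t (l : M) :
  (forall i j, cderiv (fun s => f s i j) t (l i j)) ->
  forall v, is_derive t 1 (fun s => mcoord (f s) v) (mcoord l v).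
Proof. by move=> H [[i j] []]; rewrite /mcoord /=; have [] := H i j. Qed.

Lemma expmx0 X : expmx (RtoC 0 *: X) = 1%:M.
Proof. by apply/matrixP => i j; rewrite expmxE cexpser0 expr0. Qed.

Lemma is_derive_mul_expmx g X v :
  is_derive (0 : R) 1 (fun t => mcoord (g *m expmx (RtoC t *: X)) v) (mcoord (g *m X) v).
Proof.
apply: cderiv_mcoord => i j; rewrite mxE.
apply: (@cderiv_ext _ (fun s => \sum_k g i k * cexpser (fun n => (X ^+ n) k j) s)).
  by move=> s; rewrite mxE; apply: eq_bigr => k _; rewrite expmxE.
apply: cderiv_sum => k _; apply: cderivZ.
apply: cderiv_eq; first exact: (cderiv_cexpser 0 (mx_pow_geo X k j)).
by rewrite cexpser0 expr1.
Qed.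

Lemma is_derive_mx_line g X (t : R) v :
  is_derive t 1 (fun t => mcoord (g + RtoC t *: X) v) (mcoord X v).
Proof.
have E s : mcoord (g + RtoC s *: X) v = mcoord g v + s * mcoord X v.
  by case: v => [[i j] []]; rewrite /mcoord /= !mxE ?reD ?imD ?re_RtoCM ?im_RtoCM.
apply: (is_derive_ext (f := fun s => mcoord g v + s * mcoord X v)) => [s|]; first by rewrite E.
have H := is_deriveD' (is_derive_cst (mcoord g v) t 1)
  (is_deriveM' (is_derive_id t 1) (is_derive_cst (mcoord X v) t 1)).
by apply: (is_derive_eq H); rewrite add0r mul1r mulr0 addr0.
Qed.

End MatrixExponential.

(** * Smooth test functions on matrices *)

Lemma near_is_derive (R : realType) (f g : R -> R) (t l : R) :
  (\forall x \near t, f x = g x) -> is_derive t 1 f l -> is_derive t 1 g l.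
Proof. by move=> H fl; exact: (near_eq_is_derive H). Qed.

Section Bump.
Context {R : realType}.
Implicit Type p : {poly R}.

(** The flat function exp(-1/y), with a polynomial factor in 1/y that makes the family closed under
    derivation. *)
Definition bump p (y : R) : R := if 0 < y then p.[y^-1] * expR (- y^-1) else 0.

(* d/dy [p(1/y) exp(-1/y)] = ((p - p') X^2)(1/y) exp(-1/y) *)
Definition dbump p : {poly R} := 'X^2 * (p - p^`()).

Lemma monomial_expRN_le (k : nat) (z : R) : 0 <= z -> z ^+ k * expR (- z) <= k`!%:R.
Proof.
move=> z0; rewrite expRN ler_pdivrMr ?expR_gt0 //.
case: k => [|k]; first by rewrite expr0 fact0 mul1r; have := expR_ge1Dx z; lra.
have := expR_ge1Dxn k z0.
have f0 : 0 < k.+1`!%:R :> R by rewrite ltr0n fact_gt0.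
move=> H; rewrite [leRHS]mulrC -(ler_pdivrMr _ _ f0); apply: le_trans H; lra.
Qed.

Lemma bump_bounded p : exists2 C : R, 0 <= C & forall y, `|bump p y| <= C.
Proof.
exists (\sum_(i < size p) `|p`_i| * i`!%:R) => [|y].
  by apply: sumr_ge0 => i _; rewrite mulr_ge0.
have C0 : 0 <= \sum_(i < size p) `|p`_i| * i`!%:R by apply: sumr_ge0 => i _; rewrite mulr_ge0.
rewrite /bump; case: ifPn => [y0|_]; last by rewrite normr0.
rewrite horner_coef mulr_suml; apply: le_trans (ler_norm_sum _ _ _) _.
apply: ler_sum => i _; rewrite -mulrA normrM ler_wpM2l //.
have z0 : 0 <= y^-1 by rewrite invr_ge0 ltW.
rewrite ger0_norm ?mulr_ge0 ?exprn_ge0 ?expR_ge0 //; exact: monomial_expRN_le.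
Qed.

(** Exhibits y^2 times a bounded function, which forces the derivative at the origin to be 0. *)
Lemma bumpX2 p y : bump p y = y ^+ 2 * bump ('X^2 * p) y.
Proof.
rewrite /bump; case: ifPn => [y0|_]; last by rewrite mulr0.
by rewrite hornerM hornerXn; field; rewrite gt_eqF.
Qed.

Lemma is_derive_bump p (y : R) : is_derive y 1 (bump p) (bump (dbump p) y).
Proof.
have [y0|y0|<-] := ltgtP 0 y.
- apply: (@near_is_derive _ (fun y => p.[y^-1] * expR (- y^-1))).
    by near=> z; rewrite /bump ifT //; near: z; exact: lt_nbhsr.
  have yN0 : y != 0 by rewrite gt_eqF.
  have dV : is_derive y 1 (fun z : R => z^-1) (- y ^- 2).
    have := is_deriveV yN0 (is_derive_id y (1 : R)).
    by move=> /is_derive_eq; apply; rewrite /= scaler1.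
  have dp : is_derive y 1 (fun z : R => p.[z^-1]) (- y ^- 2 * p^`().[y^-1]).
    have H := is_derive_poly p y^-1.
    by apply: (is_derive_eq (@is_derive1_comp _ (fun z => p.[z]) _ _ _ _ H dV)); rewrite mulrC.
  have de : is_derive y 1 (fun z : R => expR (- z^-1)) (y ^- 2 * expR (- y^-1)).
    have dN : is_derive y 1 (fun z : R => - z^-1) (y ^- 2).
      by apply: (is_derive_eq (is_deriveN dV)); rewrite opprK.
    by apply: (is_derive_eq (@is_derive1_comp _ expR _ _ _ _ (is_derive_expR _) dN)); rewrite mulrC.
  apply: (is_derive_eq (is_deriveM' dp de)).
  rewrite /bump y0 /dbump hornerM hornerXn hornerD hornerN exprVn; ring.
- apply: (@near_is_derive _ (fun=> 0)).
    near=> z; rewrite /bump ifF //; apply/negbTE; rewrite -leNgt ltW //.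
    by near: z; exact: lt_nbhsl.
  by rewrite /bump ifF; [exact: is_derive_cst|rewrite ltNge ltW].
rewrite {2}/bump ltxx.
have [C C0 HC] := bump_bounded ('X^2 * p).
have b0 : bump p 0 = 0 by rewrite /bump ltxx.
have L : (fun h : R => h^-1 *: ((bump p \o shift 0) (h *: (1 : R)) - bump p 0)) @ 0^' --> (0 : R).
  apply/cvgrPdist_le => e e0; near=> h.
  have h0 : h != 0 by near: h; exact: nbhs_dnbhs_neq.
  rewrite sub0r normrN b0 subr0 /= addr0 bumpX2.
  rewrite [h *: 1]mulr1 /GRing.scale /= mulrA expr2 mulrA mulVf // mul1r normrM.
  (* The difference quotient at 0 is h times a function bounded by C; C + 1 replaces C to allow C =
     0. *)
  apply: (@le_trans _ _ (e / (C + 1) * C)).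
    apply: ler_pM => //; near: h; apply: dnbhs0_le; by rewrite divr_gt0 // ltr_pwDr.
  rewrite mulrAC -mulrA ler_piMr ?(ltW e0) // ler_pdivrMr ?mul1r ?lerDl ?ltr_pwDr //.
by apply: DeriveDef; [apply/cvg_ex; exists 0|apply: cvg_lim].
Unshelve. all: by end_near. Qed.

End Bump.

(* Syntax for a class of smooth functions of the coordinates [x : I -> R]; it is
   closed under derivation along any direction field given by expressions, and
   contains all polynomials and compactly supported cut-offs. *)
Inductive expr (R : realType) (I : Type) : Type :=
| Cst of R
| Var of I
| Add of expr R I & expr R I
| Mul of expr R I & expr R I
| Bmp of {poly R} & expr R I
| Inv of expr R I.
Arguments Var {R I}.
Arguments Cst {R I}.

Section Expressions.
Context {R : realType} {I : Type}.
Implicit Types (e : expr R I) (V : I -> expr R I) (x : I -> R).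

(* [Inv e] denotes 1 / (1 + e^2), which has no singularity. *)
Fixpoint eval x e : R :=
  match e with
  | Cst c => c
  | Var i => x i
  | Add a b => eval x a + eval x b
  | Mul a b => eval x a * eval x b
  | Bmp p a => bump p (eval x a)
  | Inv a => (1 + eval x a ^+ 2)^-1
  end.

(** Derivation along the vector field with components [V i]. Components are expressions, so that
    constant fields (for smoothness) and left-invariant fields (for the Laplacian) are both
    covered. *)
Fixpoint dx V e : expr R I :=
  match e with
  | Cst c => Cst 0
  | Var i => V i
  | Add a b => Add (dx V a) (dx V b)
  | Mul a b => Add (Mul (dx V a) b) (Mul a (dx V b))
  | Bmp p a => Mul (Bmp (dbump p) a) (dx V a)
  | Inv a => Mul (Mul (Mul (Cst (-2)) a) (dx V a)) (Mul (Inv a) (Inv a))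
  end.

Lemma inv_den_gt0 (y : R) : 0 < 1 + y ^+ 2.
Proof. by rewrite ltr_pwDl // sqr_ge0. Qed.

Lemma is_derive_eval V e (f : R -> I -> R) (t : R) :
  (forall i, is_derive t 1 (fun s => f s i) (eval (f t) (V i))) ->
  is_derive t 1 (fun s => eval (f s) e) (eval (f t) (dx V e)).
Proof.
move=> H; elim: e => [c|i|a IHa b IHb|a IHa b IHb|p a IHa|a IHa] //=.
- exact: is_derive_cst.
- exact: is_deriveD'.
- exact: is_deriveM'.
- exact: (@is_derive1_comp _ (bump p) _ _ _ _ (is_derive_bump _ _) IHa).
have dq : is_derive t 1 (fun s => 1 + eval (f s) a ^+ 2)
    (2 * eval (f t) a * eval (f t) (dx V a)).
  have H2 := is_deriveD' (is_derive_cst (1 : R) t 1) (is_deriveM' IHa IHa).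
  apply: (is_derive_ext (f := fun s => 1 + eval (f s) a * eval (f s) a)) => [s|].
    by rewrite expr2.
  by apply: (is_derive_eq H2); ring.
have q0 : 1 + eval (f t) a ^+ 2 != 0 by rewrite gt_eqF ?inv_den_gt0.
have H3 := @is_deriveV _ (fun s => 1 + eval (f s) a ^+ 2) t _ 1 q0 dq.
have H4 : is_derive t 1 (fun s => (1 + eval (f s) a ^+ 2)^-1)
    (- (1 + eval (f t) a ^+ 2) ^- 2 * (2 * eval (f t) a * eval (f t) (dx V a))) := H3.
by apply: (is_derive_eq H4); rewrite -exprVn expr2; ring.
Qed.

(** An arbitrary filter is allowed because the lemma serves both for continuity and for limits of
    sequences. *)
Lemma eval_cvg {T : Type} {F : set_system T} {FF : Filter F} e (f : T -> I -> R) x :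
  (forall i, f s i @[s --> F] --> x i) -> eval (f s) e @[s --> F] --> eval x e.
Proof.
move=> H; elim: e => [c|i|a IHa b IHb|a IHa b IHb|p a IHa|a IHa] //=.
- exact: cvg_cst.
- exact: cvgD.
- exact: cvgM.
- apply: (@cvg_comp _ _ _ _ (bump p) _ _ _ IHa).
  exact: (is_derive_continuous (is_derive_bump p (eval x a))).
- apply: cvgV; first by rewrite gt_eqF ?inv_den_gt0.
  apply: cvgD; first exact: cvg_cst.
  exact: cvgM.
Qed.

Fixpoint esum (s : seq (expr R I)) : expr R I :=
  if s is e :: s' then Add e (esum s') else Cst 0.

Lemma eval_esum x s : eval x (esum s) = \sum_(e <- s) eval x e.
Proof. by elim: s => [|e s IH] /=; rewrite ?big_nil // big_cons IH. Qed.

Fixpoint is_poly e : bool :=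
  match e with
  | Cst _ | Var _ => true
  | Add a b | Mul a b => is_poly a && is_poly b
  | _ => false
  end.

(** Bounds the total degree of a polynomial expression; on [Bmp] and [Inv] the value 0 is a mere
    default. *)
Fixpoint edeg e : nat :=
  match e with
  | Var _ => 1
  | Add a b => maxn (edeg a) (edeg b)
  | Mul a b => edeg a + edeg b
  | _ => 0
  end.

Lemma is_poly_dx V e : (forall i, is_poly (V i)) -> is_poly e -> is_poly (dx V e).
Proof.
by move=> HV; elim: e => //= a IHa b IHb /andP[pa pb]; rewrite ?IHa ?IHb ?pa ?pb.
Qed.

(** Left-invariant fields have linear components, hence do not raise degrees: a polynomial and its
    derivatives are dominated by the same power of the weight. *)
Lemma edeg_dx V e : (forall i, edeg (V i) <= 1)%N -> is_poly e -> (edeg (dx V e) <= edeg e)%N.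
Proof.
move=> HV; elim: e => //= a IHa b IHb /andP[pa pb].
  by rewrite geq_max !leq_max IHa // IHb // orbT.
by rewrite geq_max leq_add2r leq_add2l IHa // IHb.
Qed.

Lemma is_poly_esum s : all is_poly s -> is_poly (esum s).
Proof. by elim: s => //= e s IH /andP[-> /IH]. Qed.

Lemma edeg_esum s n : all (fun e => edeg e <= n)%N s -> (edeg (esum s) <= n)%N.
Proof. by elim: s => //= e s IH /andP[H /IH]; rewrite geq_max H. Qed.

Lemma poly_growth e : is_poly e ->
  exists2 C : R, 0 <= C & forall x (s : R), 1 <= s -> (forall i, `|x i| <= s) ->
    `|eval x e| <= C * s ^+ edeg e.
Proof.
elim: e => //= [c _|i _|a IHa b IHb /andP[/IHa[Ca Ca0 Ha] /IHb[Cb Cb0 Hb]]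
  |a IHa b IHb /andP[/IHa[Ca Ca0 Ha] /IHb[Cb Cb0 Hb]]].
- by exists `|c| => // x s _ _; rewrite expr0 mulr1.
- by exists 1 => // x s _ H; rewrite expr1 mul1r.
- exists (Ca + Cb) => [|x s s1 H]; first exact: addr_ge0.
  apply: (le_trans (ler_normD _ _)); rewrite mulrDl lerD //.
    by apply: (le_trans (Ha x s s1 H)); rewrite ler_wpM2l // ler_weXn2l // leq_maxl.
  by apply: (le_trans (Hb x s s1 H)); rewrite ler_wpM2l // ler_weXn2l // leq_maxr.
- exists (Ca * Cb) => [|x s s1 H]; first exact: mulr_ge0.
  rewrite normrM exprD mulrACA; apply: ler_pM => //; [exact: Ha|exact: Hb].
Qed.

End Expressions.

Section MatrixExpressions.
Context {R : realType} {N : nat}.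
Local Notation M := ('M[CC R]_N).
Local Notation I := ('I_N * 'I_N * bool)%type.
Implicit Types (e : expr R I) (g X v : M).

Definition evm e g : R := eval (mcoord g) e.

Lemma evm_derive e (f : R -> M) (V : I -> expr R I) (t : R) :
  (forall i, is_derive t 1 (fun s => mcoord (f s) i) (evm (V i) (f t))) ->
  is_derive t 1 (fun s => evm e (f s)) (evm (dx V e) (f t)).
Proof. exact: (@is_derive_eval _ _ V e (fun s => mcoord (f s))). Qed.

Lemma continuous_evm e : continuous (evm e).
Proof. by move=> g; apply: (@eval_cvg _ _ _ (nbhs g) _ e (@mcoord R N) (mcoord g)) => i; exact: continuous_mcoord. Qed.

Definition constant_field v : I -> expr R I := fun i => Cst (mcoord v i).

(* The coordinates of the vector field g |-> g X. *)
Definition left_field X : I -> expr R I := fun i =>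
  esum [seq (if i.2 then
         Add (Mul (Var (i.1.1, k, false)) (Cst (im (X k i.1.2))))
             (Mul (Var (i.1.1, k, true)) (Cst (re (X k i.1.2))))
       else
         Add (Mul (Var (i.1.1, k, false)) (Cst (re (X k i.1.2))))
             (Mul (Var (i.1.1, k, true)) (Cst (- im (X k i.1.2)))))
     | k <- enum 'I_N].

Lemma eval_left_field X g i : evm (left_field X i) g = mcoord (g *m X) i.
Proof.
rewrite /evm /left_field eval_esum big_map big_enum /=.
case: i => [[i j] []]; rewrite /mcoord /= mxE ?im_sum ?re_sum; apply: eq_bigr => k _ /=.
  by rewrite imM; ring.
by rewrite reM; ring.
Qed.

Lemma is_poly_left_field X i : is_poly (left_field X i).
Proof.
by apply: is_poly_esum; rewrite all_map; apply/allP => k _ /=; case: i.2.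
Qed.

Lemma edeg_left_field X i : (edeg (left_field X i) <= 1)%N.
Proof.
by apply: edeg_esum; rewrite all_map; apply/allP => k _ /=; case: i.2.
Qed.

Lemma dir_derive_evm v e : dir_derive v (evm e) = evm (dx (constant_field v) e).
Proof.
apply/funext => g; rewrite /dir_derive derive1E.
have := @evm_derive e (fun t => g + RtoC t *: v) (constant_field v) 0.
rewrite scale0r addr0 => H.
by apply: derive_val; apply: H => i; exact: is_derive_mx_line.
Qed.

(** Iterated directional derivatives of an expression are again expressions, so continuity and
    derivability need to be known only for a single expression. *)
Lemma smooth_evm e : smooth (evm e).
Proof.
move=> vs; have [e' ->] : exists e', foldr dir_derive (evm e) vs = evm e'.
  elim: vs => [|v vs [e' IH]] /=; first by exists e.
  by rewrite IH; exists (dx (constant_field v) e'); exact: dir_derive_evm.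
split=> [|v g]; first exact: continuous_evm.
have := @evm_derive e' (fun t => g + RtoC t *: v) (constant_field v) 0.
move=> H; apply: ex_derive; apply: H => i; exact: is_derive_mx_line.
Qed.

Lemma partial_xi_evm X e : partial_xi X (evm e) = evm (dx (left_field X) e).
Proof.
apply/funext => g; rewrite /partial_xi derive1E.
have := @evm_derive e (fun t => g *m expmx (RtoC t *: X)) (left_field X) 0.
rewrite expmx0 mulmx1 => H.
apply: derive_val; apply: H => i; rewrite eval_left_field; exact: is_derive_mul_expmx.
Qed.

Definition elap (beta : seq M) e : expr R I :=
  esum [seq dx (left_field X) (dx (left_field X) e) | X <- beta].

Lemma laplacian_evm beta e : laplacian beta (evm e) = evm (elap beta e).
Proof.
apply/funext => g; rewrite /laplacian /elap /evm eval_esum big_map.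
by apply: eq_bigr => X _; rewrite !partial_xi_evm.
Qed.

Lemma is_poly_elap beta e : is_poly e -> is_poly (elap beta e).
Proof.
move=> pe; apply: is_poly_esum; rewrite all_map; apply/allP => X _ /=.
by do 2!(apply: is_poly_dx; first exact: is_poly_left_field).
Qed.

End MatrixExpressions.

(** * Dynkin's formula for polynomials *)

Section RealIntegrals.
Context {d : measure_display} {T : measurableType d} {R : realType}.
Variable mu : {measure set T -> \bar R}.
Implicit Types (D : set T) (f g : T -> R).

Lemma Rintegral_EFin D f : measurable D -> mu.-integrable D (EFin \o f) ->
  (Rintegral mu D f)%:E = (\int[mu]_(x in D) (f x)%:E)%E.
Proof. by move=> mD H; rewrite /Rintegral fineK //; exact: integrable_fin_num. Qed.

Lemma integrable_measurable D f : mu.-integrable D (EFin \o f) -> measurable_fun D f.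
Proof. by move=> /measurable_int /measurable_EFinP. Qed.

Lemma integrable_dom D f g : measurable D -> measurable_fun D f ->
  mu.-integrable D (EFin \o g) -> (forall x, D x -> `|f x| <= g x) ->
  mu.-integrable D (EFin \o f).
Proof.
move=> mD mf ig fg; apply: (le_integrable mD _ _ ig); first exact/measurable_EFinP.
by move=> x Dx /=; rewrite lee_fin (le_trans (fg x Dx)) // ler_norm.
Qed.

Lemma Rdominated D (f_ : nat -> T -> R) f g : measurable D ->
  (forall n, measurable_fun D (f_ n)) ->
  (forall x, D x -> f_ n x @[n --> \oo] --> f x) ->
  mu.-integrable D (EFin \o g) -> (forall n x, D x -> `|f_ n x| <= g x) ->
  mu.-integrable D (EFin \o f) /\
  Rintegral mu D (f_ n) @[n --> \oo] --> Rintegral mu D f.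
Proof.
move=> mD mf_ cf ig fg.
have mf : measurable_fun D f by exact: (measurable_fun_cvg mf_ cf).
have [|||||If _ C] := @dominated_convergence _ _ _ mu D mD (fun n x => (f_ n x)%:E)
  (EFin \o f) (EFin \o g).
- by move=> n; exact/measurable_EFinP.
- exact/measurable_EFinP.
- by apply: aeW => x Dx; apply/fine_cvgP; split; [exact: nearW|exact: cf].
- exact: ig.
- by apply: aeW => x n Dx; rewrite lee_fin; exact: fg.
split=> //.
have Ifn n : mu.-integrable D (EFin \o f_ n) by exact: (integrable_dom mD (mf_ n) ig (fg n)).
have := fine_cvg (_ : (_ @ \oo --> (Rintegral mu D f)%:E)); apply.
by rewrite Rintegral_EFin.
Qed.

Lemma Rfatou D (f_ : nat -> T -> R) f (C : R) : measurable D ->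
  (forall n x, D x -> 0 <= f_ n x) ->
  (forall n, mu.-integrable D (EFin \o f_ n)) ->
  (forall x, D x -> f_ n x @[n --> \oo] --> f x) ->
  (forall n, Rintegral mu D (f_ n) <= C) ->
  mu.-integrable D (EFin \o f) /\ Rintegral mu D f <= C.
Proof.
move=> mD f0 If cf fC.
have mf_ n : measurable_fun D (f_ n) by exact: integrable_measurable.
have mf : measurable_fun D f by exact: (measurable_fun_cvg mf_ cf).
have fx0 x : D x -> 0 <= f x.
  move=> Dx; have fx := cf x Dx; rewrite -(cvg_lim _ fx) //.
  by apply: limr_ge; [apply/cvg_ex; exists (f x)|apply: nearW => n; exact: f0].
have F := @fatou _ _ _ mu D mD (fun n x => (f_ n x)%:E)
  (fun n => (measurable_EFinP _ _).2 (mf_ n)) (fun n x Dx => (f0 n x Dx : (0 <= (f_ n x)%:E)%E)).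
have LC : (\int[mu]_(x in D) (f x)%:E <= C%:E)%E.
  apply: (@le_trans _ _ (\int[mu]_(x in D) limn_einf (fun n => (f_ n x)%:E))%E).
    rewrite le_eqVlt; apply/orP; left; apply/eqP; apply: eq_integral => x.
    rewrite inE => Dx; have cE : (fun n => (f_ n x)%:E) @ \oo --> (f x)%:E.
      by apply/fine_cvgP; split; [exact: nearW|exact: cf].
    by have [-> _] := cvg_limn_einf_sup cE.
  apply: (le_trans F); rewrite limn_einf_lim; apply: lime_le; first exact: is_cvg_einfs.
  apply: nearW => n; apply: (@le_trans _ _ (\int[mu]_(x in D) (f_ n x)%:E)%E).
    by apply: ereal_inf_lbound; exists n => /=.
  by rewrite -Rintegral_EFin // lee_fin.
have I : mu.-integrable D (EFin \o f).
  apply/integrableP; split; first exact/measurable_EFinP.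
  apply: (@le_lt_trans _ _ C%:E); last exact: ltry.
  apply: le_trans LC; rewrite le_eqVlt; apply/orP; left; apply/eqP; apply: eq_integral => x.
  by rewrite inE => Dx /=; rewrite ger0_norm // fx0.
by split=> //; rewrite -lee_fin Rintegral_EFin.
Qed.

End RealIntegrals.

Section JointMeasurability.
Context {d : measure_display} {Omega : measurableType d} {R : realType}.
Variable Pr : probability Omega R.
Local Notation leb := (@lebesgue_measure R).
Variable F : R -> Omega -> R.
Hypothesis mF : forall u, 0 <= u -> measurable_fun setT (F u).
Hypothesis cF : forall w, {within [set u : R | 0 <= u], continuous (fun u => F u w)}.

Let Dpos : set (Omega * R) := [set z | 0 <= z.2].

Lemma measurable_Dpos : measurable Dpos.
Proof.
have -> : Dpos = setT `*` `[0, +oo[%classic.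
  by apply/seteqP; split=> z; rewrite /Dpos /= in_itv /= andbT // => -[].
by apply: measurableX => //; exact: measurable_itv.
Qed.

(* A continuous process is the pointwise limit of its left-endpoint step
   approximations, which are jointly measurable. *)
Lemma joint_measurable : measurable_fun Dpos (fun z => F z.2 z.1).
Proof.
pose q n (u : R) : R := (Num.truncn (n.+1%:R * u))%:R / n.+1%:R.
have q0 n u : 0 <= q n u by rewrite /q divr_ge0.
apply: (@measurable_fun_cvg _ _ _ Dpos (fun n z => F (q n z.2) z.1)) => [n|[w u] /= u0].
  move=> _ Y mY.
  have -> : Dpos `&` (fun z => F (q n z.2) z.1) @^-1` Y =
    \bigcup_k ((F (k%:R / n.+1%:R) @^-1` Y) `*` `[(k%:R / n.+1%:R : R), (k.+1%:R / n.+1%:R)[%classic).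
    apply/seteqP; split=> [[w u] /= [u0 H]|[w u] [k _ /= [H]]].
      exists (Num.truncn (n.+1%:R * u)) => //=; split=> //.
      have nu0 : 0 <= n.+1%:R * u by rewrite mulr_ge0.
      rewrite in_itv /= ler_pdivrMr ?ltr_pdivlMr // mulrC.
      by apply: truncn_itv; rewrite mulrC.
    rewrite in_itv /= => /andP[h1 h2].
    have u0 : 0 <= u by apply: le_trans h1; rewrite divr_ge0.
    split=> //; rewrite /q /=.
    suff -> : Num.truncn (n.+1%:R * u) = k by [].
    apply/eqP; rewrite truncn_eq ?mulr_ge0 //.
    by move: h1 h2; rewrite ler_pdivrMr ?ltr_pdivlMr // mulrC => -> ->.
  apply: bigcup_measurable => k _; apply: measurableX; last exact: measurable_itv.
  by rewrite -[X in measurable X]setTI; apply: mF => //; rewrite divr_ge0.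
have qu : q n u @[n --> \oo] --> u.
  apply/cvgrPdist_le => e e0; near=> n.
  have n0 : 0 < n.+1%:R :> R by [].
  have nu0 : 0 <= n.+1%:R * u by rewrite mulr_ge0.
  rewrite /q -[X in `|X - _|](mulfK (lt0r_neq0 n0)) -mulrBl normrM normfV.
  rewrite [X in _ / X]ger0_norm // ler_pdivrMr //.
  apply: (@le_trans _ _ 1); last first.
    rewrite -ler_pdivrMr // div1r ltW //; near: n.
    exact: (near_infty_natSinv_lt (PosNum e0)).
  have h1 := truncn_le (n.+1%:R * u); rewrite nu0 in h1.
  have h2 := truncnS_gt (n.+1%:R * u).
  rewrite ger0_norm; rewrite mulrC; move: h1 h2; rewrite -natr1; lra.
have H := (subspace_continuousP _ _).1 (@cF w) u u0.
apply: (cvg_comp _ _ _ H) => U HU.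
have HU' : \forall n \near \oo, 0 <= q n u -> U (q n u) := qu _ HU.
change (\forall n \near \oo, U (q n u)).
by apply: filterS HU' => n; apply.
Unshelve. all: by end_near. Qed.

(** The uniform bound [C] on first absolute moments makes the iterated integral of the absolute
    value finite on the strip, which is what Fubini's theorem asks for. *)
Lemma process_fubini (t C : R) : 0 <= t ->
  (forall u, 0 <= u <= t -> Pr.-integrable setT (EFin \o F u)) ->
  (forall u, 0 <= u <= t -> Rintegral Pr setT (fun w => `|F u w|) <= C) ->
  [/\ Pr.-integrable setT (EFin \o (fun w => Rintegral leb `[0, t] (F^~ w))),
     leb.-integrable `[0, t] (EFin \o (fun u => Rintegral Pr setT (F u))) &
     Rintegral Pr setT (fun w => Rintegral leb `[0, t] (F^~ w)) =
     Rintegral leb `[0, t] (fun u => Rintegral Pr setT (F u))].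
Proof.
move=> t0 iF FC.
have mI : measurable (`[0, t]%classic : set R) by exact: measurable_itv.
have mI2 : measurable ([set: Omega] `*` (`[0, t]%classic : set R)) by exact: measurableX.
(* The process is controlled only at nonnegative times; extension by 0 outside the strip gives a
   function measurable on the whole product. *)
pose G : Omega * R -> \bar R := EFin \o ((fun z => F z.2 z.1) \_ ([set: Omega] `*` `[0, t]%classic)).
have mG : measurable_fun setT G.
  apply/measurable_EFinP; apply/(measurable_restrictT _ mI2).
  apply: measurable_funS joint_measurable; first exact: measurable_Dpos.
  by move=> [w u] /= [_]; rewrite in_itv /= => /andP[].
have mAG : measurable_fun setT (abse \o G).
  first [exact: (measurableT_comp _ mG)
    | apply: (@measurable_comp _ _ _ _ _ _ setT); [exact: measurableT|by []|exact: abse_measurable|exact: mG]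
    | move=> _ Y mY; rewrite setTI comp_preimage -[X in measurable X]setTI; apply: mG => //; rewrite -[X in measurable X]setTI; exact: abse_measurable].
have GE w u : G (w, u) = (((fun u => (F u w)%:E) \_ `[0, t]%classic) u).
  rewrite /G /= !patchE; case: ifPn => H; case: ifPn => H' //.
    by move: H H'; rewrite inE /= => -[_ H]; rewrite notin_setE.
  by move: H H'; rewrite notin_setE inE /= => H H'; exfalso; apply: H.
have iG : (Pr \x leb)%E.-integrable setT G.
  apply/integrable21ltyP => //.
  apply: (@le_lt_trans _ _ (\int[leb]_(u in `[0%R, t]) C%:E)%E); last first.
    by rewrite integral_cst //= lebesgue_measure_itv /=; case: ifPn => _;
      rewrite ?mule0 ?ltry // -EFinB -EFinM ltry.
  rewrite [leRHS]integral_mkcond; apply: ge0_le_integral => //.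
  - by move=> u _; apply: integral_ge0.
  - by apply: (@measurable_fun_fubini_tonelli_G _ _ _ _ _ Pr (abse \o G)) => // z;
      exact: abse_ge0.
  - by apply/(measurable_restrictT _ mI).
  move=> u _; rewrite patchE; case: ifPn => [/[1!inE] /= H|H].
    rewrite (eq_integral (fun w => (`|F u w|)%:E)) => [|w _].
      rewrite -Rintegral_EFin //; first by rewrite lee_fin FC.
      by apply: integrable_norm; exact: iF.
    change (`|G (w, u)| = `|(F u w)%:E|)%E.
    by rewrite GE patchE mem_set.
  by rewrite integral0_eq // => w _; rewrite GE patchE (negbTE H) abse0.
have E1 w : (\int[leb]_u G (w, u))%E = (Rintegral leb `[0, t] (F^~ w))%:E.
  rewrite Rintegral_EFin //.
    by rewrite [RHS]integral_mkcond; apply: eq_integral => u _; rewrite GE.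
  apply: continuous_compact_integrable; first exact: segment_compact.
  apply: continuous_subspaceW (@cF w) => u /=; by rewrite in_itv /= => /andP[].
have E2 u : `[0, t]%classic u -> (\int[Pr]_w G (w, u))%E = (Rintegral Pr setT (F u))%:E.
  move=> Hu; rewrite Rintegral_EFin //; last by apply: iF; move: Hu; rewrite /= in_itv.
  by apply: eq_integral => w _; rewrite GE patchE mem_set.
have E2' : (fun u => \int[Pr]_w G (w, u))%E =
    (fun u => (Rintegral Pr setT (F u))%:E) \_ `[0, t]%classic.
  apply/funext => u; rewrite patchE; case: ifPn => [/[1!inE] Hu|Hu]; first by rewrite E2.
  by rewrite integral0_eq // => w _; rewrite GE patchE (negbTE Hu).
have I1 : Pr.-integrable setT (EFin \o (fun w => Rintegral leb `[0, t] (F^~ w))).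
  have := integrable_fubini_F iG.
  by rewrite (_ : fubini_F _ _ = EFin \o (fun w => Rintegral leb `[0, t] (F^~ w))) //;
    apply/funext => w; exact: E1.
have I2 : leb.-integrable `[0, t] (EFin \o (fun u => Rintegral Pr setT (F u))).
  apply: (@integrable_dom _ _ _ leb _ _ (fun=> C)) => //.
  - apply/measurable_EFinP; apply/(measurable_restrictT _ mI).
    by have := measurable_fubini_G iG; rewrite /fubini_G E2'.
  - by apply: continuous_compact_integrable; [exact: segment_compact|
      apply: continuous_subspaceT => x; exact: cvg_cst].
  - move=> u; rewrite /= in_itv /= => Hu; apply: le_trans (FC u Hu).
    by apply: le_normr_Rintegral => //; exact: iF.
split=> //; apply: EFin_inj; rewrite !Rintegral_EFin // [RHS]integral_mkcond -E2'.
by rewrite -(Fubini iG); apply: eq_integral => w _; rewrite E1.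
Qed.

End JointMeasurability.

Section ComplexPolynomialFunctions.
Context {R : realType} {I : Type}.
Implicit Types (f g : (I -> R) -> CC R).

(** Real coordinates are used because adjoints bring in complex conjugates, which are polynomial
    only over the reals. *)
Definition cpolyfun f := exists er ei : expr R I, [/\ is_poly er, is_poly ei &
  forall x, f x = cplx (eval x er) (eval x ei)].

Lemma cpolyfun_ext f g : f =1 g -> cpolyfun f -> cpolyfun g.
Proof. by move=> fg [er [ei [? ? H]]]; exists er, ei; split=> // x; rewrite -fg. Qed.

Lemma cpolyfun_cst z : cpolyfun (fun=> z).
Proof. by exists (Cst (re z)), (Cst (im z)); split=> // x; apply: CC_eq. Qed.

Lemma cpolyfun_var (i j : I) : cpolyfun (fun x => cplx (x i) (x j)).
Proof. by exists (Var i), (Var j). Qed.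

Lemma cpolyfunD f g : cpolyfun f -> cpolyfun g -> cpolyfun (fun x => f x + g x).
Proof.
move=> [ar [ai [p1 p2 E]]] [br [bi [p3 p4 F]]].
exists (Add ar br), (Add ai bi); split=> [||x] /=; rewrite ?p1 ?p2 ?p3 ?p4 //.
by rewrite E F; apply: CC_eq; rewrite ?reD ?imD.
Qed.

Lemma cpolyfunM f g : cpolyfun f -> cpolyfun g -> cpolyfun (fun x => f x * g x).
Proof.
move=> [ar [ai [p1 p2 E]]] [br [bi [p3 p4 F]]].
exists (Add (Mul ar br) (Mul (Cst (-1)) (Mul ai bi))), (Add (Mul ar bi) (Mul ai br)).
split=> [||x] /=; rewrite ?p1 ?p2 ?p3 ?p4 //.
by rewrite E F; apply: CC_eq; rewrite ?reM ?imM /= ?mulN1r.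
Qed.

Lemma cpolyfun_conj f : cpolyfun f -> cpolyfun (fun x => Num.conj (f x)).
Proof.
move=> [ar [ai [p1 p2 E]]]; exists ar, (Mul (Cst (-1)) ai); split=> // x.
by rewrite E; apply: CC_eq; rewrite ?re_conj ?im_conj /= ?mulN1r.
Qed.

Lemma cpolyfun_sum K (r : seq K) (p : pred K) (f : K -> (I -> R) -> CC R) :
  (forall i, p i -> cpolyfun (f i)) -> cpolyfun (fun x => \sum_(i <- r | p i) f i x).
Proof.
move=> H; elim: r => [|i r IH].
  by apply: cpolyfun_ext (cpolyfun_cst 0) => x; rewrite big_nil.
case: (boolP (p i)) => pi.
  by apply: cpolyfun_ext (cpolyfunD (H i pi) IH) => x; rewrite big_cons pi.
by apply: cpolyfun_ext IH => x; rewrite big_cons (negbTE pi).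
Qed.

Lemma cpolyfun_prod K (r : seq K) (p : pred K) (f : K -> (I -> R) -> CC R) :
  (forall i, p i -> cpolyfun (f i)) -> cpolyfun (fun x => \prod_(i <- r | p i) f i x).
Proof.
move=> H; elim: r => [|i r IH].
  by apply: cpolyfun_ext (cpolyfun_cst 1) => x; rewrite big_nil.
case: (boolP (p i)) => pi.
  by apply: cpolyfun_ext (cpolyfunM (H i pi) IH) => x; rewrite big_cons pi.
by apply: cpolyfun_ext IH => x; rewrite big_cons (negbTE pi).
Qed.

End ComplexPolynomialFunctions.

Lemma norm_mul_le (R : realDomainType) (u v U V : R) :
  `|u| <= U -> `|v| <= V -> `|u * v| <= U * V.
Proof. by move=> uU vV; rewrite normrM ler_pM. Qed.

(** * Weights, Lyapunov functions and cut-offs on the general linear group *)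

Section Cutoffs.
Context {R : realType} {N : nat}.
Local Notation M := ('M[CC R]_N).
Local Notation I := ('I_N * 'I_N * bool)%type.
Implicit Types (e a b : expr R I) (g X : M).

Definition pd X e := dx (left_field X) e.

(** The weight 1 + |g|^2 in real coordinates; the summand 1 makes its powers increase with the
    exponent. *)
Definition eW : expr R I := Add (Cst 1) (esum [seq Mul (Var v) (Var v) | v <- enum {: I}]).

Lemma evm_eW g : evm eW g = 1 + \sum_v mcoord g v ^+ 2.
Proof.
rewrite /evm /= eval_esum big_map big_enum /=.
by congr (_ + _); apply: eq_bigr => v _; rewrite expr2.
Qed.

Lemma eW_ge1 g : 1 <= evm eW g.
Proof. by rewrite evm_eW lerDl; apply: sumr_ge0 => v _; exact: sqr_ge0. Qed.

Lemma mcoord_le_sqrt_eW g v : `|mcoord g v| <= Num.sqrt (evm eW g).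
Proof.
rewrite -sqrtr_sqr; apply: ler_wsqrtr; rewrite evm_eW (bigD1 v) //=.
have : 0 <= \sum_(i | i != v) mcoord g i ^+ 2 by apply: sumr_ge0 => i _; exact: sqr_ge0.
have := sqr_ge0 (mcoord g v); lra.
Qed.

Lemma sqrt_eW_ge1 g : 1 <= Num.sqrt (evm eW g).
Proof. by rewrite -[X in X <= _]sqrtr1 ler_wsqrtr // eW_ge1. Qed.

Lemma evm_growth e n : is_poly e -> (edeg e <= n)%N ->
  exists2 C : R, 0 <= C & forall g, `|evm e g| <= C * Num.sqrt (evm eW g) ^+ n.
Proof.
move=> /poly_growth[C C0 H] en; exists C => // g.
apply: (le_trans (H _ _ (sqrt_eW_ge1 g) (mcoord_le_sqrt_eW g))).
by rewrite ler_wpM2l // ler_weXn2l // sqrt_eW_ge1.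
Qed.

Lemma is_poly_pd X e : is_poly e -> is_poly (pd X e).
Proof. exact/is_poly_dx/is_poly_left_field. Qed.

Lemma edeg_pd X e : is_poly e -> (edeg (pd X e) <= edeg e)%N.
Proof. exact/edeg_dx/edeg_left_field. Qed.

Lemma is_poly_eW : is_poly eW.
Proof. by rewrite /=; apply: is_poly_esum; rewrite all_map; apply/allP. Qed.

Lemma edeg_eW : (edeg eW <= 2)%N.
Proof. by rewrite /= max0n; apply: edeg_esum; rewrite all_map; apply/allP. Qed.

(* [slow] functions serve both as Lyapunov functions and as weights. *)
Definition slow X a (C : R) := forall g,
  [/\ 0 <= evm a g, `|evm (pd X a) g| <= C * evm a g & `|evm (pd X (pd X a)) g| <= C * evm a g].

(** Derivatives along a linear field remain polynomials of degree at most 2, hence are O(1 +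
    |g|^2). *)
Lemma slow_eW X : exists2 C : R, 0 <= C & slow X eW C.
Proof.
have p1 := is_poly_pd X is_poly_eW; have p2 := is_poly_pd X p1.
have d1 : (edeg (pd X eW) <= 2)%N := leq_trans (edeg_pd X is_poly_eW) edeg_eW.
have d2 : (edeg (pd X (pd X eW)) <= 2)%N := leq_trans (edeg_pd X p1) d1.
have [C1 C10 H1] := evm_growth p1 d1; have [C2 C20 H2] := evm_growth p2 d2.
exists (C1 + C2) => [|g]; first exact: addr_ge0.
have W0 : 0 <= evm eW g by apply: le_trans (eW_ge1 g).
have := H1 g; have := H2 g; rewrite sqr_sqrtr // => h2 h1.
split=> //; rewrite mulrDl; first by apply: (le_trans h1); rewrite lerDl mulr_ge0.
by apply: (le_trans h2); rewrite lerDr mulr_ge0.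
Qed.

Lemma slow_cst X (c : R) : 0 <= c -> slow X (Cst c) 0.
Proof. by move=> c0 g; rewrite /evm /= normr0 mul0r. Qed.

(** By the product rule, XX(ab) = (XXa) b + 2 (Xa)(Xb) + a (XXb), whence the constant. *)
Lemma slow_mul X a b (C D : R) : 0 <= C -> 0 <= D -> slow X a C -> slow X b D ->
  slow X (Mul a b) (C + D + 2 * (C * D)).
Proof.
move=> C0 D0 Ha Hb g; have [a0 a1 a2] := Ha g; have [b0 b1 b2] := Hb g.
move: a0 a1 a2 b0 b1 b2; rewrite /evm /=.
set x := eval _ a; set x1 := eval _ (pd X a); set x2 := eval _ (pd X (pd X a)).
set y := eval _ b; set y1 := eval _ (pd X b); set y2 := eval _ (pd X (pd X b)).
move=> a0 a1 a2 b0 b1 b2; split; first exact: mulr_ge0.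
  apply: (le_trans (ler_normD _ _)); rewrite !normrM (ger0_norm a0) (ger0_norm b0).
  have := ler_wpM2r b0 a1; have := ler_wpM2l a0 b1.
  have : 0 <= C * D * (x * y) by rewrite !mulr_ge0.
  by rewrite !mulrDl !mulrA; lra.
have h1 : `|x2 * y| <= C * x * y by apply: norm_mul_le => //; rewrite ger0_norm.
have h2 : `|x1 * y1| <= (C * x) * (D * y) by apply: norm_mul_le.
have h3 : `|x * y2| <= x * (D * y) by apply: norm_mul_le => //; rewrite ger0_norm.
have t1 := ler_normD (x2 * y + x1 * y1) (x1 * y1 + x * y2).
have t2 := ler_normD (x2 * y) (x1 * y1); have t3 := ler_normD (x1 * y1) (x * y2).
lra.
Qed.

Fixpoint epow a (m : nat) : expr R I := if m is m'.+1 then Mul a (epow a m') else Cst 1.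

Lemma evm_epow a m g : evm (epow a m) g = evm a g ^+ m.
Proof. by rewrite /evm; elim: m => //= m ->; rewrite exprS. Qed.

Lemma slow_epow X a C m : 0 <= C -> slow X a C -> exists2 D : R, 0 <= D & slow X (epow a m) D.
Proof.
move=> C0 aC; elim: m => [|m [D D0 IH]]; first by exists 0 => //; exact: slow_cst.
exists (C + D + 2 * (C * D)); last exact: slow_mul.
by rewrite !addr_ge0 // mulr_ge0 // mulr_ge0.
Qed.

(** Write x for the value of [a] and J = 1/(1 + x^2), so that x^2 J <= 1. The first derivative costs
    2C. In the second one, the terms with (Xx)^2, x XXx and the derivative of J^2 cost 2C^2, 2C and
    8C^2. *)
Lemma slow_inv X a C : 0 <= C -> slow X a C -> slow X (Inv a) (2 * C + 10 * C ^+ 2).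
Proof.
move=> C0 Ha g; have [a0 a1 a2] := Ha g.
move: a0 a1 a2; rewrite /evm /=.
set x := eval _ a; set x1 := eval _ (pd X a); set x2 := eval _ (pd X (pd X a)).
move=> a0 a1 a2; set J := (1 + x ^+ 2)^-1.
have J0 : 0 < J by rewrite invr_gt0 inv_den_gt0.
have xJ : x ^+ 2 * J <= 1.
  by rewrite /J ler_pdivrMr ?inv_den_gt0 // mul1r lerDr.
have x2x : `|x * x1| <= C * x ^+ 2.
  rewrite (_ : C * x ^+ 2 = x * (C * x)); last by ring.
  by apply: norm_mul_le => //; rewrite ger0_norm.
have J0' := ltW J0.
have bnd (u c : R) : 0 <= c -> `|u| <= c * x ^+ 2 -> `|u * (J * J)| <= c * J.
  move=> c0 uc; apply: (@le_trans _ _ (c * x ^+ 2 * (J * J))).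
    by apply: norm_mul_le => //; rewrite ger0_norm // mulr_ge0.
  have -> : c * x ^+ 2 * (J * J) = (c * J) * (x ^+ 2 * J) by ring.
  by rewrite ler_piMr // mulr_ge0.
set D1 := -2 * x * x1 * (J * J).
have D1le : `|D1| <= 2 * C * J.
  apply: bnd; first by rewrite mulr_ge0.
  have -> : -2 * x * x1 = -2 * (x * x1) by ring.
  rewrite normrM -mulrA; apply: ler_pM => //; by rewrite normrN ger0_norm.
have C10 : 0 <= 10 * C ^+ 2 * J by rewrite !mulr_ge0 // exprn_ge0.
split=> //; first by apply: (le_trans D1le); lra.
have E : ((0 * x + -2 * x1) * x1 + -2 * x * x2) * (J * J) + -2 * x * x1 * (D1 * J + J * D1) =
  -2 * (x1 * x1) * (J * J) + -2 * (x * x2) * (J * J) + -4 * (x * x1) * D1 * J by ring.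
rewrite E.
have h1 : `|-2 * (x1 * x1) * (J * J)| <= 2 * C ^+ 2 * J.
  apply: bnd; first by rewrite mulr_ge0 // exprn_ge0.
  rewrite (_ : 2 * C ^+ 2 * x ^+ 2 = 2 * ((C * x) * (C * x))); last by ring.
  by apply: norm_mul_le; [rewrite normrN ger0_norm|exact: norm_mul_le].
have h2 : `|-2 * (x * x2) * (J * J)| <= 2 * C * J.
  apply: bnd; first by rewrite mulr_ge0.
  rewrite (_ : 2 * C * x ^+ 2 = 2 * (x * (C * x))); last by ring.
  by apply: norm_mul_le; [rewrite normrN ger0_norm|apply: norm_mul_le => //; rewrite ger0_norm].
have h3 : `|-4 * (x * x1) * D1 * J| <= 8 * C ^+ 2 * J.
  apply: (@le_trans _ _ (4 * (C * x ^+ 2) * (2 * C * J) * J)).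
    apply: norm_mul_le; last by rewrite ger0_norm.
    by apply: norm_mul_le => //; apply: norm_mul_le => //; rewrite normrN ger0_norm.
  have -> : 4 * (C * x ^+ 2) * (2 * C * J) * J = (8 * C ^+ 2 * J) * (x ^+ 2 * J) by ring.
  by rewrite ler_piMr // !mulr_ge0 // exprn_ge0.
apply: (le_trans (ler_normD _ _)); apply: (le_trans (lerD (ler_normD _ _) h3)).
lra.
Qed.

(* The bounds are uniform in n, so that dominated convergence applies to the
   martingale problem for a test function multiplied by the cut-offs. *)
Definition cutoff_family (chi : nat -> expr R I) (c : R) := forall X,
  (exists2 K : R, 0 <= K & forall n g, [/\ `|evm (chi n) g| <= K,
     `|evm (pd X (chi n)) g| <= K & `|evm (pd X (pd X (chi n))) g| <= K]) /\
  (forall g, g \in unitmx -> [/\ evm (chi n) g @[n --> \oo] --> c,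
     evm (pd X (chi n)) g @[n --> \oo] --> (0 : R) &
     evm (pd X (pd X (chi n))) g @[n --> \oo] --> (0 : R)]).

Lemma cutoff_mul chi psi c d : cutoff_family chi c -> cutoff_family psi d ->
  cutoff_family (fun n => Mul (chi n) (psi n)) (c * d).
Proof.
move=> H1 H2 X; have [[K K0 HK] L1] := H1 X; have [[K' K'0 HK'] L2] := H2 X; split.
  exists (4 * (K * K')) => [|n g]; first by rewrite !mulr_ge0.
  have [] := HK n g; have [] := HK' n g; rewrite /evm /= => b0 b1 b2 a0 a1 a2.
  have NM := @norm_mul_le R.
  have KK : 0 <= K * K' by rewrite mulr_ge0.
  split; first by apply: (le_trans (NM _ _ _ _ a0 b0)); lra.
    apply: (le_trans (ler_normD _ _)).
    by apply: (le_trans (lerD (NM _ _ _ _ a1 b0) (NM _ _ _ _ a0 b1))); lra.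
  apply: (le_trans (ler_normD _ _)).
  apply: (le_trans (lerD (ler_normD _ _) (ler_normD _ _))).
  have := lerD (lerD (NM _ _ _ _ a2 b0) (NM _ _ _ _ a1 b1)) (lerD (NM _ _ _ _ a1 b1) (NM _ _ _ _ a0 b2)).
  by move=> h; apply: (le_trans h); lra.
move=> g gu; have [a0 a1 a2] := L1 g gu; have [b0 b1 b2] := L2 g gu.
rewrite /evm /=; split; first exact: cvgM.
  have := cvgD (cvgM a1 b0) (cvgM a0 b1); rewrite mul0r mulr0 addr0; exact.
have := cvgD (cvgD (cvgM a2 b0) (cvgM a1 b1)) (cvgD (cvgM a1 b1) (cvgM a0 b2)).
rewrite !mul0r !mulr0 !addr0; exact.
Qed.

Lemma cutoff_cst c : cutoff_family (fun=> Cst c) c.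
Proof.
move=> X; split; last by move=> g _; split; exact: cvg_cst.
by exists `|c| => // n g; rewrite /evm /= normr0.
Qed.

Lemma bump_cvg p (u : nat -> R) (l : R) : u n @[n --> \oo] --> l ->
  bump p (u n) @[n --> \oo] --> bump p l.
Proof.
move=> ul; apply: (cvg_comp _ _ ul).
exact: (is_derive_continuous (is_derive_bump p l)).
Qed.

Lemma bump_cvg_pinfty p (u : nat -> R) : u n @[n --> \oo] --> +oo ->
  bump p (u n) @[n --> \oo] --> p.[0].
Proof.
move=> ul.
have u0 : \forall n \near \oo, 0 < u n by apply: (cvgryPgt u).1.
have vl : (u n)^-1 @[n --> \oo] --> (0 : R) by apply/(gtr0_cvgV0 u0).
have H : p.[(u n)^-1] * expR (- (u n)^-1) @[n --> \oo] --> p.[0] * expR (- 0).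
  apply: cvgM.
    apply: (cvg_comp _ _ vl); exact: (@is_derive_continuous _ _ _ _ (is_derive_poly p 0)).
  apply: (@cvg_comp _ _ _ (fun n => - (u n)^-1) expR _ (nbhs (- 0 : R))).
    exact: cvgN.
  exact: continuous_expR.
rewrite oppr0 expR0 mulr1 in H.
apply: cvg_trans H; apply: near_eq_cvg; near=> n.
by rewrite /bump ifT //; near: n; exact: u0.
Unshelve. all: by end_near. Qed.

Lemma cvg_oppSV : (- n.+1%:R^-1 : R) @[n --> \oo] --> (0 : R).
Proof. by rewrite -oppr0; apply: cvgN; exact: cvg_harmonic. Qed.

(** Vanishes where [eW] is at least n + 1, and tends to exp(-1), not 1, as n grows. *)
Definition chiA n : expr R I := Bmp 1 (Add (Cst 1) (Mul (Cst (- n.+1%:R^-1)) eW)).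

Lemma evm_pd_bmp X p a u v g :
  evm (pd X (Bmp p (Add (Cst u) (Mul (Cst v) a)))) g =
  bump (dbump p) (u + v * evm a g) * (v * evm (pd X a) g).
Proof. by rewrite /pd /evm /= mul0r !add0r. Qed.

Lemma evm_pd2_bmp X p a u v g :
  evm (pd X (pd X (Bmp p (Add (Cst u) (Mul (Cst v) a))))) g =
  bump (dbump (dbump p)) (u + v * evm a g) * (v * evm (pd X a) g) * (v * evm (pd X a) g) +
  bump (dbump p) (u + v * evm a g) * (v * evm (pd X (pd X a)) g).
Proof. by rewrite /pd /evm /= !mul0r !add0r. Qed.

Lemma cutoff_chiA : cutoff_family chiA (bump 1 1).
Proof.
move=> X; set p1 := dbump (1 : {poly R}); set p2 := dbump p1.
pose W1 g := evm (pd X eW) g; pose W2 g := evm (pd X (pd X eW)) g.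
pose c n : R := - n.+1%:R^-1.
have E0 n g : evm (chiA n) g = bump 1 (1 + c n * evm eW g) by [].
have E1 n g : evm (pd X (chiA n)) g = bump p1 (1 + c n * evm eW g) * (c n * W1 g).
  exact: evm_pd_bmp.
have E2 n g : evm (pd X (pd X (chiA n))) g =
    bump p2 (1 + c n * evm eW g) * (c n * W1 g) * (c n * W1 g) +
    bump p1 (1 + c n * evm eW g) * (c n * W2 g).
  exact: evm_pd2_bmp.
have [C C0 HC] := slow_eW X.
have [K0 K00 B0] := bump_bounded (1 : {poly R}); have [K1 K10 B1] := bump_bounded p1.
have [K2 K20 B2] := bump_bounded p2.
split.
  exists (K0 + K1 * C + K2 * C * C) => [|n g]; first by rewrite !addr_ge0 // !mulr_ge0.
  rewrite E0 E1 E2.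
  have n0 : 0 < n.+1%:R :> R by [].
  have cn0 : `|c n| = n.+1%:R^-1 by rewrite normrN ger0_norm // invr_ge0.
  have KC1 : 0 <= K1 * C by rewrite mulr_ge0.
  have KC2 : 0 <= K2 * C * C by rewrite !mulr_ge0.
  (* Off the support everything vanishes. On it, the derivatives of [eW] are at most C (n + 1),
     which the factor 1/(n + 1) compensates. *)
  have [Wn|Wn] := ltP (evm eW g) n.+1%:R; last first.
    have y0 : (0 < 1 + c n * evm eW g) = false.
      apply/negbTE; rewrite -leNgt mulNr subr_le0 mulrC ler_pdivlMr // mul1r //.
    by rewrite /bump y0 !mul0r addr0 normr0; split; rewrite !addr_ge0.
  have [W0 W1le W2le] := HC g.
  have cW (u : R) : `|u| <= C * evm eW g -> `|c n * u| <= C.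
    move=> ule; rewrite normrM cn0 mulrC ler_pdivrMr //.
    by apply: (le_trans ule); rewrite ler_wpM2l // ltW.
  have v1 := cW _ W1le; have v2 := cW _ W2le.
  split.
  - by apply: (le_trans (B0 _)); lra.
  - by apply: (le_trans (norm_mul_le (B1 _) v1)); lra.
  apply: (le_trans (ler_normD _ _)).
  have h := lerD (norm_mul_le (norm_mul_le (B2 (1 + c n * evm eW g)) v1) v1)
    (norm_mul_le (B1 (1 + c n * evm eW g)) v2).
  by apply: (le_trans h); lra.
move=> g _.
have cz (u : R) : c n * u @[n --> \oo] --> (0 : R).
  by rewrite -(mul0r u); apply: cvgM; [exact: cvg_oppSV|exact: cvg_cst].
have yl : 1 + c n * evm eW g @[n --> \oo] --> (1 : R).
  by rewrite -[X in _ --> X]addr0; apply: cvgD; [exact: cvg_cst|exact: cz].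
split.
- by rewrite (eq_cvg _ _ (E0^~ g)); exact: bump_cvg.
- rewrite (eq_cvg _ _ (E1^~ g)).
  have := cvgM (@bump_cvg p1 _ _ yl) (cz (W1 g)); rewrite mulr0; exact.
rewrite (eq_cvg _ _ (E2^~ g)).
have := cvgD (cvgM (cvgM (@bump_cvg p2 _ _ yl) (cz (W1 g))) (cz (W1 g))) (cvgM (@bump_cvg p1 _ _ yl) (cz (W2 g))).
rewrite !mulr0 addr0; exact.
Qed.

Lemma det_sqn_expr : exists2 eb : expr R I, is_poly eb &
  forall g, evm eb g = re (\det g) ^+ 2 + im (\det g) ^+ 2.
Proof.
have : cpolyfun (fun x : I -> R =>
    \sum_(s : {perm 'I_N}) (-1) ^+ s * \prod_i cplx (x (i, s i, false)) (x (i, s i, true))).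
  apply: cpolyfun_sum => s _; apply: cpolyfunM; first exact: cpolyfun_cst.
  by apply: cpolyfun_prod => i _; exact: cpolyfun_var.
move=> [er [ei [pr pi E]]]; exists (Add (Mul er er) (Mul ei ei)) => [|g].
  by rewrite /= pr pi.
have -> : \det g = cplx (evm er g) (evm ei g).
  rewrite -[RHS]/(cplx (eval (mcoord g) er) (eval (mcoord g) ei)) -E.
  apply: eq_bigr => s _; congr (_ * _); apply: eq_bigr => i _.
  by apply: CC_eq.
by rewrite /evm /= -!expr2.
Qed.

Section DeterminantCutoff.
Variable eb : expr R I.
Hypothesis ebE : forall g, evm eb g = re (\det g) ^+ 2 + im (\det g) ^+ 2.

Lemma evm_eb_mul g h : evm eb (g *m h) = evm eb g * evm eb h.
Proof. by rewrite !ebE det_mulmx reM imM; ring. Qed.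

Lemma evm_eb_ge0 g : 0 <= evm eb g.
Proof. by rewrite ebE addr_ge0 // sqr_ge0. Qed.

Lemma evm_eb_gt0 g : (0 < evm eb g) = (g \in unitmx).
Proof.
rewrite lt_neqAle evm_eb_ge0 andbT eq_sym ebE paddr_eq0 ?sqr_ge0 // !sqrf_eq0.
rewrite unitmxE unitfE; congr (~~ _); apply/idP/idP.
  by move=> /andP[/eqP a /eqP b]; apply/eqP/CC_eq.
by move=> /eqP ->; rewrite re0 im0 eqxx.
Qed.

(* |det|^2 is multiplicative, hence an eigenfunction of every left-invariant field. *)
Lemma pd_eb X : evm (pd X eb) = evm (Mul (Cst (evm (pd X eb) 1%:M)) eb).
Proof.
have H g : is_derive (0 : R) 1 (fun t => evm eb (g *m expmx (RtoC t *: X))) (evm (pd X eb) g).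
  have := @evm_derive _ _ eb (fun t => g *m expmx (RtoC t *: X)) (left_field X) 0.
  rewrite expmx0 mulmx1; apply=> i; rewrite eval_left_field; exact: is_derive_mul_expmx.
apply/funext => g; have Hg := H g.
have H1 : is_derive (0 : R) 1 (fun t => evm eb g * evm eb (1%:M *m expmx (RtoC t *: X)))
    (0 * evm eb (1%:M *m expmx (RtoC 0 *: X)) + evm eb g * evm (pd X eb) 1%:M).
  exact: is_deriveM' (is_derive_cst _ _ _) (H 1%:M).
have H2 : is_derive (0 : R) 1 (fun t => evm eb (g *m expmx (RtoC t *: X)))
    (0 * evm eb (1%:M *m expmx (RtoC 0 *: X)) + evm eb g * evm (pd X eb) 1%:M).
  by apply: is_derive_ext H1 => t; rewrite mul1mx -evm_eb_mul.
have e1 := @derive_val _ _ _ _ _ _ _ Hg; have e2 := @derive_val _ _ _ _ _ _ _ H2.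
by rewrite -e1 e2 [RHS]/evm /= mul0r add0r mulrC.
Qed.

Lemma pd_ebE X g : evm (pd X eb) g = evm (pd X eb) 1%:M * evm eb g.
Proof. by rewrite {1}pd_eb /evm /= -/(evm _ _). Qed.

Lemma pd2_eb X g : evm (pd X (pd X eb)) g = evm (pd X eb) 1%:M ^+ 2 * evm eb g.
Proof.
set k := evm (pd X eb) 1%:M.
rewrite /pd -/(pd X eb) -partial_xi_evm pd_eb partial_xi_evm -/k [LHS]/evm /= mul0r add0r.
by rewrite -/(evm _ g) -/(pd X eb) pd_eb [X in k * X]/evm /= -/(evm _ g) -/k mulrA expr2.
Qed.

(** Vanishes where |det|^2 is at most 1/(n + 1). On invertible matrices the argument of the bump
    tends to infinity, so the limit is 1. *)
Definition chiB n : expr R I := Bmp 1 (Add (Cst (-1)) (Mul (Cst n.+1%:R) eb)).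

Lemma cutoff_chiB : cutoff_family chiB 1.
Proof.
move=> X; set k := evm (pd X eb) 1%:M.
set p1 := dbump (1 : {poly R}); set p2 := dbump p1.
pose z n g : R := n.+1%:R * evm eb g.
(* With y = z - 1, each derivative of z is a multiple of z = y + 1. The polynomials [q1] and [q2]
   absorb these unbounded factors, so the derivatives stay bounded; as both vanish at 0, the
   derivatives tend to 0 when y tends to infinity. *)
pose q1 : {poly R} := 'X + 'X^2; pose q2 : {poly R} := ('X + 1) ^+ 2 * ('X^2 - 'X *+ 2).
have P1 y : bump p1 y * (y + 1) = bump q1 y.
  rewrite /bump; case: ifPn => [y0|_]; last by rewrite mul0r.
  rewrite /p1 /dbump /q1 derivC subr0 mulr1 !hornerE; field; by rewrite gt_eqF.
have P2 y : bump p2 y * ((y + 1) * (y + 1)) = bump q2 y.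
  rewrite /bump; case: ifPn => [y0|_]; last by rewrite mul0r.
  rewrite /p2 /p1 /dbump /q2 derivC subr0 mulr1 derivXn /= !hornerE /=.
  by field; rewrite gt_eqF.
have E0 n g : evm (chiB n) g = bump 1 (-1 + z n g) by [].
have E1 n g : evm (pd X (chiB n)) g = k * bump q1 (-1 + z n g).
  have zE : -1 + z n g + 1 = z n g by ring.
  rewrite -P1 zE evm_pd_bmp (pd_ebE X g) -/k /z.
  by ring.
have E2 n g : evm (pd X (pd X (chiB n))) g = k ^+ 2 * (bump q2 (-1 + z n g) + bump q1 (-1 + z n g)).
  have zE : -1 + z n g + 1 = z n g by ring.
  rewrite -P1 -P2 zE evm_pd2_bmp pd2_eb (pd_ebE X g) -/k /z.
  by ring.
have [K0 K00 B0] := bump_bounded (1 : {poly R}); have [K1 K10 B1] := bump_bounded q1.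
have [K2 K20 B2] := bump_bounded q2.
split.
  exists (K0 + `|k| * K1 + `|k ^+ 2| * (K2 + K1)) => [|n g].
    by rewrite !addr_ge0 // mulr_ge0 // addr_ge0.
  rewrite E0 E1 E2 (normrM k (bump _ _)) (normrM (k ^+ 2) (_ + _)).
  have := B0 (-1 + z n g); have := B1 (-1 + z n g); have := B2 (-1 + z n g).
  move=> b2 b1 b0.
  have h1 : `|k| * `|bump q1 (-1 + z n g)| <= `|k| * K1 by rewrite ler_wpM2l.
  have h2 : `|k ^+ 2| * `|bump q2 (-1 + z n g) + bump q1 (-1 + z n g)| <= `|k ^+ 2| * (K2 + K1).
    by rewrite ler_wpM2l // (le_trans (ler_normD _ _)) // lerD.
  have h3 : 0 <= `|k| * K1 by rewrite mulr_ge0.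
  have h4 : 0 <= `|k ^+ 2| * (K2 + K1) by rewrite mulr_ge0 // addr_ge0.
  by split; lra.
move=> g; rewrite -evm_eb_gt0 => b0.
have yl : -1 + z n g @[n --> \oo] --> +oo.
  apply/cvgryPge => A; near=> n.
  rewrite /z addrC lerBrDr -ler_pdivrMr //; near: n.
  exists (Num.truncn ((A + 1) / evm eb g)) => // n /= H.
  by apply: (le_trans (ltW (truncnS_gt _))); rewrite ler_nat ltnS.
have Q1 : q1.[0] = 0 by rewrite /q1 hornerD hornerXn hornerX expr0n addr0.
have Q2 : q2.[0] = 0 by rewrite /q2 hornerM hornerD hornerN hornerMn hornerX hornerXn expr0n mul0rn oppr0 addr0 mulr0.
split.
- by rewrite (eq_cvg _ _ (E0^~ g)); have := @bump_cvg_pinfty 1 _ yl; rewrite -polyC1 hornerC; exact.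
- rewrite (eq_cvg _ _ (E1^~ g)).
  have := cvgM (cvg_cst k) (@bump_cvg_pinfty q1 _ yl); rewrite Q1 mulr0; exact.
rewrite (eq_cvg _ _ (E2^~ g)).
have := cvgM (cvg_cst (k ^+ 2)) (cvgD (@bump_cvg_pinfty q2 _ yl) (@bump_cvg_pinfty q1 _ yl)).
rewrite Q1 Q2 addr0 mulr0; exact.
Unshelve. all: by end_near. Qed.

Lemma test_function_cut e n : test_function (evm (Mul e (Mul (Cst (expR 1)) (Mul (chiA n) (chiB n))))).
Proof.
set f := evm _.
(* The first condition bounds the support and the second keeps it away from singular matrices; both
   are closed. *)
pose S : set M := [set g | evm eW g <= n.+1%:R] `&` [set g | 1 <= n.+1%:R * evm eb g].
have Sc : closed S.
  apply: closedI.
    exact: (closed_comp (fun g _ => @continuous_evm _ _ eW g) (@closed_le _ n.+1%:R)).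
  pose h := evm (Mul (Cst n.+1%:R) eb).
  exact: (closed_comp (fun g _ => @continuous_evm _ _ (Mul (Cst n.+1%:R) eb) g) (@closed_ge _ 1)).
have fS : closure [set g : M | f g != 0] `<=` S.
  rewrite (closure_id S).1 //; apply: closure_subset => g /=.
  rewrite /f /evm /= -/(evm eW g) -/(evm eb g) !mulf_eq0 !negb_or => /andP[_ /and3P[_ a b]].
  split; rewrite /=.
    rewrite leNgt; apply: contra a => W; rewrite /bump ifF //.
    apply/negbTE; rewrite -leNgt mulNr subr_le0 mulrC ler_pdivlMr // mul1r ltW //.
  rewrite leNgt; apply: contra b => W; rewrite /bump ifF //.
  by apply/negbTE; rewrite -leNgt addrC subr_le0 ltW.
split; first exact: smooth_evm.
  apply: (@mx_bounded_closed_compact _ _ _ (Num.sqrt n.+1%:R)); first exact: closed_closure.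
  move=> g /fS[gW _] v; apply: (le_trans (mcoord_le_sqrt_eW g v)).
  exact: ler_wsqrtr.
move=> g /fS[_ /= gb]; rewrite -evm_eb_gt0.
have : 0 < n.+1%:R * evm eb g by apply: lt_le_trans gb.
by rewrite pmulr_rgt0.
Qed.

End DeterminantCutoff.

Lemma exists_cutoff : exists2 chi : nat -> expr R I, cutoff_family chi 1 &
  forall e n, test_function (evm (Mul e (chi n))).
Proof.
have [eb _ ebE] := det_sqn_expr.
exists (fun n => Mul (Cst (expR 1)) (Mul (chiA n) (chiB eb n))); last exact: test_function_cut.
(* The factor [expR 1] cancels the limit exp(-1) of [chiA]. *)
have E : expR 1 * (bump 1 1 * 1) = 1 :> R.
  by rewrite mulr1 /bump ltr01 invr1 -polyC1 hornerC mul1r -expRD subrr expR0.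
have := cutoff_mul (cutoff_cst (expR 1)) (cutoff_mul cutoff_chiA (cutoff_chiB ebE)).
by rewrite E.
Qed.

End Cutoffs.

(* [[set` A]] is the set of the members of A, not syntactically A itself. *)
Lemma set_mem_itv (R : realType) (a b : R) :
  [set` (`[a, b]%classic : set R)] = `[a, b]%classic.
Proof. by apply/seteqP; split=> x /=; rewrite inE. Qed.

(** * Dynkin's formula for functions dominated by an integrable weight *)

Section Dynkin.
Context {d : measure_display} {Omega : measurableType d} {R : realType}.
Variable Pr : probability Omega R.
Context {N : nat}.
Local Notation M := ('M[CC R]_N).
Local Notation I := ('I_N * 'I_N * bool)%type.
Local Notation leb := (@lebesgue_measure R).
Variables (beta : seq M) (B : R -> Omega -> M).
Hypothesis hB : brownian_motion Pr beta B.

Lemma Rintegral_prob_cst (c : R) : Rintegral Pr setT (fun=> c) = c.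
Proof.
by rewrite Rintegral_cst // (_ : fine _ = 1) ?mulr1 //; have := @probability_setT _ _ _ Pr => /= ->.
Qed.

Lemma process_measurable (f : M -> R) t : continuous f -> 0 <= t ->
  measurable_fun setT (fun w => f (B t w)).
Proof.
have [mB _ _ _ _] := hB => cf t0.
apply: (measurability _ (RGenOpens.measurableE R)) => _ [_ [a [b ->] <-]].
rewrite setTI; apply: (mB t t0 (f @^-1` `]a, b[%classic)).
by apply: open_comp => [g _|]; [exact: cf|exact: interval_open].
Qed.

Lemma process_continuous (f : M -> R) w : continuous f ->
  {within [set t : R | 0 <= t], continuous (fun t => f (B t w))}.
Proof.
have [_ _ _ cB _] := hB => cf; apply/subspace_continuousP => u u0.
have H := (subspace_continuousP _ _).1 (@cB w) u u0.
exact: (cvg_comp _ _ H (cf _)).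
Qed.

Definition Eexp e (t : R) : R := Rintegral Pr setT (fun w => evm e (B t w)).
Definition Gx e : expr R I := Mul (Cst 2^-1) (elap beta e).

Lemma GxE e g : evm (Gx e) g = 2^-1 * \sum_(X <- beta) evm (pd X (pd X e)) g.
Proof. by rewrite /evm /Gx /= /elap eval_esum big_map. Qed.

Lemma Gx_le e g (a : R) : (forall X, X \in beta -> `|evm (pd X (pd X e)) g| <= a) ->
  `|evm (Gx e) g| <= 2^-1 * (size beta)%:R * a.
Proof.
move=> H; rewrite GxE normrM ger0_norm // -mulrA ler_wpM2l //.
apply: (le_trans (ler_norm_sum _ _ _)).
apply: (@le_trans _ _ (\sum_(X <- beta) a)).
  by rewrite big_seq [leRHS]big_seq; exact: ler_sum.
by rewrite big_const_seq count_predT iter_addr_0 mulr_natl.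
Qed.

Lemma cvg_sum_seq (T : eqType) (s : seq T) (f : T -> nat -> R) (l : T -> R) :
  (forall x, x \in s -> f x n @[n --> \oo] --> l x) ->
  (\sum_(x <- s) f x n) @[n --> \oo] --> \sum_(x <- s) l x.
Proof.
elim: s => [|x s IH] H.
  by rewrite big_nil (eq_cvg _ _ (fun n => big_nil _ _ _ _)); exact: cvg_cst.
rewrite big_cons (eq_cvg _ _ (fun n => big_cons _ _ _ _ _ _)); apply: cvgD.
  by apply: H; rewrite inE eqxx.
by apply: IH => y ys; apply: H; rewrite inE ys orbT.
Qed.

(** The martingale identity between the times 0 and t is taken on the whole space; Fubini's theorem
    then moves the expectation inside the time integral. *)
Lemma test_dynkin e t C : test_function (evm e) -> 0 <= t ->
  Pr.-integrable setT (EFin \o (fun w => evm e (B t w))) ->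
  (forall u, 0 <= u <= t -> Pr.-integrable setT (EFin \o (fun w => evm (Gx e) (B u w)))) ->
  (forall u, 0 <= u <= t -> Rintegral Pr setT (fun w => `|evm (Gx e) (B u w)|) <= C) ->
  Eexp e t = evm e 1%:M + Rintegral leb `[0, t] (Eexp (Gx e)).
Proof.
move=> te t0 ie iG GC; have [_ _ B0 _ /(_ _ te)] := hB.
move=> [iZ _ /(_ 0 t setT (lexx _) t0)] mart.
rewrite !set_mem_itv in mart.
have GE : (fun f g => 2^-1 * laplacian beta f g) (evm e) = evm (Gx e).
  by apply/funext => g; rewrite laplacian_evm.
have [I1 I2 I3] := process_fubini (fun u u0 => @process_measurable _ u (@continuous_evm _ _ (Gx e)) u0)
  (fun w => @process_continuous _ w (@continuous_evm _ _ (Gx e))) t0 iG GC.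
have Z0 w : evm e (B 0 w) - evm e (B 0 w) -
    Rintegral leb `[0, 0] (fun u => 2^-1 * laplacian beta (evm e) (B u w)) = 0.
  by rewrite subrr set_itv1 Rintegral_set1 subr0.
have {}mart : Rintegral Pr setT (fun w => evm e (B t w) - evm e 1%:M -
    Rintegral leb `[0, t] (fun u => evm (Gx e) (B u w))) = 0.
  have sT : natural_filtration B 0 setT.
    by move=> S [[s0 sC _] _]; rewrite -(setD0 setT); exact: sC.
  have := mart sT; rewrite [RHS](eq_integral (fun=> 0%E)) => [|w _]; last by rewrite Z0.
  rewrite integral0 => H; rewrite /Rintegral -[RHS]/(fine 0%E) -H; congr fine; apply: eq_integral => w _.
  by rewrite B0 laplacian_evm.
move: mart.
have ic : Pr.-integrable setT (EFin \o (fun=> evm e 1%:M)) by exact: finite_measure_integrable_cst.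
have ic' : Pr.-integrable setT (EFin \o (fun w => evm e (B t w) - evm e 1%:M)).
  exact: (integrableB measurableT ie ic).
rewrite RintegralB // RintegralB // Rintegral_prob_cst I3 -/(Eexp e t) => /eqP; rewrite subr_eq0 => /eqP H.
by rewrite -[X in _ + X]H addrC subrK.
Qed.

(** The weight [w] dominates [e] and its derivatives, hence also those of [e] times a cut-off,
    uniformly in n. Dominated convergence is used under the expectation at each time, and then under
    the time integral. *)
Lemma dynkin e (w : M -> R) (K C t : R) : continuous w -> 0 <= t -> 0 <= K ->
  (forall u, 0 <= u <= t -> Pr.-integrable setT (EFin \o (fun o => w (B u o)))) ->
  (forall u, 0 <= u <= t -> Rintegral Pr setT (fun o => w (B u o)) <= C) ->
  (forall g, `|evm e g| <= K * w g) ->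
  (forall X g, X \in beta -> `|evm (pd X e) g| <= K * w g /\
     `|evm (pd X (pd X e)) g| <= K * w g) ->
  [/\ forall u, 0 <= u <= t -> Pr.-integrable setT (EFin \o (fun o => evm e (B u o))),
     forall u, 0 <= u <= t -> Pr.-integrable setT (EFin \o (fun o => evm (Gx e) (B u o))),
     leb.-integrable `[0, t] (EFin \o Eexp (Gx e)) &
     Eexp e t = evm e 1%:M + Rintegral leb `[0, t] (Eexp (Gx e))].
Proof.
move=> cw t0 K0 iw wC eK dK.
have [_ Bu _ _ _] := hB.
have [chi cf test] := @exists_cutoff R N.
pose G1 := @continuous_evm R N.
have mB (f : M -> R) u : continuous f -> 0 <= u <= t -> measurable_fun setT (fun o => f (B u o)).
  by move=> cf' /andP[u0 _]; exact: process_measurable.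
have Kw_int (k : R) u : 0 <= u <= t -> Pr.-integrable setT (EFin \o (fun o => k * w (B u o))).
  by move=> ut; exact: (integrableZl measurableT k (iw u ut)).
have Kw_E (k : R) u : 0 <= u <= t -> Rintegral Pr setT (fun o => k * w (B u o)) =
    k * Rintegral Pr setT (fun o => w (B u o)).
  by move=> ut; rewrite RintegralZl //; exact: iw.
have dom (k : R) (f : M -> R) u : 0 <= u <= t -> continuous f -> (forall g, `|f g| <= k * w g) ->
    Pr.-integrable setT (EFin \o (fun o => f (B u o))).
  move=> ut cf' fk; apply: (integrable_dom measurableT (mB f u cf' ut) (Kw_int k u ut)) => o _.
  exact: fk.
have dom_le (k : R) (f : M -> R) u : 0 <= k -> 0 <= u <= t -> continuous f -> (forall g, `|f g| <= k * w g) ->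
    Rintegral Pr setT (fun o => `|f (B u o)|) <= k * C.
  move=> k0 ut cf' fk.
  have fi := dom k f u ut cf' fk.
  apply: (@le_trans _ _ (Rintegral Pr setT (fun o => k * w (B u o)))).
    apply: le_Rintegral => //; first exact: integrable_norm.
    exact: Kw_int.
  by rewrite Kw_E // ler_wpM2l // wC.
have [K' K'0 HK'] : exists2 K' : R, 0 <= K' & forall X, X \in beta -> forall n g,
    [/\ `|evm (chi n) g| <= K', `|evm (pd X (chi n)) g| <= K' &
       `|evm (pd X (pd X (chi n))) g| <= K'].
  elim: (beta) => [|X s [K1 K10 IH]]; first by exists 0.
  have [[K2 K20 H2] _] := cf X; exists (K1 + K2) => [|Y]; first exact: addr_ge0.
  rewrite inE => /orP[/eqP ->|Ys] n g.
    by have [a b c] := H2 n g; split; lra.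
  by have [a b c] := IH Y Ys n g; split; lra.
(* Only the bound and the limit of [chi n] itself are drawn from this, so any field will do. *)
have [[K2 K20 HK2] chi1] := cf 0.
pose f n := Mul e (chi n).
have fE n g : evm (f n) g = evm e g * evm (chi n) g by [].
have f2E n X g : evm (pd X (pd X (f n))) g =
    evm (pd X (pd X e)) g * evm (chi n) g + evm (pd X e) g * evm (pd X (chi n)) g +
    (evm (pd X e) g * evm (pd X (chi n)) g + evm e g * evm (pd X (pd X (chi n))) g) by [].
have f_le n g : `|evm (f n) g| <= K * K2 * w g.
  have [a _ _] := HK2 n g; rewrite fE.
  by rewrite -mulrA [K2 * _]mulrC mulrA; apply: norm_mul_le.
(* The second derivative of a product has four terms, each at most K K' w; the other factors come
   from the generator. *)
set k := 2^-1 * (size beta)%:R * (4 * (K * K')).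
have k0 : 0 <= k by rewrite !mulr_ge0.
have Gf_le n g : `|evm (Gx (f n)) g| <= k * w g.
  rewrite /k -mulrA; apply: Gx_le => X Xb; rewrite f2E.
  have [d1 d2] := dK X g Xb; have [c0 c1 c2] := HK' X Xb n g.
  have e0 := eK g; have NM := @norm_mul_le R.
  apply: (le_trans (ler_normD _ _)).
  apply: (le_trans (lerD (ler_normD _ _) (ler_normD _ _))).
  have h := lerD (lerD (NM _ _ _ _ d2 c0) (NM _ _ _ _ d1 c1)) (lerD (NM _ _ _ _ d1 c1) (NM _ _ _ _ e0 c2)).
  by apply: (le_trans h); rewrite le_eqVlt; apply/orP; left; apply/eqP; ring.
set k1 := 2^-1 * (size beta)%:R * K.
have k10 : 0 <= k1 by rewrite !mulr_ge0.
have Ge_le g : `|evm (Gx e) g| <= k1 * w g.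
  by rewrite /k1 -mulrA; apply: Gx_le => X Xb; have [] := dK X g Xb.
have ie u (ut : 0 <= u <= t) := dom K _ u ut (G1 e) eK.
have iG u (ut : 0 <= u <= t) := dom k1 _ u ut (G1 (Gx e)) Ge_le.
have tt : 0 <= t <= t by rewrite t0 lexx.
have id n : Eexp (f n) t = evm (f n) 1%:M + Rintegral leb `[0, t] (Eexp (Gx (f n))).
  apply: (@test_dynkin _ t (k * C)) => //.
  - exact: test.
  - exact: dom tt (G1 (f n)) (f_le n).
  - by move=> u ut; exact: dom ut (G1 (Gx (f n))) (Gf_le n).
  - by move=> u ut; exact: dom_le ut (G1 (Gx (f n))) (Gf_le n).
have Ifub n := process_fubini (fun u u0 => @process_measurable _ u (G1 (Gx (f n))) u0)
  (fun o => @process_continuous _ o (G1 (Gx (f n)))) t0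
  (fun u ut => dom _ _ _ ut (G1 (Gx (f n))) (Gf_le n))
  (fun u ut => dom_le _ _ _ k0 ut (G1 (Gx (f n))) (Gf_le n)).
have [_ If _] := process_fubini (fun u u0 => @process_measurable _ u (G1 (Gx e)) u0)
  (fun o => @process_continuous _ o (G1 (Gx e))) t0
  (fun u ut => dom _ _ _ ut (G1 (Gx e)) Ge_le)
  (fun u ut => dom_le _ _ _ k10 ut (G1 (Gx e)) Ge_le).
have f_cvg g : g \in unitmx -> evm (f n) g @[n --> \oo] --> evm e g.
  move=> /chi1[c0 _ _]; rewrite -[X in _ --> X]mulr1; apply: cvgM => //; exact: cvg_cst.
have Gf_cvg g : g \in unitmx -> evm (Gx (f n)) g @[n --> \oo] --> evm (Gx e) g.
  move=> gu; rewrite GxE (eq_cvg _ _ (fun n => GxE (f n) g)).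
  apply: cvgM; first exact: cvg_cst.
  apply: cvg_sum_seq => X Xb; have [_ /(_ g gu)[c0 c1 c2]] := cf X.
  rewrite (eq_cvg _ _ (fun n => f2E n X g)).
  have := cvgD (cvgD (cvgM (cvg_cst (evm (pd X (pd X e)) g)) c0) (cvgM (cvg_cst (evm (pd X e) g)) c1))
    (cvgD (cvgM (cvg_cst (evm (pd X e) g)) c1) (cvgM (cvg_cst (evm e g)) c2)).
  rewrite !mulr0 !addr0 mulr1; exact.
have L : Eexp (f n) t @[n --> \oo] --> Eexp e t.
  refine (proj2 (@Rdominated _ _ _ Pr setT (fun n o => evm (f n) (B t o))
    (fun o => evm e (B t o)) (fun o => K * K2 * w (B t o)) _ _ _ _ _)) => //.
  - by move=> n; exact: mB.
  - by move=> o _; apply: f_cvg; exact: Bu.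
  - exact: Kw_int.
have LG u : 0 <= u <= t -> Eexp (Gx (f n)) u @[n --> \oo] --> Eexp (Gx e) u.
  move=> ut; refine (proj2 (@Rdominated _ _ _ Pr setT (fun n o => evm (Gx (f n)) (B u o))
    (fun o => evm (Gx e) (B u o)) (fun o => k * w (B u o)) _ _ _ _ _)) => //.
  - by move=> n; exact: mB.
  - by move=> o _; apply: Gf_cvg; apply: Bu; case/andP: ut.
  - exact: Kw_int.
have mI : measurable (`[0, t]%classic : set R) by exact: measurable_itv.
have LI : Rintegral leb `[0, t] (Eexp (Gx (f n))) @[n --> \oo] --> Rintegral leb `[0, t] (Eexp (Gx e)).
  refine (proj2 (@Rdominated _ _ _ leb `[0, t]%classic (fun n => Eexp (Gx (f n)))
    (Eexp (Gx e)) (fun=> k * C) _ _ _ _ _)) => //.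
  - by move=> n; have [_ /integrable_measurable] := Ifub n.
  - by apply: continuous_compact_integrable; [exact: segment_compact|
      apply: continuous_subspaceT => x; exact: cvg_cst].
  - move=> n u; rewrite /= in_itv /= => ut.
    apply: (le_trans (le_normr_Rintegral _ _)) => //; first exact: dom ut (G1 _) (Gf_le n).
    exact: dom_le ut (G1 _) (Gf_le n).
split=> //.
have L2 : Eexp (f n) t @[n --> \oo] --> evm e 1%:M + Rintegral leb `[0, t] (Eexp (Gx e)).
  by rewrite (eq_cvg _ _ id); apply: cvgD LI; apply: f_cvg; exact: unitmx1.
by rewrite -(cvg_lim (@Rhausdorff R) L) (cvg_lim (@Rhausdorff R) L2).
Qed.

End Dynkin.

(** * Gronwall's lemma and derivatives from quadratic estimates *)

Section RealAnalysis.
Context {R : realType}.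
Local Notation leb := (@lebesgue_measure R).
Implicit Types (f g v : R -> R).

Lemma Rintegral_diff_le g (s t S : R) : 0 <= s -> s <= t ->
  leb.-integrable `[0, t] (EFin \o g) -> (forall u, s <= u <= t -> `|g u| <= S) ->
  `|Rintegral leb `[0, t] g - Rintegral leb `[0, s] g| <= (t - s) * S.
Proof.
move=> s0 st ig gS.
have st' : (BRight s <= BRight t)%O by rewrite bnd_simp.
have -> : Rintegral leb `[0, t] g - Rintegral leb `[0, s] g = Rintegral leb `]s, t] g.
  by apply: Rintegral_itvB => //; rewrite bnd_simp.
have mI : measurable (`]s, t]%classic : set R) by exact: measurable_itv.
have sub : `]s, t]%classic `<=` `[0, t]%classic.
  by move=> u /=; rewrite !in_itv /= => /andP[su ->]; rewrite (le_trans s0 (ltW su)).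
have ig' : leb.-integrable `]s, t] (EFin \o g).
  by apply: integrableS ig => //; exact: measurable_itv.
have ic : leb.-integrable `]s, t] (EFin \o (fun=> S)).
  apply: (@integrableS _ _ _ leb `[s, t]%classic) => //.
    by move=> u /=; rewrite !in_itv /= => /andP[/ltW -> ->].
  by apply: continuous_compact_integrable; [exact: segment_compact|
    apply: continuous_subspaceT => x; exact: cvg_cst].
have h : `|Rintegral leb `]s, t] g| <= Rintegral leb `]s, t] (fun u => `|g u|).
  exact: le_normr_Rintegral.
apply: (le_trans h).
apply: (@le_trans _ _ (Rintegral leb `]s, t] (fun=> S))).
  apply: le_Rintegral => //; first exact: integrable_norm.
  by move=> u; rewrite /= in_itv /= => /andP[su ut]; apply: gS; rewrite ltW.
have E := @lebesgue_measure_itv R (Interval (BRight s) (BRight t)).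
rewrite Rintegral_cst // (_ : fine _ = t - s) 1?mulrC //; apply: (eq_trans (congr1 fine E)).
rewrite /= lte_fin; case: ltP => [_|ts]; first by rewrite -EFinB.
by rewrite (@le_anti _ _ s t) ?st ?ts //= subrr.
Qed.

Lemma Rintegral_diff_approx g (s t S c : R) : 0 <= s -> s <= t ->
  leb.-integrable `[0, t] (EFin \o g) -> (forall u, s <= u <= t -> `|g u - c| <= S) ->
  `|Rintegral leb `[0, t] g - Rintegral leb `[0, s] g - (t - s) * c| <= (t - s) * S.
Proof.
move=> s0 st ig gS.
have ic r : leb.-integrable `[0, r] (EFin \o (fun=> c)).
  by apply: continuous_compact_integrable; [exact: segment_compact|
    apply: continuous_subspaceT => x; exact: cvg_cst].
have mI r : measurable (`[0, r]%classic : set R) by exact: measurable_itv.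
have cE r : 0 <= r -> Rintegral leb `[0, r] (fun=> c) = r * c.
  move=> r0; have E := @lebesgue_measure_itv R (Interval (BLeft 0) (BRight r)).
  rewrite Rintegral_cst // (_ : fine _ = r) 1?mulrC //; apply: (eq_trans (congr1 fine E)).
  rewrite /= lte_fin; case: ltP => [_|r0']; first by rewrite sube0.
  by rewrite (@le_anti _ _ r 0) ?r0 ?r0' //=.
have igs : leb.-integrable `[0, s] (EFin \o g).
  apply: integrableS ig => // u /=; rewrite !in_itv /= => /andP[-> us] /=.
  exact: le_trans st.
have t0 := le_trans s0 st.
have -> : Rintegral leb `[0, t] g - Rintegral leb `[0, s] g - (t - s) * c =
  Rintegral leb `[0, t] (fun u => g u - c) - Rintegral leb `[0, s] (fun u => g u - c).
  by rewrite !RintegralB // !cE //; ring.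
apply: Rintegral_diff_le => //.
apply: (@integrableB _ _ _ leb _ _ (EFin \o g) (EFin \o (fun=> c)) ig (ic t)).
exact: measurable_itv.
Qed.

(** A form of Gronwall's lemma requiring only boundedness of [v]: on each interval of length [delta]
    the value at most doubles, and k intervals give 2^k. The a priori bound [M] starts an iteration
    and disappears from the conclusion. *)
Lemma gronwall_doubling v (T C M delta : R) :
  0 <= C -> 0 < delta -> C * delta <= 2^-1 -> 0 <= M ->
  (forall t, 0 <= t <= T -> 0 <= v t <= M) ->
  (forall s t S, 0 <= s -> s <= t -> t <= T ->
     (forall u, s <= u <= t -> v u <= S) -> v t <= v s + C * (t - s) * S) ->
  forall (k : nat) t, 0 <= t <= T -> t <= k%:R * delta -> v t <= 2 ^+ k * v 0.
Proof.
move=> C0 d0 Cd M0 vM H; elim=> [|k IH] t /andP[t0 tT] tk.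
  by rewrite expr0 mul1r (@le_anti _ _ t 0) // t0 andbT -(mul0r delta).
have T0 := le_trans t0 tT.
have v00 : 0 <= v 0 by have /andP[] : 0 <= v 0 <= M by apply: vM; rewrite lexx.
have [tk'|tk'] := leP t (k%:R * delta).
  apply: (le_trans (IH t _ tk')); first by rewrite t0.
  by rewrite ler_wpM2r // ler_weXn2l // ler1n.
set s := k%:R * delta in IH tk'.
have s0 : 0 <= s by rewrite mulr_ge0 // ltW.
have sT : s <= T := le_trans (ltW tk') tT.
have [vs0 vsM] : 0 <= v s /\ v s <= M by apply/andP/vM; rewrite s0.
(* Inserting the bound 2 v(s) + m into the integral inequality gives v(s) + (2 v(s) + m) / 2, so the
   excess m is halved each time. *)
have loop j : forall r, s <= r -> r <= t -> v r <= 2 * v s + M / 2 ^+ j.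
  elim: j => [|j IHj] r sr rt.
    rewrite expr0 divr1; have /andP[_ h] : 0 <= v r <= M.
      by apply: vM; rewrite (le_trans s0 sr) (le_trans rt tT).
    lra.
  have rs : r - s <= delta.
    by rewrite lerBlDl; apply: (le_trans rt); move: tk; rewrite -natr1 mulrDl mul1r.
  have h := H s r (2 * v s + M / 2 ^+ j) s0 sr (le_trans rt tT)
    (fun u ur => IHj u (proj1 (andP ur)) (le_trans (proj2 (andP ur)) rt)).
  apply: (le_trans h).
  have Mj : 0 <= M / 2 ^+ j by rewrite divr_ge0 // exprn_ge0.
  have q : C * (r - s) <= 2^-1.
    by apply: le_trans Cd; rewrite ler_wpM2l.
  have : C * (r - s) * (2 * v s + M / 2 ^+ j) <= 2^-1 * (2 * v s + M / 2 ^+ j).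
    by apply: ler_wpM2r => //; lra.
  rewrite [X in _ <= _ + X](_ : _ = 2^-1 * (M / 2 ^+ j)); last by rewrite exprS; field.
  lra.
have vt : v t <= 2 * v s.
  apply/ler_addgt0Pr => e e0.
  have [j Mj] : exists j, M / 2 ^+ j <= e.
    exists (Num.truncn (M / e)).+1; rewrite ler_pdivrMr ?exprn_gt0 //.
    rewrite mulrC -ler_pdivrMr //; apply: (le_trans (ltW (truncnS_gt _))).
    by rewrite -natrX ler_nat ltnW // ltn_expl.
  by apply: (le_trans (loop j t (ltW tk') (lexx _))); rewrite lerD2l.
apply: (le_trans vt); rewrite exprS -mulrA ler_wpM2l //; apply: IH => //.
by rewrite s0.
Qed.

Lemma is_derive_quadratic f (t l C delta : R) : 0 < delta ->
  (forall s, `|s - t| < delta -> `|f s - f t - (s - t) * l| <= C * (s - t) ^+ 2) ->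
  is_derive t 1 f l.
Proof.
move=> d0 H.
have L : (fun h : R => h^-1 *: ((f \o shift t) (h *: (1 : R)) - f t)) @ 0^' --> l.
  apply/cvgrPdist_le => e e0; near=> h.
  have h0 : h != 0 by near: h; exact: nbhs_dnbhs_neq.
  have hd : `|h| < delta by near: h; apply: dnbhs0_lt.
  have hC : `|h| <= e / (`|C| + 1) by near: h; apply: dnbhs0_le; rewrite divr_gt0 // ltr_pwDr.
  rewrite [h *: 1]mulr1 /GRing.scale /=.
  have := H (h + t); rewrite addrK => /(_ hd) Hh.
  have -> : l - h^-1 * (f (h + t) - f t) = - (h^-1 * (f (h + t) - f t - h * l)) by field.
  rewrite normrN normrM normfV mulrC ler_pdivrMr ?normr_gt0 //.
  apply: (le_trans Hh); rewrite -[h ^+ 2]real_normK ?num_real // expr2 mulrA.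
  rewrite ler_wpM2r //; apply: (le_trans (ler_wpM2r _ (ler_norm C))) => //.
  apply: (le_trans (ler_wpM2l _ hC)) => //.
  rewrite mulrCA ler_piMr ?(ltW e0) // ler_pdivrMr ?mul1r ?ltr_pwDr // lerDl //.
by apply: DeriveDef; [apply/cvg_ex; exists l|apply: cvg_lim].
Unshelve. all: by end_near. Qed.

(** From (c - x)^2 >= 0; with c = n + 1 it bounds the truncated Lyapunov function by n + 1. *)
Lemma le_scaled_square (x c : R) : 0 <= x -> 0 < c -> x <= c * (1 + (c^-1 * x) ^+ 2).
Proof.
move=> x0 c0; have cN0 : c != 0 by rewrite gt_eqF.
have -> : c * (1 + (c^-1 * x) ^+ 2) = c + c^-1 * x ^+ 2 by field.
have : 0 <= c^-1 * (c - x) ^+ 2 by rewrite mulr_ge0 ?sqr_ge0 // invr_ge0 ltW.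
have -> : c^-1 * (c - x) ^+ 2 = c - 2 * x + c^-1 * x ^+ 2 by field.
move: (c^-1 * x ^+ 2) => y; lra.
Qed.

End RealAnalysis.

(** * Moment bounds and time regularity of expected polynomials *)

Section PolynomialDynkin.
Context {d : measure_display} {Omega : measurableType d} {R : realType}.
Variable Pr : probability Omega R.
Context {N : nat}.
Local Notation M := ('M[CC R]_N).
Local Notation I := ('I_N * 'I_N * bool)%type.
Local Notation leb := (@lebesgue_measure R).
Variables (beta : seq M) (B : R -> Omega -> M).
Hypothesis hB : brownian_motion Pr beta B.
Local Notation EB := (Eexp Pr B).
Local Notation Gx := (Gx beta).

Lemma slow_weak X a (C C' : R) : C <= C' -> slow X a C -> slow (N := N) X a C'.
Proof.
move=> CC' H g; have [a0 a1 a2] := H g; split=> //.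
  by apply: (le_trans a1); rewrite ler_wpM2r.
by apply: (le_trans a2); rewrite ler_wpM2r.
Qed.

Lemma slow_uniform T (f : T -> expr R I) :
  (forall X, exists2 C : R, 0 <= C & forall n, slow X (f n) C) ->
  exists2 C : R, 0 <= C & forall X n, X \in beta -> slow X (f n) C.
Proof.
move=> H; elim: (beta) => [|X s [C C0 IH]]; first by exists 0.
have [C' C'0 H'] := H X; exists (C + C') => [|Y n]; first exact: addr_ge0.
rewrite inE => /orP[/eqP ->|Ys].
  by apply: slow_weak (H' n); rewrite lerDr.
by apply: slow_weak (IH Y n Ys); rewrite lerDl.
Qed.

(* A bounded Lyapunov function, increasing to U as n tends to infinity. *)
Definition trunc_expr (U : expr R I) (n : nat) : expr R I :=
  Mul U (Inv (Mul (Cst n.+1%:R^-1) U)).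

Lemma trunc_exprE U n g :
  evm (trunc_expr U n) g = evm U g * (1 + (n.+1%:R^-1 * evm U g) ^+ 2)^-1.
Proof. by []. Qed.

Lemma trunc_expr_le U n g : 0 <= evm U g -> 0 <= evm (trunc_expr U n) g <= n.+1%:R.
Proof.
move=> U0; rewrite trunc_exprE; apply/andP; split.
  by apply: divr_ge0 => //; apply: ltW; exact: inv_den_gt0.
by rewrite ler_pdivrMr ?inv_den_gt0 // le_scaled_square.
Qed.

Lemma trunc_cvg (x : R) : x * (1 + (n.+1%:R^-1 * x) ^+ 2)^-1 @[n --> \oo] --> x.
Proof.
pose e : expr R unit := Mul (Cst x) (Inv (Mul (Var tt) (Cst x))).
have E : eval (fun=> 0) e = x by rewrite /= mul0r expr0n addr0 invr1 mulr1.
have H := @eval_cvg _ _ nat \oo _ e (fun n _ => n.+1%:R^-1) (fun=> 0) (fun=> cvg_harmonic).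
by rewrite E in H; exact: H _.
Qed.

(** Being [slow] is invariant under scaling, constants having rate 0; the factor 1/(n + 1) therefore
    does not affect the constant, which is uniform in n. *)
Lemma slow_trunc U : (forall X, exists2 C : R, 0 <= C & slow X U C) ->
  exists2 C : R, 0 <= C & forall X n, X \in beta -> slow X (trunc_expr U n) C.
Proof.
move=> H; apply: slow_uniform => X; have [C C0 HC] := H X.
pose C1 := 0 + C + 2 * (0 * C); pose C2 := 2 * C1 + 10 * C1 ^+ 2.
have C10 : 0 <= C1 by rewrite /C1 mul0r mulr0 addr0 add0r.
have C20 : 0 <= C2 by rewrite addr_ge0 // mulr_ge0 // exprn_ge0.
exists (C + C2 + 2 * (C * C2)) => [|n]; first by rewrite !addr_ge0 // !mulr_ge0.
apply: slow_mul => //; apply: slow_inv => //; apply: slow_mul => //.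
by apply: slow_cst; rewrite invr_ge0.
Qed.

(** Each truncation is bounded, so Dynkin's formula applies to it, and its image under the generator
    is at most C' times itself. Gronwall's lemma gives a bound independent of n, and Fatou's lemma
    passes to [U]. *)
Lemma Lyapunov_moment U : (forall g, 0 <= evm U g) ->
  (forall X, exists2 C : R, 0 <= C & slow X U C) ->
  forall T : R, 0 <= T -> exists2 C : R, 0 <= C & forall t, 0 <= t <= T ->
    Pr.-integrable setT (EFin \o (fun o => evm U (B t o))) /\ EB U t <= C.
Proof.
move=> U0 sU T T0; have [C C0 HC] := slow_trunc sU.
pose C' := 2^-1 * (size beta)%:R * C.
have C'0 : 0 <= C' by rewrite !mulr_ge0.
(* Ensures C' delta <= 1/2, as [gronwall_doubling] asks; the added 1 covers C' = 0. *)
pose delta := (2 * (C' + 1))^-1.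
have d0 : 0 < delta by rewrite invr_gt0 mulr_gt0 // ltr_pwDr.
have Cd : C' * delta <= 2^-1.
  rewrite /delta invfM mulrCA ler_piMr // ler_pdivrMr ?mul1r ?lerDl //.
  by rewrite ltr_pwDr.
pose k := (Num.truncn (T / delta)).+1.
exists (2 ^+ k * evm U 1%:M) => [|t /andP[t0 tT]]; first by rewrite mulr_ge0 // exprn_ge0.
have tk : t <= k%:R * delta.
  by apply: (le_trans tT); rewrite -ler_pdivrMr // ltW // truncnS_gt.
pose f := trunc_expr U.
have f0M n g := trunc_expr_le n (U0 g).
have dyn n s : 0 <= s -> [/\ forall u, 0 <= u <= s -> Pr.-integrable setT (EFin \o (fun o => evm (f n) (B u o))),
     forall u, 0 <= u <= s -> Pr.-integrable setT (EFin \o (fun o => evm (Gx (f n)) (B u o))),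
     leb.-integrable `[0, s] (EFin \o EB (Gx (f n))) &
     EB (f n) s = evm (f n) 1%:M + Rintegral leb `[0, s] (EB (Gx (f n)))].
  (* The constant weight 1 suffices for a bounded function. The constant grows with n, but does not
     enter the final bound. *)
  move=> s0; apply: (@dynkin _ _ _ _ _ _ _ hB (f n) (fun=> 1) (n.+1%:R * (1 + C)) 1 s) => //.
  - exact: cst_continuous.
  - by rewrite mulr_ge0 // addr_ge0.
  - by move=> u _; exact: finite_measure_integrable_cst.
  - by move=> u _; rewrite Rintegral_prob_cst.
  - move=> g; have /andP[a b] := f0M n g; rewrite ger0_norm // mulr1.
    by apply: (le_trans b); rewrite ler_peMr // lerDl.
  - move=> X g Xb; have [a a1 a2] := HC X n Xb g; have /andP[_ b] := f0M n g.
    have h : C * evm (f n) g <= n.+1%:R * (1 + C) * 1.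
      rewrite mulr1 mulrC; apply: ler_pM => //; by rewrite lerDr.
    by split; [apply: (le_trans a1)|apply: (le_trans a2)].
have If n s : 0 <= s -> Pr.-integrable setT (EFin \o (fun o => evm (f n) (B s o))).
  by move=> s0; have [H _ _ _] := dyn n s s0; apply: H; rewrite s0 lexx.
have vM n s : 0 <= s <= T -> 0 <= EB (f n) s <= n.+1%:R.
  move=> /andP[s0 _]; apply/andP; split.
    by apply: Rintegral_ge0 => o _; have /andP[] := f0M n (B s o).
  rewrite -[leRHS](Rintegral_prob_cst Pr); apply: le_Rintegral => //.
    exact: If.
    exact: finite_measure_integrable_cst.
  by move=> o _; have /andP[] := f0M n (B s o).
have bound n : EB (f n) t <= 2 ^+ k * evm U 1%:M.
  have v0 : EB (f n) 0 = evm (f n) 1%:M.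
    have [_ _ _ ->] := dyn n 0 (lexx _); by rewrite set_itv1 Rintegral_set1 addr0.
  have h : EB (f n) t <= 2 ^+ k * EB (f n) 0.
    apply: (@gronwall_doubling _ (EB (f n)) T C' n.+1%:R delta) => //; first exact: vM.
      move=> s r S s0 sr rT uS; have r0 := le_trans s0 sr.
      have [_ _ _ ->] := dyn n s s0; have [_ ig1 ig ->] := dyn n r r0.
      have gS u : s <= u <= r -> `|EB (Gx (f n)) u| <= C' * S.
        move=> sur; have /andP[su ur] := sur; have u0 := le_trans s0 su.
        have iGu : Pr.-integrable setT (EFin \o (fun o => evm (Gx (f n)) (B u o))).
          by apply: ig1; rewrite u0.
        apply: (le_trans (le_normr_Rintegral _ iGu)) => //.
        apply: (@le_trans _ _ (C' * EB (f n) u)); last by rewrite ler_wpM2l // uS.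
        rewrite /Eexp -RintegralZl //; last exact: If.
        apply: le_Rintegral => //; first exact: integrable_norm.
          exact: (integrableZl measurableT C' (If n u u0)).
        move=> o _.
        have -> : C' * evm (f n) (B u o) = 2^-1 * (size beta)%:R * (C * evm (f n) (B u o)).
          by rewrite /C'; ring.
        by apply: Gx_le => X Xb; have [_ _ a2] := HC X n Xb (B u o).
      have := Rintegral_diff_le s0 sr ig gS; move=> /(le_trans (ler_norm _)); lra.
    by rewrite t0.
  apply: (le_trans h); rewrite v0 ler_wpM2l ?exprn_ge0 // trunc_exprE.
  by rewrite ler_piMr // invf_le1 ?inv_den_gt0 // lerDl sqr_ge0.
apply: (@Rfatou _ _ _ Pr setT (fun n o => evm (f n) (B t o))) => //.
- by move=> n o _; have /andP[] := f0M n (B t o).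
- by move=> n; exact: If.
move=> o _; rewrite (eq_cvg _ _ (fun n => trunc_exprE U n (B t o))).
exact: trunc_cvg.
Qed.

(** A whole power of [eW] replaces the half-integer power that the degree suggests, so that the
    weight is an expression to which [slow_epow] applies. *)
Lemma poly_dominated (e : expr R I) : is_poly e -> exists2 K : R, 0 <= K &
  (forall g, `|evm e g| <= K * evm (epow eW (edeg e)) g) /\
  (forall X g, X \in beta -> `|evm (pd X e) g| <= K * evm (epow eW (edeg e)) g /\
     `|evm (pd X (pd X e)) g| <= K * evm (epow eW (edeg e)) g).
Proof.
move=> pe; set n := edeg e.
have W1 g : 1 <= evm (epow (@eW R N) n) g by rewrite evm_epow exprn_ege1 // eW_ge1.
have G (a : expr R I) : is_poly a -> (edeg a <= n)%N ->
    exists2 K : R, 0 <= K & forall g, `|evm a g| <= K * evm (epow eW n) g.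
  move=> pa an; have [K K0 H] := evm_growth pa an; exists K => // g.
  apply: (le_trans (H g)); rewrite ler_wpM2l // evm_epow.
  have W0 : 0 <= evm (@eW R N) g by apply: le_trans (eW_ge1 g).
  rewrite -{2}(sqr_sqrtr W0) -exprM ler_weXn2l ?sqrt_eW_ge1 //.
  by rewrite leq_pmull.
have [K K0 HK] := G e pe (leqnn _).
suff [K' K'0 H'] : exists2 K' : R, 0 <= K' & forall X g, X \in beta ->
    `|evm (pd X e) g| <= K' * evm (epow eW n) g /\
    `|evm (pd X (pd X e)) g| <= K' * evm (epow eW n) g.
  exists (K + K'); first exact: addr_ge0.
  split=> [g|X g Xb].
    apply: (le_trans (HK g)); rewrite ler_wpM2r ?lerDl //; exact: le_trans (W1 g).
  have W0 : 0 <= evm (epow (@eW R N) n) g by apply: le_trans (W1 g).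
  have [a b] := H' X g Xb; split; [apply: (le_trans a)|apply: (le_trans b)];
    by rewrite ler_wpM2r ?lerDr.
elim: (beta) => [|X s [K1 K10 IH]]; first by exists 0.
have p1 := is_poly_pd X pe; have p2 := is_poly_pd X p1.
have d1 := edeg_pd X pe; have d2 := leq_trans (edeg_pd X p1) d1.
have [K2 K20 H2] := G _ p1 d1; have [K3 K30 H3] := G _ p2 d2.
exists (K1 + K2 + K3) => [|Y g]; first by rewrite !addr_ge0.
have W0 : 0 <= evm (epow (@eW R N) n) g by apply: le_trans (W1 g).
rewrite inE => /orP[/eqP ->|Ys].
  split; [apply: (le_trans (H2 g))|apply: (le_trans (H3 g))]; rewrite ler_wpM2r //; lra.
have [a b] := IH Y g Ys; split; [apply: (le_trans a)|apply: (le_trans b)]; rewrite ler_wpM2r //; lra.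
Qed.

Lemma poly_dynkin (e : expr R I) (T : R) : is_poly e -> 0 <= T ->
  (exists2 C : R, 0 <= C & forall t, 0 <= t <= T ->
    Pr.-integrable setT (EFin \o (fun o => evm e (B t o))) /\ `|EB e t| <= C) /\
  (forall t, 0 <= t <= T -> leb.-integrable `[0, t] (EFin \o EB (Gx e)) /\
    EB e t = evm e 1%:M + Rintegral leb `[0, t] (EB (Gx e))).
Proof.
move=> pe T0; have [K K0 [eK dK]] := poly_dominated pe.
pose U := epow (@eW R N) (edeg e).
have U0 g : 0 <= evm U g by rewrite evm_epow exprn_ge0 // (le_trans _ (eW_ge1 g)).
have [C C0 HC] : exists2 C : R, 0 <= C & forall t, 0 <= t <= T ->
    Pr.-integrable setT (EFin \o (fun o => evm U (B t o))) /\ EB U t <= C.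
  apply: Lyapunov_moment => // X; have [c c0 Hc] := slow_eW (N := N) X.
  exact: slow_epow c0 Hc.
have dyn t : 0 <= t <= T -> [/\ forall u, 0 <= u <= t -> Pr.-integrable setT (EFin \o (fun o => evm e (B u o))),
     forall u, 0 <= u <= t -> Pr.-integrable setT (EFin \o (fun o => evm (Gx e) (B u o))),
     leb.-integrable `[0, t] (EFin \o EB (Gx e)) &
     EB e t = evm e 1%:M + Rintegral leb `[0, t] (EB (Gx e))].
  move=> /andP[t0 tT].
  have ut u : 0 <= u <= t -> 0 <= u <= T by move=> /andP[-> ut]; rewrite (le_trans ut).
  apply: (@dynkin _ _ _ _ _ _ _ hB e (evm U) K C t) => //; first exact: continuous_evm.
    by move=> u /ut /HC[].
  by move=> u /ut /HC[].
split; last by move=> t /dyn[].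
exists (K * C) => [|t tT]; first exact: mulr_ge0.
have ie : Pr.-integrable setT (EFin \o (fun o => evm e (B t o))).
  by have [H _ _ _] := dyn t tT; apply: H; have /andP[-> _] := tT; rewrite lexx.
split=> //; have [iU UC] := HC t tT.
apply: (le_trans (le_normr_Rintegral _ ie)) => //.
apply: (@le_trans _ _ (K * EB U t)); last by rewrite ler_wpM2l.
rewrite /Eexp -RintegralZl //; apply: le_Rintegral => //; first exact: integrable_norm.
exact: (integrableZl measurableT K iU).
Qed.

Lemma is_poly_Gx e : is_poly e -> is_poly (Gx e).
Proof. by move=> pe; rewrite /= is_poly_elap. Qed.

Lemma poly_integrable (e : expr R I) t : is_poly e -> 0 <= t ->
  Pr.-integrable setT (EFin \o (fun o => evm e (B t o))).
Proof.
move=> pe t0; have [[C _ H] _] := poly_dynkin pe t0.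
by have [|] := H t; first by rewrite t0 lexx.
Qed.

Lemma Eexp_lipschitz (e : expr R I) (T : R) : is_poly e -> 0 <= T ->
  exists2 C : R, 0 <= C & forall s t, 0 <= s -> s <= t -> t <= T ->
    `|EB e t - EB e s| <= (t - s) * C.
Proof.
move=> pe T0; have [_ De] := poly_dynkin pe T0.
have [[C C0 HC] _] := poly_dynkin (is_poly_Gx pe) T0.
exists C => // s t s0 st tT; have t0 := le_trans s0 st.
have [_ ->] := De s ltac:(by rewrite s0 (le_trans st)).
have [ig ->] := De t ltac:(by rewrite t0 tT).
rewrite opprD addrACA subrr add0r; apply: Rintegral_diff_le => // u /andP[su ut].
by have [|] := HC u; first by rewrite (le_trans s0 su) (le_trans ut tT).
Qed.

(** The integrand in Dynkin's formula is itself Lipschitz, by the same formula applied to [Gx e];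
    one more integration gives a Taylor estimate. *)
Lemma Eexp_quadratic (e : expr R I) (T : R) : is_poly e -> 0 <= T ->
  exists2 C : R, 0 <= C & forall s t, 0 <= s <= T -> 0 <= t <= T ->
    `|EB e t - EB e s - (t - s) * EB (Gx e) s| <= C * (t - s) ^+ 2.
Proof.
move=> pe T0; have [_ De] := poly_dynkin pe T0.
have [C C0 HC] := Eexp_lipschitz (is_poly_Gx pe) T0.
exists C => // s t /andP[s0 sT] /andP[t0 tT].
(* The point c where the generator is evaluated is left free in [a, b], so that the cases s <= t and
   t <= s are its two endpoints. *)
have key a b c : 0 <= a -> a <= b -> b <= T -> a <= c <= b ->
    `|EB e b - EB e a - (b - a) * EB (Gx e) c| <= C * (b - a) ^+ 2.
  move=> a0 ab bT /andP[ac cb].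
  have [_ ->] := De a ltac:(by rewrite a0 (le_trans ab)).
  have [ig ->] := De b ltac:(by rewrite (le_trans a0 ab) bT).
  have -> : C * (b - a) ^+ 2 = (b - a) * ((b - a) * C) by ring.
  rewrite opprD addrACA subrr add0r.
  apply: Rintegral_diff_approx => // u /andP[au ub].
  have [uc|cu] := leP u c.
    rewrite distrC; apply: (le_trans (HC u c (le_trans a0 au) uc (le_trans cb bT))).
    by rewrite ler_wpM2r // lerB.
  apply: (le_trans (HC c u (le_trans a0 ac) (ltW cu) (le_trans ub bT))).
  by rewrite ler_wpM2r // lerB.
have [st|ts] := leP s t; first by apply: key => //; rewrite lexx st.
have := key t s s t0 (ltW ts) sT; rewrite (ltW ts) lexx => /(_ isT).
have -> : EB e s - EB e t - (s - t) * EB (Gx e) s =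
  - (EB e t - EB e s - (t - s) * EB (Gx e) s) by ring.
by rewrite normrN (_ : (s - t) ^+ 2 = (t - s) ^+ 2) //; ring.
Qed.

Lemma Eexp_derive (e : expr R I) (tau t : R) : is_poly e -> 0 <= tau -> 0 < t ->
  is_derive t 1 (fun s => EB e (s * tau)) (tau * EB (Gx e) (t * tau)).
Proof.
move=> pe tau0 t0.
(* On the neighbourhood |s - t| < t all times s tau stay in [0, 2 t tau], where the quadratic
   estimate holds. *)
have T0 : 0 <= (t + t) * tau by rewrite mulr_ge0 // addr_ge0 // ltW.
have [C C0 HC] := Eexp_quadratic pe T0.
apply: (@is_derive_quadratic _ _ t _ (C * tau ^+ 2) t) => // s st.
have [s0 s2] : 0 <= s /\ s <= t + t by move: st; rewrite ltr_norml => /andP[]; split; lra.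
have := HC (t * tau) (s * tau) ltac:(by rewrite mulr_ge0 ?(ltW t0) //= ler_wpM2r // lerDl ltW)
  ltac:(by rewrite mulr_ge0 //= ler_wpM2r).
have -> : (s - t) * (tau * EB (Gx e) (t * tau)) = (s * tau - t * tau) * EB (Gx e) (t * tau) by ring.
by have -> : C * tau ^+ 2 * (s - t) ^+ 2 = C * (s * tau - t * tau) ^+ 2 by ring.
Qed.

Lemma Eexp_continuous (e : expr R I) (tau : R) : is_poly e -> 0 <= tau ->
  {within `[0, 1], continuous (fun s : R => EB e (s * tau))}.
Proof.
move=> pe tau0; have [C C0 HC] := Eexp_lipschitz pe tau0.
have H s t : 0 <= s <= 1 -> 0 <= t <= 1 ->
    `|EB e (s * tau) - EB e (t * tau)| <= C * tau * `|s - t|.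
  wlog st : s t / t <= s.
    move=> W hs ht; have [ts|st] := leP t s; first exact: W.
    by rewrite distrC (distrC s t); apply: W => //; exact: ltW.
  move=> /andP[s0 s1] /andP[t0 t1]; rewrite (@ger0_norm _ (s - t)) ?subr_ge0 //.
  have -> : C * tau * (s - t) = (s * tau - t * tau) * C by ring.
  apply: HC; [exact: mulr_ge0|exact: ler_wpM2r|].
  by rewrite -[leRHS]mul1r ler_wpM2r.
apply/subspace_continuousP => s; rewrite /= in_itv /= => hs.
apply/cvgrPdist_le => eps eps0.
have e1 : 0 < eps / (C * tau + 1) by rewrite divr_gt0 // ltr_pwDr // mulr_ge0.
near=> t.
have ht : 0 <= t <= 1.
  have : `[0, 1]%classic t by near: t; exact: withinT.
  by rewrite /= in_itv.
apply: (le_trans (H s t hs ht)).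
have : `|s - t| <= eps / (C * tau + 1).
  near: t; apply: cvg_within; exists (eps / (C * tau + 1)); first exact: e1.
  by move=> z; exact: ltW.
rewrite ler_pdivlMr ?ltr_pwDr ?mulr_ge0 // mulrDr mulr1.
have := normr_ge0 (s - t); lra.
Unshelve. all: by end_near. Qed.

End PolynomialDynkin.

(** * Independence and joint trace moments *)

Section IndependentProducts.
Context {d : measure_display} {Omega : measurableType d} {R : realType}.
Variable Pr : probability Omega R.

Lemma integrable_lincomb (K : eqType) (s : seq K) (c : K -> R) (f : K -> Omega -> R) :
  (forall k, k \in s -> Pr.-integrable setT (EFin \o f k)) ->
  Pr.-integrable setT (EFin \o (fun w => \sum_(k <- s) c k * f k w)) /\
  Rintegral Pr setT (fun w => \sum_(k <- s) c k * f k w) =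
  \sum_(k <- s) c k * Rintegral Pr setT (f k).
Proof.
elim: s => [|k s IH] H.
  rewrite big_nil (_ : (fun w : Omega => \sum_(k <- [::]) _) = fun=> 0); last first.
    by apply/funext => w; rewrite big_nil.
  by split; [exact: integrable0|rewrite Rintegral_prob_cst].
have [i1 e1] := IH (fun k' ks => H k' (mem_behead (s := k :: s) ks)).
have ik : Pr.-integrable setT (EFin \o (fun w => c k * f k w)).
  have := @integrableZl _ _ _ Pr setT measurableT (c k) _ (H k (mem_head _ _)).
  by apply: eq_integrable => // w _; rewrite /= EFinM.
have -> : (fun w => \sum_(k <- k :: s) c k * f k w) =
    fun w => c k * f k w + \sum_(k <- s) c k * f k w.
  by apply/funext => w; rewrite big_cons.
rewrite big_cons -e1.
split; last by rewrite RintegralD // RintegralZl // H ?mem_head.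
have := @integrableD _ _ _ Pr setT measurableT _ _ ik i1.
by apply: eq_integrable => // w _; rewrite /= EFinD.
Qed.

Lemma Rintegral_indic (A : set Omega) : measurable A ->
  Rintegral Pr setT (\1_A) = fine (Pr A).
Proof. by move=> mA; rewrite /Rintegral integral_indic // setIT. Qed.

Lemma integrable_indicR (A : set Omega) : measurable A ->
  Pr.-integrable setT (EFin \o (\1_A : Omega -> R)).
Proof. by move=> mA; exact: integrable_indic. Qed.

(* The values of [x] are rounded towards 0 to a multiple of 1/(n+1), and
   truncated at n+1 in absolute value. *)
Definition round_index (n : nat) : finType := ('I_(n.+1 * n.+1) * bool)%type.
Definition round_coef n (k : round_index n) : R := (-1) ^+ k.2 * n.+1%:R^-1.
Definition round_set n (k : round_index n) : set R :=
  [set x | k.1.+1%:R / n.+1%:R <= (-1) ^+ k.2 * x].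
Definition rounding n (x : R) : R := \sum_(k : round_index n) round_coef k * \1_(round_set k) x.

(** The sum counts the integers among 1, ..., m not exceeding y. The induction also needs that it
    equals m once y >= m. *)
Lemma sum_steps (m : nat) (y : R) :
  let S : R := \sum_(i < m) ((i.+1%:R <= y)%R)%:R in
  [/\ 0 <= S, S <= Num.max y 0 & y <= m%:R -> y - 1 <= S].
Proof.
suff : let S : R := \sum_(i < m) ((i.+1%:R <= y)%R)%:R in
    [/\ 0 <= S, S <= Num.max y 0, y <= m%:R -> y - 1 <= S & m%:R <= y -> S = m%:R] by case.
rewrite /=; elim: m => [|m [IH0 IH1 IH2 IH3]].
  rewrite big_ord0 le_max lexx orbT; split=> // y0; lra.
rewrite big_ord_recr /=; set S := \sum_(i < m) _ in IH0 IH1 IH2 IH3 *.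
have mS : (m.+1%:R : R) = m%:R + 1 by rewrite -addn1 natrD.
case: (lerP m.+1%:R y) => my; rewrite ?addr0 ?mulr1n.
  have -> : S = m%:R by apply: IH3; lra.
  split; rewrite ?le_max -?mS ?my ?ler0n // => ym; lra.
split=> //; rewrite ?addr0 //; last by lra.
Qed.

Lemma rounding_bounds n (x : R) :
  `|rounding n x| <= `|x| /\ (`|x| <= n.+1%:R -> `|x - rounding n x| <= n.+1%:R^-1).
Proof.
have N0 : 0 < (n.+1%:R : R) by [].
pose S (y : R) : R := \sum_(i < n.+1 * n.+1) ((i.+1%:R <= y)%R)%:R.
(* The two signs give the step counts of the positive and of the negative part, at most one of which
   is nonzero. *)
have E : rounding n x = n.+1%:R^-1 * (S (n.+1%:R * x) - S (- (n.+1%:R * x))).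
  rewrite /rounding (eq_bigr (fun k : round_index n => (fun i b => n.+1%:R^-1 *
     ((-1) ^+ nat_of_bool b * ((i.+1%:R <= (-1) ^+ nat_of_bool b * (n.+1%:R * x))%R)%:R)) k.1 k.2)); last first.
    move=> [i b] _ /=; rewrite /round_coef indicE mem_setE /=.
    rewrite (_ : (x \in _) = (i.+1%:R / n.+1%:R <= (-1) ^+ b * x)) // ler_pdivrMr //.
    rewrite (_ : (-1) ^+ b * x * _ = (-1) ^+ b * (n.+1%:R * x)); ring.
  rewrite -(pair_bigA _ (fun (i : 'I_(n.+1 * n.+1)) b => n.+1%:R^-1 *
     ((-1) ^+ nat_of_bool b * ((i.+1%:R <= (-1) ^+ nat_of_bool b * (n.+1%:R * x))%R)%:R))) /=.
  rewrite -sumrB mulr_sumr; apply: eq_bigr => i _.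
  rewrite big_bool /= expr1 expr0 !mul1r !mulN1r; ring.
have pos (y : R) : 0 <= y -> S (- y) = 0.
  move=> y0; apply: big1 => i _; rewrite leNgt (_ : - y < _) //.
  by apply: (@le_lt_trans _ _ 0); rewrite ?oppr_le0.
have H (y : R) : 0 <= y -> [/\ 0 <= S y, S y <= y & y <= n.+1%:R * n.+1%:R -> y - 1 <= S y].
  move=> y0; have [S0 S1 S2] := sum_steps (n.+1 * n.+1) y; split=> //.
    by apply: (le_trans S1); rewrite ge_max lexx.
  by rewrite -natrM.
have V1 : n.+1%:R^-1 * n.+1%:R = 1 :> R by rewrite mulVf.
have key (x0 : R) : 0 <= x0 ->
    0 <= n.+1%:R^-1 * S (n.+1%:R * x0) <= x0 /\
    (x0 <= n.+1%:R -> x0 - n.+1%:R^-1 <= n.+1%:R^-1 * S (n.+1%:R * x0)).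
  move=> x0p; have [S0 S1 S2] := H (n.+1%:R * x0) (mulr_ge0 (ltW N0) x0p).
  have i0 : 0 <= n.+1%:R^-1 :> R by rewrite invr_ge0.
  split; first by have := ler_wpM2l i0 S1; rewrite mulrA V1 mul1r => ->; rewrite mulr_ge0.
  move=> xn; have := ler_wpM2l i0 (S2 _).
  by rewrite mulrBr mulrA V1 mul1r mulr1; apply; rewrite ler_wpM2l // ltW.
case: (lerP 0 x) => x0.
  have [/andP[a1 a2] a3] := key x x0.
  rewrite E pos ?mulr_ge0 ?(ltW N0) // subr0 (ger0_norm x0) ger0_norm //; split=> // /a3 a4.
  by rewrite ger0_norm ?subr_ge0 // lerBlDl -lerBlDr.
have [] := key (- x) _; first by rewrite oppr_ge0 ltW.
have -> : n.+1%:R * - x = - (n.+1%:R * x) by rewrite mulrN.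
have E0 : S (n.+1%:R * x) = 0.
  by rewrite -[_ * x]opprK pos // oppr_ge0 mulr_ge0_le0 // ltW.
rewrite E E0 sub0r mulrN => /andP[a1 a2] a3; rewrite normrN (ger0_norm a1) (ltr0_norm x0).
split=> // /a3; rewrite opprK ler_norml; move: a1 a2 {a3}.
move: (n.+1%:R^-1 * S (- (n.+1%:R * x))) (n.+1%:R^-1) => z v a1 a2 a4.
by apply/andP; split; lra.
Qed.

Lemma cvg_rounding (x : R) : rounding n x @[n --> \oo] --> x.
Proof.
apply/cvgrPdist_le => e e0; near=> n.
have [_ H] := rounding_bounds n x.
apply: (le_trans (H _)).
  by apply: ltW; apply: lt_le_trans (_ : n%:R <= _); [near: n; exact: nbhs_infty_gtr|rewrite ler_nat].
have [_ H'] := rounding_bounds n x.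
apply: ltW; near: n; exact: near_infty_natSinv_lt (PosNum e0).
Unshelve. all: by end_near. Qed.

Lemma measurable_round_set n (k : round_index n) : measurable (round_set k).
Proof.
rewrite (_ : round_set k = (fun x : R => (-1) ^+ k.2 * x) @^-1` `[k.1.+1%:R / n.+1%:R, +oo[).
  by rewrite -[X in measurable X]setTI; exact: measurable_funM.
by apply/seteqP; split=> x; rewrite /round_set /= in_itv /= andbT.
Qed.

Definition indep_rv (J : finType) (X : J -> Omega -> R) := forall Y : J -> set R,
  (forall j, measurable (Y j)) ->
  fine (Pr (\bigcap_(j in [set: J]) (X j @^-1` Y j))) = \prod_j fine (Pr (X j @^-1` Y j)).

(** Rounded variables take finitely many values. Expanding the product gives indicators of
    intersections, and for these independence is a statement about events. *)
Lemma prod_rounding (J : finType) (X : J -> Omega -> R) n :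
  (forall j, measurable_fun setT (X j)) -> indep_rv X ->
  [/\ Pr.-integrable setT (EFin \o (fun w => \prod_j rounding n (X j w))),
   forall j, Pr.-integrable setT (EFin \o (fun w => rounding n (X j w))) &
   Rintegral Pr setT (fun w => \prod_j rounding n (X j w)) =
   \prod_j Rintegral Pr setT (fun w => rounding n (X j w))].
Proof.
move=> mX iX.
pose A j (k : round_index n) := X j @^-1` round_set k.
have mA j k : measurable (A j k).
  by rewrite /A -[X in measurable X]setTI; apply: mX => //; exact: measurable_round_set.
have E1 j : (fun w => rounding n (X j w)) =
    fun w => \sum_(k : round_index n) round_coef k * (\1_(A j k) : Omega -> R) w.
  by apply/funext => w; apply: eq_bigr => k _; rewrite !indicE !mem_setE.
pose B (f : {ffun J -> round_index n}) := \bigcap_(j in [set: J]) A j (f j).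
have mB f : measurable (B f).
  by apply: fin_bigcap_measurable => [|j _]; [exact: finite_finset|exact: mA].
have E2 : (fun w => \prod_j rounding n (X j w)) =
    fun w => \sum_(f : {ffun J -> round_index n})
      (\prod_j round_coef (f j)) * (\1_(B f) : Omega -> R) w.
  apply/funext => w; rewrite bigA_distr_bigA; apply: eq_bigr => f _.
  rewrite big_split /=; congr (_ * _); rewrite indicE.
  have [/set_mem Bw|Bw] := boolP (w \in B f).
    by apply: big1 => j _; rewrite indicE mem_set //; exact: (Bw j).
  have [j jw] : exists j, ~ A j (f j) w.
    by apply/existsNP => H; move/negP: Bw; apply; apply: mem_set => j _; exact: H.
  by rewrite (bigD1 j) //= indicE memNset ?mul0r.
have L1 j := integrable_lincomb (s := index_enum (round_index n)) (@round_coef n)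
  (f := fun k => \1_(A j k)) (fun k _ => integrable_indicR (mA j k)).
have [i2 e2] := integrable_lincomb (s := index_enum {ffun J -> round_index n})
  (fun f => \prod_j round_coef (f j)) (f := fun f => \1_(B f)) (fun f _ => integrable_indicR (mB f)).
split.
- by rewrite E2.
- by move=> j; rewrite E1; exact: (L1 j).1.
rewrite E2 e2.
under [RHS]eq_bigr => j _ do rewrite E1 (L1 j).2.
rewrite bigA_distr_bigA; apply: eq_bigr => f _.
rewrite Rintegral_indic // [RHS]big_split /=; congr *%R.
rewrite /B iX => [|j]; last exact: measurable_round_set.
by apply: eq_bigr => j _; rewrite Rintegral_indic.
Qed.

Lemma cvg_prod_fin (J : finType) (f : J -> nat -> R) (l : J -> R) :
  (forall j, f j n @[n --> \oo] --> l j) -> (\prod_j f j n) @[n --> \oo] --> \prod_j l j.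
Proof.
move=> H; elim: (index_enum J) => [|j s IH].
  by rewrite big_nil (eq_cvg _ _ (fun n => big_nil _ _ _ _)); exact: cvg_cst.
by rewrite big_cons (eq_cvg _ _ (fun n => big_cons _ _ _ _ _ _)); exact: cvgM.
Qed.

Lemma measurable_rounding n : measurable_fun setT (rounding n : R -> R).
Proof.
apply: measurable_sum => k; apply: measurable_funM => //.
by apply: measurable_indic; exact: measurable_round_set.
Qed.

(* Independence of the [X j] also yields integrability of the product, by Fatou. *)
Lemma indep_prod (J : finType) (X : J -> Omega -> R) :
  (forall j, Pr.-integrable setT (EFin \o X j)) -> indep_rv X ->
  Pr.-integrable setT (EFin \o (fun w => \prod_j X j w)) /\
  Rintegral Pr setT (fun w => \prod_j X j w) = \prod_j Rintegral Pr setT (X j).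
Proof.
move=> intX iX.
have mX j : measurable_fun setT (X j) by apply: integrable_measurable (intX j).
have iX' : indep_rv (fun j w => `|X j w|).
  move=> Y mY; apply: (iX (fun j => Num.norm @^-1` Y j)) => j.
  by rewrite -[X in measurable X]setTI; apply: normr_measurable.
have mX' j : measurable_fun setT (fun w => `|X j w|) by exact: measurableT_comp.
have intX' j : Pr.-integrable setT (EFin \o (fun w => `|X j w|)).
  by have := integrable_abse (intX j); apply: eq_integrable.
have pos n (x : R) : 0 <= x -> 0 <= rounding n x.
  move=> x0; apply: sumr_ge0 => k _; rewrite /round_coef indicE mem_setE.
  case: k => i [] /=; last by rewrite expr0 mul1r mulr_ge0.
  rewrite (_ : (x \in _) = (i.+1%:R / n.+1%:R <= (-1) ^+ 1 * x)) // (_ : (i.+1%:R / n.+1%:R <= (-1) ^+ 1 * x) = false) ?mulr0 //.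
  apply/negbTE; rewrite -ltNge expr1 mulN1r; apply: (@le_lt_trans _ _ 0); first by rewrite oppr_le0.
  by rewrite divr_gt0.
have [iabs _] : Pr.-integrable setT (EFin \o (fun w => \prod_j `|X j w|)) /\
    Rintegral Pr setT (fun w => \prod_j `|X j w|) <= \prod_j Rintegral Pr setT (fun w => `|X j w|).
  apply: (Rfatou (f_ := fun n w => \prod_j rounding n `|X j w|)) => //.
  - by move=> n w _; apply: prodr_ge0 => j _; exact: pos.
  - by move=> n; have [] := prod_rounding n mX' iX'.
  - by move=> w _; apply: cvg_prod_fin => j; exact: cvg_rounding.
  - move=> n; have [_ i2 ->] := prod_rounding n mX' iX'.
    apply: ler_prod => j _; apply/andP; split.
      by apply: Rintegral_ge0 => w _; exact: pos.
    apply: le_Rintegral => //.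
    move=> w _; have [H _] := rounding_bounds n `|X j w|.
    by rewrite -[leRHS]normr_id; apply: le_trans H; exact: ler_norm.
have rle n w : `|\prod_j rounding n (X j w)| <= \prod_j `|X j w|.
  by rewrite normr_prod; apply: ler_prod => j _; rewrite normr_ge0 (rounding_bounds n _).1.
have [i1 c1] := @Rdominated _ _ _ Pr setT (fun n w => \prod_j rounding n (X j w))
  (fun w => \prod_j X j w) _ measurableT
  (fun n => integrable_measurable (let: And3 a _ _ := prod_rounding n mX iX in a))
  (fun w _ => @cvg_prod_fin J _ _ (fun j => @cvg_rounding (X j w))) iabs (fun n w _ => rle n w).
split=> //; suff c2 : Rintegral Pr setT (fun w => \prod_j rounding n (X j w)) @[n --> \oo] -->
    \prod_j Rintegral Pr setT (X j) by exact: (cvg_unique _ c1 c2).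
rewrite (eq_cvg _ _ (_ : _ =1 fun n => \prod_j Rintegral Pr setT (fun w => rounding n (X j w)))); last first.
  by move=> n; have [_ _ ->] := prod_rounding n mX iX.
apply: cvg_prod_fin => j.
apply: (@Rdominated _ _ _ Pr setT (fun n w => rounding n (X j w)) (X j)
  (fun w => `|X j w|) measurableT _ _ (intX' j) _).2.
- by move=> n; apply: measurableT_comp (mX j); exact: measurable_rounding.
- by move=> w _; exact: cvg_rounding.
- by move=> n w _; exact: (rounding_bounds n _).1.
Qed.

End IndependentProducts.

Section Tensors.
Context {R : realType} {J : finType} {N : nat}.
Local Notation M := ('M[CC R]_N).
Local Notation I := ('I_N * 'I_N * bool)%type.
Implicit Types (F G : (J -> M) -> R) (A : J -> M).

(** Sums of products of one-factor polynomials: on these, independence reduces expectations to those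
    of the single factors. *)
Definition tensor F := exists (K : finType) (c : K -> R) (h : K -> J -> expr R I),
  (forall k j, is_poly (h k j)) /\ forall A, F A = \sum_k c k * \prod_j evm (h k j) (A j).

Lemma tensor_ext F G : F =1 G -> tensor F -> tensor G.
Proof. by move=> FG [K [c [h [p E]]]]; exists K, c, h; split=> // A; rewrite -FG. Qed.

Lemma tensor_cst (x : R) : tensor (fun=> x).
Proof.
exists unit, (fun=> x), (fun _ _ => Cst 1); split=> // A.
by rewrite big_const card_unit /= addr0 big1 // mulr1.
Qed.

Lemma tensor_coord (j : J) (v : I) : tensor (fun A => mcoord (A j) v).
Proof.
exists unit, (fun=> 1), (fun _ i => if i == j then Var v else Cst 1); split=> [k i|A].
  by case: ifP.
rewrite big_const card_unit /= addr0 mul1r (bigD1 j) //= eqxx big1 ?mulr1 // => i /negbTE ->.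
by [].
Qed.

Lemma tensorD F G : tensor F -> tensor G -> tensor (fun A => F A + G A).
Proof.
move=> [K [c [h [p E]]]] [K' [c' [h' [p' E']]]].
exists (K + K')%type, (fun x => match x with inl k => c k | inr k => c' k end),
  (fun x => match x with inl k => h k | inr k => h' k end).
by split=> [[k|k]|A] //; rewrite big_sumType E E'.
Qed.

Lemma tensorM F G : tensor F -> tensor G -> tensor (fun A => F A * G A).
Proof.
move=> [K [c [h [p E]]]] [K' [c' [h' [p' E']]]].
exists (K * K')%type, (fun x => c x.1 * c' x.2), (fun x j => Mul (h x.1 j) (h' x.2 j)).
split=> [[k k'] j|A] /=; first by rewrite p p'.
rewrite E E' big_distrlr /= pair_bigA; apply: eq_bigr => -[k k'] _ /=.
by rewrite mulrACA -big_split.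
Qed.

Lemma tensor_eval (e : expr R (J * I)) : is_poly e ->
  tensor (fun A => eval (fun x => mcoord (A x.1) x.2) e).
Proof.
elim: e => //= [c _|x _|a IHa b IHb /andP[/IHa ta /IHb tb]|a IHa b IHb /andP[/IHa ta /IHb tb]].
- exact: tensor_cst.
- exact: tensor_coord.
- exact: tensorD.
- exact: tensorM.
Qed.

End Tensors.

Section TraceEvaluation.
Context {R : realType} {J : finType} {N : nat}.
Local Notation M := ('M[CC R]_N).
Local Notation I := ('I_N * 'I_N * bool)%type.
Implicit Types (F : (J * I -> R) -> M) (P : trpoly R J).

Definition mpolyfun F := forall i k, cpolyfun (fun x => F x i k).

Definition mx_of_coord (x : J * I -> R) (j : J) : M :=
  \matrix_(i, k) cplx (x (j, (i, k, false))) (x (j, (i, k, true))).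

Lemma mx_of_coordK (A : J -> M) : mx_of_coord (fun x => mcoord (A x.1) x.2) = A.
Proof.
apply/funext => j; apply/matrixP => i k; rewrite mxE /mcoord /=.
by apply: CC_eq.
Qed.

Lemma cpolyfunX (f : (J * I -> R) -> CC R) n : cpolyfun f -> cpolyfun (fun x => f x ^+ n).
Proof.
move=> pf; elim: n => [|n IH].
  by apply: cpolyfun_ext (cpolyfun_cst 1) => x; rewrite expr0.
by apply: cpolyfun_ext (cpolyfunM pf IH) => x; rewrite exprS.
Qed.

Lemma mpolyfun_word (e : word J) : mpolyfun (fun x => word_mx (mx_of_coord x) e).
Proof.
rewrite /word_mx; elim: (sval e) => [|l s IH] i k.
  by apply: cpolyfun_ext (cpolyfun_cst (i == k)%:R) => x; rewrite big_nil mxE.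
apply: (@cpolyfun_ext _ _ (fun x => \sum_m
    (if l.2 then adjmx (mx_of_coord x l.1) else mx_of_coord x l.1) i m *
    (\prod_(l <- s) (if l.2 then adjmx (mx_of_coord x l.1) else mx_of_coord x l.1)) m k)).
  by move=> x; rewrite big_cons mxE.
apply: cpolyfun_sum => m _; apply: cpolyfunM; last exact: IH.
case: l => j [] /=.
  apply: (@cpolyfun_ext _ _ (fun x => Num.conj (cplx (x (j, (m, i, false))) (x (j, (m, i, true)))))).
    by move=> x; rewrite !mxE.
  exact/cpolyfun_conj/cpolyfun_var.
apply: (@cpolyfun_ext _ _ (fun x => cplx (x (j, (i, m, false))) (x (j, (i, m, true))))).
  by move=> x; rewrite mxE.
exact: cpolyfun_var.
Qed.

Lemma cpolyfun_trace_eval P : cpolyfun (fun x => trace_eval P (mx_of_coord x)).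
Proof.
rewrite /trace_eval /peval /mmap; apply: cpolyfun_sum => m _.
apply: cpolyfunM; first exact: cpolyfun_cst.
apply: cpolyfun_prod => e _; apply: cpolyfunX.
apply: cpolyfunM; first exact: cpolyfun_cst.
by apply: cpolyfun_sum => i _; exact: mpolyfun_word.
Qed.

Lemma tensor_trace_eval P :
  tensor (fun A : J -> M => re (trace_eval P A)) /\
  tensor (fun A : J -> M => im (trace_eval P A)).
Proof.
have [er [ei [pr pi E]]] := cpolyfun_trace_eval P.
by split; [apply: tensor_ext (tensor_eval pr)|apply: tensor_ext (tensor_eval pi)] => A;
  rewrite -{2}(mx_of_coordK A) E.
Qed.

End TraceEvaluation.

(** * Joint expectations of the independent Brownian motions *)

Section JointProcess.
Context {d : measure_display} {Omega : measurableType d} {R : realType}.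
Variable Pr : probability Omega R.
Context {J : finType} {N : nat}.
Local Notation M := ('M[CC R]_N).
Local Notation I := ('I_N * 'I_N * bool)%type.
Variables (T : J -> R) (beta : seq M) (B : J -> R -> Omega -> M).
Hypothesis hT : forall j, 0 <= T j.
Hypothesis hB : forall j, brownian_motion Pr beta (B j).
Hypothesis hind : independent_processes Pr B.
Implicit Types (F : (J -> M) -> R).

(** A common clock for all factors: time 0 is the identity and time 1 is B(T). *)
Definition joint (t : R) (w : Omega) (j : J) : M := B j (t * T j) w.
Definition Ejoint F (t : R) : R := Rintegral Pr setT (fun w => F (joint t w)).

(** The sets with preimage in the generated sigma-algebra form a sigma-algebra containing the open
    intervals, hence all Borel sets. *)
Lemma sigma_process_preimage (X : R -> Omega -> M) (f : M -> R) (u : R) (Y : set R) :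
  continuous f -> 0 <= u -> measurable Y ->
  sigma_process X [set u | 0 <= u] ((fun w => f (X u w)) @^-1` Y).
Proof.
move=> cf u0; move=> mY.
have {}mY : (RGenOpens.G (R:=R)).-sigma.-measurable Y by rewrite -RGenOpens.measurableE.
have sa := smallest_sigma_algebra setT [set S | exists (u : R) (U : set M),
  [/\ 0 <= u, open U & S = X u @^-1` U]].
have := @smallest_sub _ _ _ _ (sigma_algebra_image (fun w => f (X u w)) sa) _ Y mY.
rewrite /image_set_system /= setTI; apply => _ [a [b ->]] /=.
rewrite setTI; apply: sub_sigma_algebra; exists u, (f @^-1` `]a, b[%classic); split=> //.
by apply: open_comp => [g _|]; [exact: cf|exact: interval_open].
Qed.

Lemma Ejoint_product (h : J -> expr R I) t : 0 <= t -> (forall j, is_poly (h j)) ->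
  Pr.-integrable setT (EFin \o (fun w => \prod_j evm (h j) (joint t w j))) /\
  Ejoint (fun A => \prod_j evm (h j) (A j)) t = \prod_j Eexp Pr (B j) (h j) (t * T j).
Proof.
move=> t0 ph; apply: (@indep_prod _ _ _ Pr J (fun j w => evm (h j) (joint t w j))).
  by move=> j; apply: poly_integrable; rewrite ?mulr_ge0 //; exact: hB.
move=> Y mY; apply: hind => j; apply: sigma_process_preimage => //.
  exact: continuous_evm.
by rewrite mulr_ge0.
Qed.

Lemma Ejoint_lincomb (K : finType) (c : K -> R) (h : K -> J -> expr R I) F t : 0 <= t ->
  (forall k j, is_poly (h k j)) ->
  (forall A, F A = \sum_k c k * \prod_j evm (h k j) (A j)) ->
  Pr.-integrable setT (EFin \o (fun w => F (joint t w))) /\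
  Ejoint F t = \sum_k c k * \prod_j Eexp Pr (B j) (h k j) (t * T j).
Proof.
move=> t0 ph E.
have -> : F = fun A => \sum_k c k * \prod_j evm (h k j) (A j) by apply/funext.
have [i1 e1] := integrable_lincomb (Pr := Pr) (s := index_enum K) c
  (f := fun k w => \prod_j evm (h k j) (joint t w j))
  (fun k _ => (Ejoint_product t0 (ph k)).1).
split=> //; rewrite /Ejoint e1; apply: eq_bigr => k _; congr (_ * _).
exact: (Ejoint_product t0 (ph k)).2.
Qed.

Lemma Ejoint_integrable F t : tensor F -> 0 <= t ->
  Pr.-integrable setT (EFin \o (fun w => F (joint t w))).
Proof. by move=> [K [c [h [ph E]]]] t0; have [] := Ejoint_lincomb t0 ph E. Qed.

Lemma Ejoint0 F : Ejoint F 0 = F (fun=> 1%:M).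
Proof.
rewrite /Ejoint (_ : (fun w => _) = fun=> F (fun=> 1%:M)) ?Rintegral_prob_cst //.
apply/funext => w; congr F; apply/funext => j; rewrite /joint mul0r.
by have [_ _ -> _ _] := hB j.
Qed.

Definition tlap F (A : J -> M) : R :=
  2^-1 * \sum_j T j * laplacian beta (fun g => F (@dfwith J (fun=> M) A j g)) (A j).

Lemma pd_esum X (s : seq (expr R I)) : pd X (esum s) = esum [seq pd X e | e <- s].
Proof. by elim: s => //= e s IH; rewrite /pd /= -/(pd X _) -IH. Qed.

Lemma evm_pd2_scale X (c : R) (e : expr R I) g :
  evm (pd X (pd X (Mul (Cst c) e))) g = c * evm (pd X (pd X e)) g.
Proof. by rewrite /evm /pd /=; ring. Qed.

(** The generator acts on one factor at a time and maps expressions to expressions, so the result is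
    again a sum of products, indexed by the term and the factor acted upon. *)
Lemma tlap_lincomb (K : finType) (c : K -> R) (h : K -> J -> expr R I) F A :
  (forall A, F A = \sum_k c k * \prod_j evm (h k j) (A j)) ->
  tlap F A = \sum_(x : K * J) (c x.1 * T x.2) *
    \prod_j evm (if j == x.2 then Gx beta (h x.1 j) else h x.1 j) (A j).
Proof.
move=> E; rewrite /tlap mulr_sumr.
rewrite -(pair_bigA _ (fun (k : K) (i : J) => (c k * T i) *
    \prod_j evm (if j == i then Gx beta (h k j) else h k j) (A j))) exchange_big /=.
apply: eq_bigr => j _.
pose a k := c k * \prod_(i | i != j) evm (h k i) (A i).
pose e := esum [seq Mul (Cst (a k)) (h k j) | k <- index_enum K].
have -> : (fun g => F (@dfwith J (fun=> M) A j g)) = evm e.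
  apply/funext => g; rewrite E /evm eval_esum big_map; apply: eq_bigr => k _.
  rewrite (bigD1 j) //= dfwithin /a -!mulrA; congr (_ * _).
  rewrite mulrC; congr (_ * _); apply: eq_bigr => i ij.
  by rewrite dfwithout // eq_sym.
rewrite laplacian_evm mulrCA.
have -> : 2^-1 * evm (elap beta e) (A j) = evm (Gx beta e) (A j) by [].
rewrite GxE mulr_sumr mulr_sumr.
transitivity (\sum_k \sum_(X <- beta) T j * (2^-1 * (a k * evm (pd X (pd X (h k j))) (A j)))).
  rewrite exchange_big /=; apply: eq_bigr => X _.
  rewrite -!mulr_sumr; congr (_ * (_ * _)).
  rewrite /e !pd_esum -!map_comp /evm eval_esum big_map; apply: eq_bigr => k _.
  exact: evm_pd2_scale.
apply: eq_bigr => k _; rewrite (bigD1 j) //= eqxx GxE -!mulr_sumr.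
rewrite (eq_bigr (fun i => evm (h k i) (A i))) => [|i /negbTE -> //].
rewrite /a; ring.
Qed.

Lemma is_derive_bigsum (K : Type) (s : seq K) (f : K -> R -> R) (l : K -> R) (t : R) :
  (forall k, is_derive t 1 (f k) (l k)) ->
  is_derive t 1 (fun u => \sum_(k <- s) f k u) (\sum_(k <- s) l k).
Proof.
move=> H; elim: s => [|k s IH].
  rewrite big_nil; apply: is_derive_ext (is_derive_cst (0 : R) t 1) => u.
  by rewrite big_nil.
rewrite big_cons; apply: is_derive_ext (is_deriveD' (H k) IH) => u.
by rewrite big_cons.
Qed.

Lemma is_derive_prod (f : J -> R -> R) (l : J -> R) (t : R) :
  (forall j, is_derive t 1 (f j) (l j)) ->
  is_derive t 1 (fun s => \prod_j f j s) (\sum_j l j * \prod_(i | i != j) f i t).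
Proof.
move=> H; have := index_enum_uniq J.
suff G (s : seq J) : uniq s -> is_derive t 1 (fun u => \prod_(j <- s) f j u)
    (\sum_(j <- s) l j * \prod_(i <- s | i != j) f i t) by exact: G.
elim: s => [_|j s IH /= /andP[js /IH {}IH]].
  rewrite big_nil; apply: is_derive_ext (is_derive_cst (1 : R) t 1) => u.
  by rewrite big_nil.
have D := is_deriveM' (H j) IH.
rewrite [X in is_derive _ _ _ X](_ : _ = l j * \prod_(i <- s) f i t +
   f j t * \sum_(j0 <- s) l j0 * \prod_(i <- s | i != j0) f i t).
  by apply: is_derive_ext D => u; rewrite big_cons.
rewrite big_cons big_cons eqxx /= mulr_sumr; congr (_ + _).
  congr (_ * _); rewrite big_seq_cond [RHS]big_seq; apply: eq_bigl => i.
  by case: (boolP (i \in s)) => //= si; apply: contraNneq js => <-.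
rewrite big_seq [RHS]big_seq; apply: eq_bigr => i si.
rewrite big_cons ifT 1?mulrCA //; by apply: contraNneq js => ->.
Qed.

(** Expectations of products factorise, so the product rule reduces the claim to one-factor Dynkin
    formulas, with [T j] appearing through the change of clock. *)
Lemma Ejoint_derive F (t : R) : tensor F -> 0 < t ->
  is_derive t 1 (Ejoint F) (Ejoint (tlap F) t).
Proof.
move=> [K [c [h [ph E]]]] t0.
have G u : 0 <= u -> Ejoint F u = \sum_k c k * \prod_j Eexp Pr (B j) (h k j) (u * T j).
  by move=> u0; have [] := Ejoint_lincomb u0 ph E.
have E' := fun A => tlap_lincomb A E.
have ph' (x : K * J) j : is_poly (if j == x.2 then Gx beta (h x.1 j) else h x.1 j).
  by case: ifP => // _; exact: is_poly_Gx.
have [_ ->] := Ejoint_lincomb (ltW t0) ph' E'.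
(* The factorised formula is known only at nonnegative times, which form a neighbourhood of t. *)
apply: (@near_is_derive _ (fun u : R => \sum_k c k * \prod_j Eexp Pr (B j) (h k j) (u * T j))).
  by near=> u; apply/esym/G/ltW; near: u; exact: lt_nbhsr.
rewrite -(pair_bigA _ (fun (k : K) (i : J) => (c k * T i) *
    \prod_j Eexp Pr (B j) (if j == i then Gx beta (h k j) else h k j) (t * T j))) /=.
apply: is_derive_bigsum => k.
have D := is_derive_prod (fun j => Eexp_derive (hB j) (ph k j) (hT j) t0).
have := is_deriveM' (is_derive_cst (c k) t 1) D.
rewrite mul0r add0r mulr_sumr; congr (is_derive _ _ _ _).
apply: eq_bigr => i _; rewrite [in RHS](bigD1 i) //= eqxx.
rewrite [in RHS](eq_bigr (fun j => Eexp Pr (B j) (h k j) (t * T j))) => [|j /negbTE -> //].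
by rewrite !mulrA.
Unshelve. all: by end_near. Qed.

Lemma Ejoint_continuous F : tensor F -> {within `[0, 1], continuous (Ejoint F)}.
Proof.
move=> [K [c [h [ph E]]]].
suff cG : {within `[0, 1], continuous (fun u : R => \sum_k c k * \prod_j Eexp Pr (B j) (h k j) (u * T j))}.
  apply: (subspace_eq_continuous _ cG) => u; rewrite inE /= in_itv /= => /andP[u0 _].
  by rewrite /from_subspace; have [_ ->] := Ejoint_lincomb u0 ph E.
move=> u; rewrite /continuous_at /from_subspace; elim: (index_enum K) => [|k ks IHk].
  by rewrite big_nil (eq_cvg _ _ (fun n => big_nil _ _ _ _)); exact: cvg_cst.
rewrite big_cons (eq_cvg _ _ (fun n => big_cons _ _ _ _ _ _)); apply: cvgD IHk.
apply: cvgMr.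
elim: (index_enum J) => [|j s IH].
  by rewrite big_nil (eq_cvg _ _ (fun n => big_nil _ _ _ _)); exact: cvg_cst.
rewrite big_cons (eq_cvg _ _ (fun n => big_cons _ _ _ _ _ _)); apply: cvgM IH.
exact: Eexp_continuous.
Qed.

End JointProcess.

(** * Trace polynomials and exponentials of operators *)

Section TracePolynomialAlgebra.
Context {R : realType} {J : finType}.
Local Notation Pol := (trpoly R J).
Implicit Types (P Q : Pol) (m : cmon J) (v : word J -> CC R).

Lemma mon_degreeEw m (d : {fset word J}) : (finsupp m `<=` d)%fset ->
  mon_degree m = (\sum_(e <- d) size (sval e) * m e)%N.
Proof.
move=> le; rewrite /mon_degree (big_fset_incl _ le) //.
by move=> i i_in_d; rewrite -cmE_neq0 negbK => /eqP ->; rewrite muln0.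
Qed.

Lemma mon_degreeM m1 m2 : mon_degree (mulcm m1 m2) = (mon_degree m1 + mon_degree m2)%N.
Proof.
have D : finsupp (mulcm m1 m2) = (finsupp m1 `|` finsupp m2)%fset by exact: mdomD.
rewrite {1}/mon_degree D (mon_degreeEw (fsubsetUl _ (finsupp m2))).
rewrite (mon_degreeEw (fsubsetUr (finsupp m1) _)) -big_split /=.
by apply: eq_bigr => i _; rewrite mulcmE mulnDr.
Qed.

Lemma mon_degree1 : mon_degree (onecm (word J)) = 0%N.
Proof. by rewrite /mon_degree (_ : finsupp _ = fset0) ?big_seq_fset0 //; exact: mdom1. Qed.

(** Named so that the monomial part of [peval] can carry a multiplicative structure, from which the
    homomorphism property follows. *)
Definition mon_eval v m : CC R := \prod_(e <- finsupp m) v e ^+ m e.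

Lemma mon_evalEw v m (d : {fset word J}) : (finsupp m `<=` d)%fset ->
  mon_eval v m = \prod_(e <- d) v e ^+ m e.
Proof.
move=> le; rewrite /mon_eval (big_fset_incl _ le) //.
by move=> i i_in_d; rewrite -cmE_neq0 negbK => /eqP ->; rewrite expr0.
Qed.

Lemma mon_eval_mmorphism v : mmorphism (mon_eval v).
Proof.
split=> [m1 m2|]; last first.
  by rewrite /mon_eval (_ : finsupp _ = fset0) ?big_seq_fset0 //; exact: mdom1.
have D : finsupp (mmul m1 m2) = (finsupp m1 `|` finsupp m2)%fset by exact: mdomD.
rewrite {1}/mon_eval D (mon_evalEw v (fsubsetUl _ (finsupp m2))).
rewrite (mon_evalEw v (fsubsetUr (finsupp m1) _)) -big_split /=.
by apply: eq_bigr => i _; rewrite mulcmE exprD.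
Qed.
HB.instance Definition _ v := isMultiplicative.Build _ _ (mon_eval v) (mon_eval_mmorphism v).

Lemma pevalE v : peval v = mmap idfun (mon_eval v). Proof. by []. Qed.

Lemma pevalD v : {morph peval v : P Q / P + Q}. Proof. exact: mmapD. Qed.
Lemma pevalB v : {morph peval v : P Q / P - Q}. Proof. exact: mmapB. Qed.
Lemma pevalM v : {morph peval v : P Q / P * Q}.
Proof. by move=> P Q; rewrite pevalE; exact: (mmap_is_multiplicative (h := mon_eval v)).1. Qed.
Lemma peval_1 v : peval v 1 = 1. Proof. exact: (mmap1 (h := mon_eval v)). Qed.
Lemma pevalZ v (c : CC R) P : peval v (c *: P) = c * peval v P.
Proof. exact: (mmapZ (h := mon_eval v)). Qed.
Lemma peval_prod v I (r : seq I) (p : pred I) (F : I -> Pol) :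
  peval v (\prod_(i <- r | p i) F i) = \prod_(i <- r | p i) peval v (F i).
Proof. by apply: big_morph; [exact: pevalM|exact: peval_1]. Qed.

Lemma degree_leP n P : degree_le n P <-> forall m, (n < mon_degree m)%N -> mcoeff m P = 0.
Proof.
split=> [H m nm|H m mP].
  by apply: mcoeff_outdom; apply: contraL nm => /H; rewrite -leqNgt.
rewrite leqNgt; apply: contraL mP => /H /eqP; by rewrite mcoeff_eq0.
Qed.

Lemma degree_le_weak n n' P : (n <= n')%N -> degree_le n P -> degree_le n' P.
Proof. by move=> nn H m /H /leq_trans; exact. Qed.

Lemma degree_leD n P Q : degree_le n P -> degree_le n Q -> degree_le n (P + Q).
Proof.
by move=> /degree_leP HP /degree_leP HQ; apply/degree_leP => m h; rewrite mcoeffD HP // HQ // addr0.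
Qed.

Lemma degree_leZ n (c : CC R) P : degree_le n P -> degree_le n (c *: P).
Proof. by move=> /degree_leP HP; apply/degree_leP => m h; rewrite mcoeffZ HP // mulr0. Qed.

Lemma degree_leB n P Q : degree_le n P -> degree_le n Q -> degree_le n (P - Q).
Proof. by move=> hP hQ; rewrite -scaleN1r; apply: degree_leD => //; exact: degree_leZ. Qed.

Lemma degree_le1 : degree_le 0 (1 : Pol).
Proof.
move=> m; rewrite -mcoeff_neq0 mcoeff1; have [-> _|_] := eqVneq m mone; last by rewrite eqxx.
by rewrite (_ : mon_degree _ = 0%N) //; exact: mon_degree1.
Qed.

Lemma degree_leC n (c : CC R) : degree_le n (c *: 1 : Pol).
Proof. by apply/degree_leZ/(degree_le_weak _ degree_le1). Qed.

Lemma degree_leM n n' P Q : degree_le n P -> degree_le n' Q -> degree_le (n + n') (P * Q).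
Proof.
move=> HP HQ m /msuppM_le [m1 [m2 [h1 h2 ->]]].
by rewrite (mon_degreeM m1 m2) leq_add // ?HP // HQ.
Qed.

Lemma degree_le_prod n I (r : seq I) (F : I -> Pol) :
  (forall i, degree_le n (F i)) -> degree_le (size r * n) (\prod_(i <- r) F i).
Proof.
move=> H; elim: r => [|i r IH]; first by rewrite big_nil mul0n; exact: degree_le1.
by rewrite big_cons mulSn; exact: degree_leM.
Qed.

(** Words occurring in a monomial of degree at most d have length and exponent at most d, so
    finitely many bounded exponents determine the monomial. The type [W] also contains the empty
    tuple, which [insub] discards. *)
Lemma finite_monomials d : finite_set [set m : cmon J | (mon_degree m <= d)%N].
Proof.
pose W := {n : 'I_d.+1 & n.-tuple (J * bool)}.
pose w (x : W) : option (word J) := insub (tval (tagged x)).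
pose f m : option {ffun W -> 'I_d.+1} :=
  if (mon_degree m <= d)%N then Some [ffun x => inord (if w x is Some e then m e else 0%N)] else None.
have -> : [set m : cmon J | (mon_degree m <= d)%N] = f @^-1` [set x | x != None].
  by apply/seteqP; split=> m; rewrite /f /=; case: ifP.
apply: finite_preimage; last exact: finite_finset.
have small m (e : word J) : (mon_degree m <= d)%N -> (size (sval e) * m e <= d)%N.
  move=> md; apply: leq_trans md.
  have [em|] := boolP (e \in finsupp m); last by rewrite -cmE_neq0 negbK => /eqP ->; rewrite muln0.
  by rewrite /mon_degree (big_fsetD1 e) //= leq_addr.
have pos (e : word J) : (0 < size (sval e))%N by case: e => -[].
move=> m1 m2; rewrite !inE /= /f; case: ifP => // d1 _; case: ifP => // d2 _ [] E.
apply/eqP/cmP => e.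
have [le|gt] := leqP (size (sval e)) d; last first.
  have Z m : (mon_degree m <= d)%N -> m e = 0%N.
    move=> /small-/(_ e); case: (m e) => // n h; have := leq_trans gt (leq_trans (leq_pmulr _ (ltn0Sn n)) h).
    by rewrite ltnn.
  by rewrite !Z.
pose x : W := Tagged (fun n : 'I_d.+1 => n.-tuple (J * bool)) (in_tuple (sval e) : (Ordinal (le : (size (sval e) < d.+1)%N)).-tuple _).
have wx : w x = Some e by rewrite /w /x /= valK.
have /ffunP/(_ x) := E; rewrite !ffunE wx => /(congr1 val) /=.
have b m : (mon_degree m <= d)%N -> (m e < d.+1)%N.
  by move=> /small-/(_ e); apply: leq_trans; rewrite leq_pmull.
by rewrite !inordK ?b.
Qed.

Definition monomials d : {fset cmon J} := fset_set [set m | (mon_degree m <= d)%N].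

Lemma mem_monomials d m : (m \in monomials d) = (mon_degree m <= d)%N.
Proof. by rewrite in_fset_set; [rewrite mem_setE|exact: finite_monomials]. Qed.

Lemma msupp_monomials d P : degree_le d P -> (msupp P `<=` monomials d)%fset.
Proof. by move=> H; apply/fsubsetP => m /H; rewrite mem_monomials. Qed.

Definition Umon m : Pol := mkmalgU m 1.

Lemma poly_expand d P : degree_le d P -> P = \sum_(m <- monomials d) mcoeff m P *: Umon m.
Proof.
move=> h; rewrite {1}(monalgEw (msupp_monomials h)); apply: eq_bigr => m _.
apply/malgP => k; rewrite mcoeffZ [LHS]mcoeffU [mcoeff k (Umon m)]mcoeffU.
by case: (m == k); rewrite ?mulr1n ?mulr0n ?mulr1 ?mulr0.
Qed.

(** The l^1 norm of the coefficients: it is submultiplicative and dominates evaluation at the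
    identity. *)
Definition pn P : R := \sum_(m <- msupp P) n1 (mcoeff m P).

Lemma pnEw P (D : {fset cmon J}) : (msupp P `<=` D)%fset -> pn P = \sum_(m <- D) n1 (mcoeff m P).
Proof.
move=> le; rewrite /pn (big_fset_incl _ le) //.
by move=> m _ /mcoeff_outdom ->; rewrite n10.
Qed.

Lemma pn_ge0 P : 0 <= pn P. Proof. by apply: sumr_ge0 => m _; exact: n1_ge0. Qed.

Lemma pn0 : pn 0 = 0. Proof. by rewrite /pn msupp0 big_seq_fset0. Qed.

Lemma pnD P Q : pn (P + Q) <= pn P + pn Q.
Proof.
rewrite (pnEw (msuppD_le _ _)) (pnEw (fsubsetUl (msupp P) (msupp Q))).
rewrite (pnEw (fsubsetUr (msupp P) (msupp Q))) -big_split /=.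
by apply: ler_sum => m _; rewrite mcoeffD n1D.
Qed.

Lemma pnZ (c : CC R) P : pn (c *: P) <= n1 c * pn P.
Proof.
rewrite (pnEw (msuppZ_le c P)) mulr_sumr; apply: ler_sum => m _.
by rewrite mcoeffZ n1M.
Qed.

Lemma pnN P : pn (- P) = pn P.
Proof. by rewrite /pn msuppN; apply: eq_bigr => m _; rewrite mcoeffN n1N. Qed.

Lemma pnB P Q : pn (P - Q) <= pn P + pn Q.
Proof. by apply: le_trans (pnD _ _) _; rewrite pnN. Qed.

Lemma pn_sum I (r : seq I) (p : pred I) (F : I -> Pol) :
  pn (\sum_(i <- r | p i) F i) <= \sum_(i <- r | p i) pn (F i).
Proof.
elim/big_rec2: _ => [|i y z _ H]; first by rewrite pn0.
by apply: (le_trans (pnD _ _)); rewrite lerD2l.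
Qed.

Lemma pnU (c : CC R) m : pn (mkmalgU m c) = n1 c.
Proof. by rewrite (pnEw msuppU_le) big_seq_fset1 mcoeffUU. Qed.

Lemma pnM P Q : pn (P * Q) <= pn P * pn Q.
Proof.
rewrite malgME /pn mulr_suml; apply: (le_trans (pn_sum _ _ _)); apply: ler_sum => k _.
rewrite mulr_sumr; apply: (le_trans (pn_sum _ _ _)); apply: ler_sum => l _.
by rewrite pnU n1M.
Qed.

Lemma n1_mcoeff P m : n1 (mcoeff m P) <= pn P.
Proof.
have [mP|/mcoeff_outdom ->] := boolP (m \in msupp P); last by rewrite n10 pn_ge0.
by rewrite /pn (big_fsetD1 m) //= lerDl; apply: sumr_ge0 => k _; exact: n1_ge0.
Qed.

Lemma n1_peval1 P : n1 (peval1 P) <= pn P.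
Proof.
rewrite /peval1 /peval mmapE; apply: (le_trans (n1_sum _ _ _)); apply: ler_sum => m _.
by rewrite big1 ?mulr1 // => e _; rewrite expr1n.
Qed.

Lemma linear_expand (V : lmodType (CC R)) (A : {linear Pol -> V}) d P : degree_le d P ->
  A P = \sum_(m <- monomials d) mcoeff m P *: A (Umon m).
Proof. by move=> /poly_expand {1}->; rewrite linear_sum; apply: eq_bigr => m _; rewrite linearZ. Qed.

(** Polynomials of degree at most d are spanned by finitely many monomials; the norms of the images
    of these add up to the constant. *)
Lemma linear_bounded (A : {linear Pol -> Pol}) d : exists2 C : R, 0 <= C &
  forall P, degree_le d P -> pn (A P) <= C * pn P.
Proof.
exists (\sum_(m <- monomials d) pn (A (Umon m))) => [|P dP].
  by apply: sumr_ge0 => m _; exact: pn_ge0.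
rewrite (linear_expand A dP) mulr_suml; apply: (le_trans (pn_sum _ _ _)).
apply: ler_sum => m _; apply: (le_trans (pnZ _ _)); rewrite mulrC ler_wpM2l ?pn_ge0 //.
exact: n1_mcoeff.
Qed.

End TracePolynomialAlgebra.

(** * Exponentials of operators that do not increase the degree *)

Section ExponentialOfOperators.
Context {R : realType} {J : finType}.
Local Notation Pol := (trpoly R J).
Implicit Types (P Q : Pol) (m : cmon J) (A : {linear Pol -> Pol}).

(* Locked, as unfolding [exp_op] makes failing unifications very slow. *)
Definition EX : (Pol -> Pol) -> R -> Pol -> Pol :=
  locked (fun (A : Pol -> Pol) (t : R) => exp_op (fun P' => RtoC t *: A P')).

Lemma EXE (A : Pol -> Pol) t P : EX A t P = exp_op (fun P' => RtoC t *: A P') P.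
Proof. by rewrite /EX -lock. Qed.

Lemma linZ A (c : CC R) P : A (c *: P) = c *: A P. Proof. exact: linearZ. Qed.

Lemma degree_exists P : exists d, degree_le d P.
Proof.
exists (\sum_(m <- msupp P) mon_degree m)%N => m mP.
by rewrite (big_fsetD1 m) //= leq_addr.
Qed.

Lemma degree_le_iter A d k P : degree_nonincreasing A -> degree_le d P -> degree_le d (iter k A P).
Proof. by move=> hA hP; elim: k => //= k; exact: hA. Qed.

Lemma pn_iter A d (C : R) k P : degree_nonincreasing A -> 0 <= C ->
  (forall P, degree_le d P -> pn (A P) <= C * pn P) -> degree_le d P ->
  pn (iter k A P) <= pn P * C ^+ k.
Proof.
move=> hA C0 H dP; elim: k => [|k IH] /=; first by rewrite expr0 mulr1.
apply: (le_trans (H _ (degree_le_iter hA dP))).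
by rewrite exprS mulrCA ler_wpM2l.
Qed.

Lemma cgeo_iter A d (C : R) P m : degree_nonincreasing A -> 0 <= C ->
  (forall P, degree_le d P -> pn (A P) <= C * pn P) -> degree_le d P ->
  cgeo_bounded (fun k => mcoeff m (iter k A P)) (pn P) C.
Proof.
move=> hA C0 H dP; split=> // k; apply: (le_trans (n1_mcoeff _ _)).
by apply: (@pn_iter A d C k P).
Qed.

(* [done] diverges on this goal; [erefl] does not. *)
Lemma iter_scale A (c : CC R) k P : iter k (fun P' => c *: A P') P = c ^+ k *: iter k A P.
Proof.
elim: k => [|k IH]; first by rewrite expr0 scale1r.
rewrite [LHS]iterS [in RHS]iterS IH linZ scalerA exprS; exact: erefl.
Qed.

Lemma mcoeff_sum_Umon d (f : cmon J -> CC R) k :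
  mcoeff k (\sum_(m <- monomials d) f m *: Umon m) = if k \in monomials d then f k else 0.
Proof.
rewrite raddf_sum /= (eq_bigr (fun m => f m * (m == k)%:R)); last first.
  by move=> m _; rewrite [LHS]mcoeffZ; congr (_ * _); exact: mcoeffU.
case: ifPn => kd; last first.
  apply: big1_seq => m /= md; have [mk|] := eqVneq m k; last by rewrite mulr0.
  by rewrite mk (negbTE kd) in md.
rewrite (big_fsetD1 k kd) /= eqxx mulr1 big1_seq ?addr0 // => m /=.
by rewrite in_fsetD1 => /andP[/negbTE -> _]; rewrite mulr0.
Qed.

Lemma cexpser_zero (t : R) : cexpser (fun=> 0 : CC R) t = 0.
Proof.
have := cexpserZ (0 : CC R) t (cgeo0 (lexx (0 : R))).
rewrite [RHS]mul0r => H; rewrite -[RHS]H; congr (cexpser _ t).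
by apply/funext => k; rewrite mul0r.
Qed.

(** [exp_op] chooses some coefficientwise limit. One is built explicitly, supported on finitely many
    monomials by the degree bound, and uniqueness of limits identifies the choice with it. *)
Lemma EX_coef A t P m : degree_nonincreasing A ->
  mcoeff m (EX A t P) = cexpser (fun k => mcoeff m (iter k A P)) t.
Proof.
move=> hA; have [d dP] := degree_exists P; have [C C0 HC] := linear_bounded A d.
have cv k : (fun n : nat => mcoeff k (\sum_(j < n) (j`!%:R)^-1 *:
    iter j (fun P' => RtoC t *: A P') P)) @ \oo --> cexpser (fun j => mcoeff k (iter j A P)) t.
  have H := @cvg_cexpser _ _ _ _ t (cgeo_iter k hA C0 HC dP).
  rewrite (eq_cvg _ _ (_ : _ =1 fun n : nat => \sum_(j < n) (j`!%:R)^-1 *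
    (RtoC t ^+ j * mcoeff k (iter j A P)))) // => n.
  by rewrite raddf_sum; apply: eq_bigr => j _; rewrite iter_scale [LHS]mcoeffZ mcoeffZ.
pose Q := \sum_(k <- monomials d) cexpser (fun j => mcoeff k (iter j A P)) t *: Umon k.
have QE k : mcoeff k Q = cexpser (fun j => mcoeff k (iter j A P)) t.
  rewrite mcoeff_sum_Umon; case: ifPn => [_|kd]; first exact: erefl.
  rewrite -(cexpser_zero t); congr (cexpser _ t); apply/funext => j.
  rewrite mem_monomials -ltnNge in kd; apply/esym.
  exact: ((degree_leP d _).1 (degree_le_iter hA dP)).
have SQ : [set Q : Pol | forall k, (fun n : nat => mcoeff k (\sum_(j < n) (j`!%:R)^-1 *:
    iter j (fun P' => RtoC t *: A P') P)) @ \oo --> mcoeff k Q] Q.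
  by move=> k; rewrite QE; exact: cv.
have H := xgetPex 0 (ex_intro _ Q SQ) m; rewrite EXE.
exact: (cvg_unique (@norm_hausdorff _ _) H (cv m)).
Qed.

Lemma EX_linear A t : degree_nonincreasing A -> linear (EX A t).
Proof.
move=> hA c P Q; apply/malgP => m; rewrite [RHS]mcoeffD [X in _ = X + _]mcoeffZ.
rewrite (EX_coef t (c *: P + Q) m hA) (EX_coef t P m hA) (EX_coef t Q m hA).
have [d dP] := degree_exists P; have [d' dQ] := degree_exists Q.
have [C C0 HC] := linear_bounded A (maxn d d').
have gP := cgeo_iter m hA C0 HC (degree_le_weak (leq_maxl d d') dP).
have gQ := cgeo_iter m hA C0 HC (degree_le_weak (leq_maxr d d') dQ).
rewrite -(cexpserZ c t gP) -(cexpserD t (cgeoZ c gP) gQ); congr (cexpser _ t).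
apply/funext => k; rewrite -mcoeffZ -mcoeffD; congr (mcoeff m _).
by elim: k => //= k ->; rewrite linearP.
Qed.

Lemma EX_degree A t d P : degree_nonincreasing A -> degree_le d P -> degree_le d (EX A t P).
Proof.
move=> hA dP; apply/degree_leP => m dm; rewrite EX_coef // -(cexpser_zero t).
congr (cexpser _ t); apply/funext => k.
by rewrite ((degree_leP d _).1 (degree_le_iter hA dP)).
Qed.

Lemma EX0 A P : degree_nonincreasing A -> EX A 0 P = P.
Proof. by move=> hA; apply/malgP => m; rewrite EX_coef // cexpser0. Qed.

End ExponentialOfOperators.

(* Ring identities are proved in an abstract ring: unification at the type of
   trace polynomials is very slow. *)
Lemma leibniz_cons (S : comNzRingType) (I : eqType) (i : I) (r : seq I) (f g : I -> S) :
  i \notin r ->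
  g i * (\prod_(j <- r) f j) + f i * (\sum_(j <- r) g j * \prod_(k <- r | k != j) f k) =
  \sum_(j <- i :: r) g j * \prod_(k <- i :: r | k != j) f k.
Proof.
move=> ir; rewrite [RHS]big_cons big_cons eqxx /= mulr_sumr; congr (_ + _).
  congr (_ * _); rewrite big_seq_cond [RHS]big_seq_cond; apply: eq_bigl => j.
  by case: (boolP (j \in r)) => //= jr; apply/esym; apply: contraNneq ir => <-.
apply: eq_big_seq => j jr.
rewrite big_cons ifT; last by apply: contraNneq ir => ->.
exact: mulrCA.
Qed.

(** * Differential calculus for curves of trace polynomials *)

Section PolynomialCurves.
Context {R : realType} {J : finType}.
Local Notation Pol := (trpoly R J).
Implicit Types (P Q : Pol) (m : cmon J) (A : {linear Pol -> Pol}) (F G : R -> Pol).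

Definition pderiv F (t : R) (dF : Pol) : Prop :=
  forall m, cderiv (fun s => mcoeff m (F s)) t (mcoeff m dF).

(** One degree bound for all times confines the curve to a finite-dimensional space, where
    coefficientwise derivatives can be passed through linear maps. *)
Definition dbounded (d : nat) F : Prop := forall s, degree_le d (F s).

Lemma pderiv_eq F t dF dF' : pderiv F t dF -> dF = dF' -> pderiv F t dF'.
Proof. by move=> H <-. Qed.

Lemma pderiv_cst P t : pderiv (fun=> P) t 0.
Proof. by move=> m; rewrite mcoeff0; exact: cderiv_cst. Qed.

Lemma pderivB F G t dF dG : pderiv F t dF -> pderiv G t dG ->
  pderiv (fun s => F s - G s) t (dF - dG).
Proof.
move=> hF hG m; rewrite mcoeffB.
have H := cderivD (hF m) (cderivZ (-1) (hG m)).
apply: (cderiv_eq (l := mcoeff m dF + -1 * mcoeff m dG)); last by rewrite mulN1r.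
by apply: cderiv_ext H => s; rewrite mcoeffB mulN1r.
Qed.

Lemma pderiv_degree d F t dF : dbounded d F -> pderiv F t dF -> degree_le d dF.
Proof.
move=> bF hF; apply/degree_leP => m dm.
have Z s : mcoeff m (F s) = 0 by exact: ((degree_leP d _).1 (bF s)).
have [Hr Hi] := hF m.
have U (f : R -> R) l : (forall s, f s = 0) -> is_derive t 1 f l -> l = 0.
  move=> f0 H; have -> : l = 'D_1 f t by apply/esym; exact: (@derive_val _ _ _ _ _ _ _ H).
  have -> : f = fun=> 0 by apply/funext.
  exact: derive_cst.
apply: CC_eq; [apply: U Hr|apply: U Hi] => s; by rewrite Z.
Qed.

Lemma linear_expand' (G : Pol -> Pol) d P : linear G -> degree_le d P ->
  G P = \sum_(m <- monomials d) mcoeff m P *: G (Umon m).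
Proof.
move=> lG dP; pose GL : {linear Pol -> Pol} := HB.pack G (GRing.isLinear.Build _ _ _ _ G lG).
exact: (linear_expand GL dP).
Qed.

(** A Leibniz rule for a moving linear map applied to a moving vector. Fixed linear maps, products
    and exponentials are all instances; the proof expands over the finite basis of monomials. *)
Lemma pderiv_apply d F dF (G : R -> Pol -> Pol) (dG : Pol -> Pol) t :
  (forall s, linear (G s)) -> linear dG ->
  (forall m, pderiv (fun s => G s (Umon m)) t (dG (Umon m))) ->
  dbounded d F -> pderiv F t dF ->
  pderiv (fun s => G s (F s)) t (dG (F t) + G t dF).
Proof.
move=> lG ldG hG bF hF m; have ddF := pderiv_degree bF hF.
have E s P : degree_le d P -> mcoeff m (G s P) =
    \sum_(k <- monomials d) mcoeff k P * mcoeff m (G s (Umon k)).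
  move=> dP; rewrite (linear_expand' (lG s) dP) raddf_sum /=.
  by apply: eq_bigr => k _; rewrite [LHS]mcoeffZ.
have E' P : degree_le d P -> mcoeff m (dG P) =
    \sum_(k <- monomials d) mcoeff k P * mcoeff m (dG (Umon k)).
  move=> dP; rewrite (linear_expand' ldG dP) raddf_sum /=.
  by apply: eq_bigr => k _; rewrite [LHS]mcoeffZ.
rewrite mcoeffD (E t _ ddF) (E' _ (bF t)) -big_split /=.
apply: (@cderiv_ext _ (fun s => \sum_(k <- monomials d)
    mcoeff k (F s) * mcoeff m (G s (Umon k)))).
  by move=> s; rewrite (E s _ (bF s)).
apply: cderiv_sum => k _; apply: (cderiv_eq (cderivM (hF k) (hG k m))).
by rewrite addrC.
Qed.

Lemma linear_zero : linear (fun _ : Pol => 0 : Pol).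
Proof. by move=> c P Q; rewrite scaler0 addr0. Qed.

Lemma pderiv_lin d F dF (A : Pol -> Pol) t : linear A -> dbounded d F -> pderiv F t dF ->
  pderiv (fun s => A (F s)) t (A dF).
Proof.
move=> lA bF hF.
have := pderiv_apply (G := fun=> A) (fun=> lA) linear_zero (fun m => pderiv_cst (A (Umon m)) t) bF hF.
by rewrite add0r.
Qed.

Lemma pderivM d d' F G dF dG t : dbounded d F -> dbounded d' G ->
  pderiv F t dF -> pderiv G t dG -> pderiv (fun s => F s * G s) t (dF * G t + F t * dG).
Proof.
move=> bF bG hF hG.
apply: (pderiv_apply (G := fun s P => F s * P) (dG := fun P => dF * P) _ _ _ bG hG).
- by move=> s c P Q; rewrite mulrDr -scalerAr.
- by move=> c P Q; rewrite mulrDr -scalerAr.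
- move=> m; apply: (pderiv_lin (A := fun P => P * Umon m) _ bF hF).
  by move=> c P Q; rewrite mulrDl -scalerAl.
Qed.

Lemma pderiv_prod (I : eqType) (r : seq I) d (F : I -> R -> Pol) (dF : I -> Pol) t :
  uniq r -> (forall i, dbounded d (F i)) -> (forall i, pderiv (F i) t (dF i)) ->
  pderiv (fun s => \prod_(i <- r) F i s) t (\sum_(i <- r) dF i * \prod_(j <- r | j != i) F j t).
Proof.
move=> ur bF hF; elim: r ur => [_|i r IH /= /andP[ir /IH {}IH]].
  rewrite big_nil (_ : (fun s => _) = fun=> 1); first exact: pderiv_cst.
  by apply/funext => s; rewrite big_nil.
have -> : (fun s => \prod_(j <- i :: r) F j s) = fun s => F i s * \prod_(j <- r) F j s.
  by apply/funext => s; rewrite big_cons.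
have bG : dbounded (size r * d) (fun s => \prod_(j <- r) F j s).
  by move=> s; apply: degree_le_prod => j; exact: bF.
apply: (pderiv_eq (pderivM (bF i) bG (hF i) IH)).
exact: leibniz_cons.
Qed.

Lemma EX_comm A t P : degree_nonincreasing A -> EX A t (A P) = A (EX A t P).
Proof.
move=> hA; have [d dP] := degree_exists P; have [C C0 HC] := linear_bounded A d.
apply/malgP => m; rewrite (EX_coef t (A P) m hA).
rewrite (linear_expand A (EX_degree (t := t) hA dP)) raddf_sum /=.
rewrite (eq_bigr (fun k => mcoeff m (A (Umon k)) * cexpser (fun j => mcoeff k (iter j A P)) t)); last first.
  by move=> k _; rewrite [LHS]mcoeffZ (EX_coef t P k hA) mulrC.
rewrite -(cexpser_sum _ (a := fun=> pn P) t C0); last first.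
  by move=> k _; exact: (cgeo_iter k hA C0 HC dP).
congr (cexpser _ t); apply/funext => j; rewrite -iterSr iterS.
rewrite (linear_expand A (degree_le_iter (k := j) hA dP)) raddf_sum /=.
by apply: eq_bigr => k _; rewrite [LHS]mcoeffZ mulrC.
Qed.

Lemma EX_zero A t : degree_nonincreasing A -> EX A t 0 = 0.
Proof.
move=> hA; apply/malgP => m; rewrite (EX_coef t 0 m hA) mcoeff0 -(cexpser_zero t).
congr (cexpser _ t); apply/funext => k; rewrite (_ : iter k A 0 = 0) ?mcoeff0 //.
by elim: k => //= k ->; rewrite linear0.
Qed.

Lemma pderiv_EX_cst A t P : degree_nonincreasing A ->
  pderiv (fun s => EX A s P) t (EX A t (A P)).
Proof.
move=> hA m; have [d dP] := degree_exists P; have [C C0 HC] := linear_bounded A d.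
rewrite (EX_coef t (A P) m hA).
apply: (@cderiv_ext _ (cexpser (fun k => mcoeff m (iter k A P)))).
  by move=> s; rewrite (EX_coef s P m hA).
apply: (cderiv_eq (cderiv_cexpser t (cgeo_iter m hA C0 HC dP))).
by congr (cexpser _ t); apply/funext => k; rewrite -iterSr.
Qed.

Lemma pderiv_EX d A F dF t : degree_nonincreasing A -> dbounded d F -> pderiv F t dF ->
  pderiv (fun s => EX A s (F s)) t (EX A t (A (F t) + dF)).
Proof.
move=> hA bF hF.
have H := pderiv_apply (G := fun s => EX A s) (dG := fun P => EX A t (A P)) _ _ _ bF hF.
apply: (pderiv_eq (H _ _ _)).
- by move=> s; exact: EX_linear.
- by move=> c P Q; rewrite linearP (EX_linear t hA).
- by move=> m; exact: pderiv_EX_cst.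
- by rewrite -[A (F t)]scale1r (EX_linear t hA) !scale1r.
Qed.

Lemma pderiv_EX_rev A c t P : degree_nonincreasing A ->
  pderiv (fun s => EX A (c - s) P) t (- A (EX A (c - t) P)).
Proof.
move=> hA m; have := cderiv_rev (pderiv_EX_cst (c - t) P hA m).
by rewrite mcoeffN (EX_comm _ _ hA).
Qed.

Lemma peval1_expand d P : degree_le d P -> peval1 P = \sum_(m <- monomials d) mcoeff m P.
Proof.
move=> dP; rewrite /peval1 /peval (mmapEw (msupp_monomials dP)); apply: eq_bigr => m _.
by rewrite big1 ?mulr1 // => e _; rewrite expr1n.
Qed.

Lemma cderiv_peval1 d F t dF : dbounded d F -> pderiv F t dF ->
  cderiv (fun s => peval1 (F s)) t (peval1 dF).
Proof.
move=> bF hF; rewrite (peval1_expand (pderiv_degree bF hF)).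
apply: (@cderiv_ext _ (fun s => \sum_(m <- monomials d) mcoeff m (F s))).
  by move=> s; rewrite (peval1_expand (bF s)).
by apply: cderiv_sum => m _.
Qed.

Lemma cderiv_within (f : R -> CC R) (df : R -> CC R) (a b : R) :
  (forall t, cderiv f t (df t)) ->
  {within `[a, b], continuous (fun t => re (f t))} /\
  {within `[a, b], continuous (fun t => im (f t))}.
Proof.
by move=> H; split; apply: continuous_subspaceT => t; have [h1 h2] := H t;
  [exact: is_derive_continuous h1|exact: is_derive_continuous h2].
Qed.

Lemma cderiv_global_bound (f df : R -> CC R) (a b M : R) : a <= b ->
  (forall t, cderiv f t (df t)) -> (forall t, a <= t <= b -> n1 (df t) <= M) ->
  n1 (f b - f a) <= 2 * (M * (b - a)).
Proof.
move=> ab H HM; have [cr ci] := cderiv_within a b H.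
by apply: (cderiv_bound ab cr ci (dF := df)) => // t /andP[/ltW t1 /ltW t2]; apply: HM; rewrite t1.
Qed.

Definition nmon d : R := (#|` monomials (J := J) d|)%:R.

Lemma pn_le_nmon d P (M : R) : degree_le d P -> (forall m, n1 (mcoeff m P) <= M) ->
  pn P <= nmon d * M.
Proof.
move=> dP H; rewrite (pnEw (msupp_monomials dP)).
apply: (@le_trans _ _ (\sum_(m <- monomials (J := J) d) M)); first by apply: ler_sum => m _.
by rewrite big_const_seq count_predT iter_addr_0 /nmon mulr_natl.
Qed.

Lemma pderiv_bound d F (dF : R -> Pol) (a b M : R) : a <= b -> dbounded d F ->
  (forall t, pderiv F t (dF t)) -> (forall t, a <= t <= b -> pn (dF t) <= M) ->
  pn (F b - F a) <= nmon d * (2 * (M * (b - a))).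
Proof.
move=> ab bF H HM; apply: pn_le_nmon => [|m]; first exact: degree_leB.
rewrite mcoeffB.
apply: (cderiv_global_bound ab (f := fun s => mcoeff m (F s)) (fun t => H t m)) => t tab.
exact: le_trans (n1_mcoeff _ _) (HM t tab).
Qed.

Lemma EX_bound A d (C : R) t P : degree_nonincreasing A -> 0 <= C ->
  (forall P, degree_le d P -> pn (A P) <= C * pn P) -> degree_le d P -> `|t| <= 1 ->
  pn (EX A t P) <= nmon d * (2 * expR C) * pn P.
Proof.
move=> hA C0 HC dP t1; rewrite -mulrA; apply: pn_le_nmon => [|m]; first exact: EX_degree.
rewrite (EX_coef t P m hA); apply: (le_trans (n1_cexpser t (cgeo_iter m hA C0 HC dP))).
rewrite -mulrA ler_wpM2l // [leRHS]mulrC ler_wpM2l ?pn_ge0 // ler_expR.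
by rewrite -[leRHS]mulr1 ler_wpM2l.
Qed.

(** The curve s |-> e^{sA} e^{(c-s)A} P has derivative 0, since A commutes with its exponential. *)
Lemma EX_semigroup A (c t : R) P : degree_nonincreasing A -> 0 <= t ->
  EX A t (EX A (c - t) P) = EX A c P.
Proof.
move=> hA t0; have [d dP] := degree_exists P.
have bF : dbounded d (fun s => EX A (c - s) P) by move=> s; exact: EX_degree.
have H s : pderiv (fun s => EX A s (EX A (c - s) P)) s 0.
  apply: (pderiv_eq (pderiv_EX hA bF (pderiv_EX_rev c s P hA))).
  by rewrite [X in EX A s X](_ : _ = 0) ?EX_zero // subrr.
apply/malgP => m; apply/eqP; rewrite -subr_eq0; apply/eqP.
have := cderiv_global_bound (f := fun s => mcoeff m (EX A s (EX A (c - s) P))) (df := fun=> 0) (M := 0) t0.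
rewrite mul0r mulr0 /= subr0 (EX0 _ hA) => /(_ _ _) h.
have : n1 (mcoeff m (EX A t (EX A (c - t) P)) - mcoeff m (EX A c P)) <= 0.
  apply: h => [s|s _]; last by rewrite n10.
  by have := H s m; rewrite mcoeff0.
move=> h0; have e := le_trans (re_le_n1 _) h0; have e' := le_trans (im_le_n1 _) h0.
by apply: CC_eq; apply/eqP; rewrite -normr_le0.
Qed.

(** Duhamel's formula: the curve s |-> e^{sA} e^{(t-s)A'} P joins the two exponentials and has
    derivative e^{sA} (A - A') e^{(t-s)A'} P. The outer [nmon d] and 2 come from bounding
    coefficients one by one. *)
Lemma EX_diff A A' d (C delta : R) t P :
  degree_nonincreasing A -> degree_nonincreasing A' -> 0 <= C -> 0 <= delta ->
  (forall P, degree_le d P -> pn (A P) <= C * pn P) ->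
  (forall P, degree_le d P -> pn (A' P) <= C * pn P) ->
  (forall P, degree_le d P -> pn (A P - A' P) <= delta * pn P) ->
  degree_le d P -> 0 <= t <= 1 ->
  pn (EX A t P - EX A' t P) <=
  nmon d * (2 * (nmon d * (2 * expR C) * (delta * (nmon d * (2 * expR C) * pn P)))).
Proof.
move=> hA hA' C0 del0 HC HC' Hd dP /andP[t0 t1].
set K := nmon d * (2 * expR C).
have K0 : 0 <= K by rewrite /K mulr_ge0 ?ler0n // mulr_ge0 // expR_ge0.
have bF : dbounded d (fun s => EX A' (t - s) P) by move=> s; exact: EX_degree.
have bF' : dbounded d (fun s => EX A s (EX A' (t - s) P)) by move=> s; exact: EX_degree.
have M0 : 0 <= K * (delta * (K * pn P)) by rewrite !mulr_ge0 // pn_ge0.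
have := pderiv_bound t0 bF' (fun s => pderiv_EX hA bF (pderiv_EX_rev t s P hA'))
  (M := K * (delta * (K * pn P))).
rewrite (subrr t) !(subr0 t) (EX0 (EX A' t P) hA) (EX0 P hA') => H.
apply: (le_trans (H _)) => [s /andP[s0 st]|].
  have ts1 : `|t - s| <= 1 by rewrite ger0_norm ?subr_ge0 //; lra.
  have s1 : `|s| <= 1 by rewrite ger0_norm //; lra.
  have dX : degree_le d (EX A' (t - s) P) by exact: EX_degree.
  apply: (le_trans (EX_bound hA C0 HC _ s1)).
    by apply: degree_leB; [exact: hA|exact: hA'].
  rewrite ler_wpM2l //; apply: (le_trans (Hd _ dX)); rewrite ler_wpM2l //.
  exact: EX_bound.
rewrite ler_wpM2l ?ler0n // ler_wpM2l //.
by rewrite -[leRHS]mulr1 ler_wpM2l.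
Qed.

Lemma EX_fixed A t P : degree_nonincreasing A -> 0 <= t -> A P = 0 -> EX A t P = P.
Proof.
move=> hA t0 AP; have [d dP] := degree_exists P.
have bF : dbounded d (fun=> P) by [].
have bF' : dbounded d (fun s => EX A s P) by move=> s; exact: EX_degree.
have H (s : R) : pderiv (fun s => EX A s P) s 0.
  by apply: (pderiv_eq (pderiv_EX_cst s P hA)); rewrite AP EX_zero.
apply/malgP => m; apply/eqP; rewrite -subr_eq0; apply/eqP.
have h0 : n1 (mcoeff m (EX A t P) - mcoeff m P) <= 0.
  have := cderiv_global_bound (f := fun s => mcoeff m (EX A s P)) (df := fun=> 0) (M := 0) t0.
  rewrite mul0r mulr0 /= (EX0 _ hA); apply => [s|s _]; last by rewrite n10.
  by have := H s m; rewrite mcoeff0.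
have e := le_trans (re_le_n1 _) h0; have e' := le_trans (im_le_n1 _) h0.
by apply: CC_eq; apply/eqP; rewrite -normr_le0.
Qed.

End PolynomialCurves.

(** * Second-order operators and fluctuations *)

Section SecondOrder.
Variables (S : comNzRingType) (K : finType).
Implicit Types (f g : K -> S) (A : {set K}).

Lemma sum_enum_set f g A :
  \sum_(i <- enum A) g i * \prod_(j <- enum A | j != i) f j =
  \sum_(i in A) g i * \prod_(j in A :\ i) f j.
Proof.
rewrite big_enum; apply: eq_bigr => i iA; congr (_ * _).
by rewrite big_enum_cond; apply: eq_bigl => j; rewrite in_setD1 andbC.
Qed.

Lemma derivation_prod (D : S -> S) f A :
  (forall a b, D (a * b) = D a * b + a * D b) ->
  D (\prod_(i in A) f i) = \sum_(i in A) D (f i) * \prod_(j in A :\ i) f j.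
Proof.
move=> hD; have D1 : D 1 = 0.
  by have := hD 1 1; rewrite !mulr1 mul1r => /eqP; rewrite addrC -subr_eq subrr eq_sym => /eqP.
rewrite -sum_enum_set -big_enum; elim: (enum A) (enum_uniq A) => [_|i r IH /= /andP[ir /IH {}IH]].
  by rewrite !big_nil.
by rewrite big_cons hD IH leibniz_cons.
Qed.

Variables (L : S -> S) (gam : S -> S -> S).
Hypothesis hL : forall a b, L (a * b) = L a * b + a * L b + (gam a b + gam b a).
Hypothesis gamM : forall a b c, gam a (b * c) = gam a b * c + gam a c * b.
Hypothesis gamC : forall a b, gam a b = gam b a.

(** Up to a defect, L is a derivation, and the defect is a derivation in each argument. It is
    written as [gam a b + gam b a] so that peeling off one factor adds exactly the two ordered pairs
    formed with each other factor. *)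
Lemma second_order f A :
  L (\prod_(i in A) f i) = \sum_(i in A) L (f i) * \prod_(j in A :\ i) f j +
  \sum_(i in A) \sum_(j in A :\ i) gam (f i) (f j) * \prod_(k in A :\ i :\ j) f k.
Proof.
have gam1 a : gam a 1 = 0.
  by have := gamM a 1 1; rewrite !mulr1 => /eqP; rewrite addrC -subr_eq subrr eq_sym => /eqP.
have L1 : L 1 = 0.
  have := hL 1 1; rewrite gam1 !mulr1 mul1r !addr0 => /eqP.
  by rewrite addrC -subr_eq subrr eq_sym => /eqP.
have [n] := ubnP #|A|; elim: n A => // n IH A An.
have [->|/finset.set0Pn[x xA]] := eqVneq A finset.set0; first by rewrite !finset.big_set0 addr0 L1.
have Bn : (#|A :\ x| < n)%N by move: An; rewrite (cardsD1 x) xA.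
have PE : \prod_(i in A) f i = f x * \prod_(i in A :\ x) f i by rewrite (big_setD1 x).
have PD i : i \in A :\ x -> \prod_(j in A :\ i) f j = f x * \prod_(j in A :\ x :\ i) f j.
  rewrite in_setD1 => /andP[ix iA]; rewrite (big_setD1 x) ?in_setD1 1?eq_sym ?ix //=.
  by congr (_ * _); apply: eq_bigl => j; rewrite !in_setD1 andbCA.
have PDD i j : i \in A :\ x -> j \in A :\ x :\ i ->
    \prod_(k in A :\ i :\ j) f k = f x * \prod_(k in A :\ x :\ i :\ j) f k.
  rewrite !in_setD1 => /andP[ix iA] /and3P[ji jx jA].
  rewrite (big_setD1 x) ?in_setD1 ?xA 1?eq_sym ?jx 1?eq_sym ?ix //=.
  congr (_ * _); apply: eq_bigl => k; rewrite !in_setD1.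
  by case: (k == x); case: (k == j); case: (k == i).
have gP : gam (f x) (\prod_(i in A :\ x) f i) =
    \sum_(j in A :\ x) gam (f x) (f j) * \prod_(k in A :\ x :\ j) f k.
  by apply: (@derivation_prod (gam (f x))) => a b; rewrite gamM [gam _ b * a]mulrC.
rewrite PE hL (IH _ Bn) [gam _ (f x)]gamC gP.
rewrite [in RHS](big_setD1 x) //= [X in _ = _ + X](big_setD1 x) //=.
have -> : \sum_(i in A :\ x) L (f i) * \prod_(j in A :\ i) f j =
    f x * \sum_(i in A :\ x) L (f i) * \prod_(j in A :\ x :\ i) f j.
  by rewrite mulr_sumr; apply: eq_bigr => i iA; rewrite PD // mulrCA.
have -> : \sum_(i in A :\ x) \sum_(j in A :\ i) gam (f i) (f j) * \prod_(k in A :\ i :\ j) f k =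
    \sum_(i in A :\ x) gam (f x) (f i) * \prod_(k in A :\ x :\ i) f k +
    f x * \sum_(i in A :\ x) \sum_(j in A :\ x :\ i) gam (f i) (f j) * \prod_(k in A :\ x :\ i :\ j) f k.
  rewrite mulr_sumr -big_split /=; apply: eq_bigr => i iA.
  have xAi : x \in A :\ i by move: iA; rewrite !in_setD1 eq_sym => /andP[-> _]; rewrite xA.
  rewrite (big_setD1 x) //= gamC; congr (_ + _).
    by congr (_ * _); apply: eq_bigl => k; rewrite !in_setD1 andbCA.
  rewrite mulr_sumr; have -> : (A :\ i :\ x = A :\ x :\ i)%SET.
    by apply/setP => k; rewrite !in_setD1 andbCA.
  by apply: eq_bigr => j jA; rewrite PDD // mulrCA.
rewrite mulrDr; set u := f x * _; set v := f x * _; set w := \sum_(i in _) _; set y := L _ * _.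
by rewrite addrA [RHS]addrA; ring.
Qed.

End SecondOrder.

Lemma three_halves_le (F : realFieldType) (x u v t z y : F) : u <= x -> v <= x -> t <= x ->
  y <= z + t -> z <= u + v -> 0 <= x -> 2^-1 * y <= 2 * x.
Proof. lra. Qed.

Lemma rearrange5 (F : comPzRingType) (n k e c p : F) :
  n * (2 * (k * (e * c * (k * p)))) = e * (n * (2 * (k * (c * k))) * p).
Proof. by ring. Qed.

Lemma rearrange3 (F : comPzRingType) (c e r : F) : 2 * c * (e * r * r) = e * (2 * c * (r * r)).
Proof. by ring. Qed.

Lemma rearrange3' (F : comPzRingType) (c e r : F) : 2 * c * (r * (e * r)) = e * (2 * c * (r * r)).
Proof. by ring. Qed.

Lemma linear_sub (F : pzRingType) (U V : lmodType F) (f : U -> V) (a b : U) :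
  linear f -> f (a - b) = f a - f b.
Proof. by move=> lf; rewrite addrC -scaleN1r lf scaleN1r addrC. Qed.

Lemma rearrange4 (F : comPzRingType) (v k b : F) : v * (k * (k * b)) = k * (k * (v * b)).
Proof. by ring. Qed.

Lemma split_error (F : comPzRingType) (a p m l h : F) :
  a + p * m - l * h = a + ((p - l) * m + l * (m - h)).
Proof. by ring. Qed.

Lemma split_sub (V : zmodType) (x y z : V) : x - z = (x - y) + (y - z).
Proof. by rewrite addrA subrK. Qed.

Lemma within_continuousB (R : realType) (A : set R) (f g : R -> R) :
  {within A, continuous f} -> {within A, continuous g} ->
  {within A, continuous (fun s => f s - g s)}.
Proof.
move=> /subspace_continuousP cf /subspace_continuousP cg; apply/subspace_continuousP => u Au.
by apply: cvgB; [exact: cf|exact: cg].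
Qed.

Lemma addDB (V : zmodType) (a b : V) : a + b - a = b.
Proof. by rewrite addrC addKr. Qed.

Lemma prod_setD1 (S : comNzRingType) (K : finType) (i : K) (A B : {set K}) (f g : K -> S) (x : S) :
  i \in A -> (A :\ i)%SET = B -> f i = x -> (forall k, k \in B -> f k = g k) ->
  \prod_(k in A) f k = x * \prod_(k in B) g k.
Proof. by move=> iA <- <- H; rewrite (big_setD1 i iA); congr (_ * _); exact: eq_bigr. Qed.

Lemma mul_prod_eq0 (S : comNzRingType) (K : finType) (a : S) (i : K) (A : {set K}) (f : K -> S) :
  i \in A -> f i = 0 -> a * \prod_(k in A) f k = 0.
Proof. by move=> iA f0; rewrite (big_setD1 i iA) /= f0 mul0r mulr0. Qed.

Lemma shift_mul (F : pzRingType) (S : comAlgType F) (a b : S) (c : F) :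
  (a - c *: 1) * b = - c *: b + a * b.
Proof. by rewrite mulrBl -scalerAl mul1r scaleNr addrC. Qed.

Section CarreDuChamp.
Variables (F : numFieldType) (S : comAlgType F).
Implicit Types (a b c : S).

Lemma half_add a : 2^-1 *: a + 2^-1 *: a = a.
Proof. by rewrite -scalerDl -mulr2n -[X in X *: _]mulr_natr mulVf ?scale1r // pnatr_eq0. Qed.

Variable L : S -> S.
Definition carre a b := 2^-1 *: (L (a * b) - L a * b - a * L b).

Lemma carreC a b : carre a b = carre b a.
Proof.
rewrite /carre [b * a]mulrC [L b * a]mulrC [b * L a]mulrC; congr (_ *: _).
by rewrite addrAC.
Qed.

Lemma carre_L a b : L (a * b) = L a * b + a * L b + (carre a b + carre b a).
Proof. by rewrite [carre b a]carreC half_add; ring. Qed.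

(** The three-factor identity for L is precisely the derivation property of its defect. *)
Lemma carreM a b c :
  (forall a b c, L (a * b * c) = L (a * b) * c + a * L (b * c) + L (a * c) * b
                 - L a * b * c - a * L b * c - a * b * L c) ->
  carre a (b * c) = carre a b * c + carre a c * b.
Proof.
move=> hL; rewrite /carre -!scalerAl -scalerDr mulrA hL; congr (_ *: _); ring.
Qed.

Lemma second_order_one :
  (forall a b c, L (a * b * c) = L (a * b) * c + a * L (b * c) + L (a * c) * b
                 - L a * b * c - a * L b * c - a * b * L c) -> L 1 = 0.
Proof. move=> hL; have := hL 1 1 1; rewrite !mulr1 !mul1r => ->; ring. Qed.

Lemma derivation_one (D : S -> S) : (forall a b, D (a * b) = D a * b + a * D b) -> D 1 = 0.
Proof.
by move=> hD; have := hD 1 1; rewrite !mulr1 mul1r => /eqP; rewrite addrC -subr_eq subrr eq_sym => /eqP.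
Qed.

Lemma carreBl a a' b : zmod_morphism L -> carre (a - a') b = carre a b - carre a' b.
Proof. by move=> lL; rewrite /carre -scalerBr mulrBl !lL; congr (_ *: _); ring. Qed.

Lemma carre_cst (c : F) b : scalable L -> L 1 = 0 -> carre (c *: 1) b = 0.
Proof.
move=> lL L1; rewrite /carre -scalerAl mul1r !lL L1 scaler0 mul0r subr0 -scalerAl mul1r subrr.
by rewrite scaler0.
Qed.

Lemma generator_cst (D : S -> S) (e c : F) : scalable D -> scalable L -> D 1 = 0 -> L 1 = 0 ->
  D (c *: 1) + e *: L (c *: 1) = 0.
Proof. by move=> sD sL D1 L1; rewrite sD sL D1 L1 !scaler0 addr0. Qed.

(** The derivatives of the factors cancel D and all first-order contributions of L; only the pair
    terms of L survive. *)
Lemma generator_product (K : finType) (D G : S -> S) (e : F) (f : K -> S) (g : K -> K -> S)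
    (A : {set K}) :
  (forall a, G a = D a + e *: L a) ->
  (forall a b, D (a * b) = D a * b + a * D b) ->
  (forall a b c, L (a * b * c) = L (a * b) * c + a * L (b * c) + L (a * c) * b
                 - L a * b * c - a * L b * c - a * b * L c) ->
  (forall i j, carre (f i) (f j) = g i j) ->
  G (\prod_(i in A) f i) + \sum_(i in A) - G (f i) * \prod_(j in A :\ i) f j =
  e *: \sum_(i in A) \sum_(j in A :\ i) g i j * \prod_(k in A :\ i :\ j) f k.
Proof.
move=> hG hD hL hg; rewrite hG.
under [X in _ + X]eq_bigr => i _ do rewrite hG.
under [in RHS]eq_bigr => i _ do under eq_bigr => j _ do rewrite -hg.
rewrite (derivation_prod f A hD).
rewrite (@second_order S K L carre carre_L (fun a b c => carreM a b c hL) carreC f A) scalerDr.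
have -> : \sum_(i in A) - (D (f i) + e *: L (f i)) * \prod_(j in A :\ i) f j =
    - (\sum_(i in A) D (f i) * \prod_(j in A :\ i) f j +
       e *: \sum_(i in A) L (f i) * \prod_(j in A :\ i) f j).
  rewrite scaler_sumr -big_split -sumrN; apply: eq_bigr => i _ /=.
  by rewrite mulNr mulrDl scalerAl.
by rewrite opprD !addrA; ring.
Qed.

End CarreDuChamp.

(** * Centred moments: evolution, uniform bounds and limit *)

Section Fluctuations.
Context {R : realType} {J : finType} {K : finType}.
Local Notation Pol := (trpoly R J).
Variables (D L : {linear Pol -> Pol}).
Hypotheses (hDdeg : degree_nonincreasing D) (hLdeg : degree_nonincreasing L).
Hypothesis hD : forall P Q : Pol, D (P * Q) = D P * Q + P * D Q.
Hypothesis hL : forall P Q S : Pol,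
  L (P * Q * S) = L (P * Q) * S + P * L (Q * S) + L (P * S) * Q
                  - L P * Q * S - P * L Q * S - P * Q * L S.
Implicit Types (P : Pol) (Q : K -> Pol) (S : {set K}).

Local Notation gam := (carre_du_champ L).

Lemma gamE P P' : gam P P' = carre (S := Pol) L P P'. Proof. exact: erefl. Qed.

(** Gamma of a constant with anything is 0, so centring the factors does not change the pair
    terms. *)
Lemma gam_shift (c c' : CC R) P P' : gam (P - c *: 1) (P' - c' *: 1) = gam P P'.
Proof.
have L1 : L 1 = 0 := second_order_one hL.
have lL : zmod_morphism L by exact: raddfB.
have sL : scalable L by move=> x X; exact: linZ.
have z (x : CC R) X : carre (S := Pol) L (x *: 1) X = 0 := carre_cst x X sL L1.
rewrite !gamE (carreBl _ _ _ lL) z subr0 carreC (carreBl _ _ _ lL) z subr0 carreC.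
exact: erefl.
Qed.

Lemma gam_degree d P P' : degree_le d P -> degree_le d P' -> degree_le (d + d) (gam P P').
Proof.
move=> dP dP'; apply: degree_leZ; apply: degree_leB; last first.
  by apply: degree_leM => //; exact: hLdeg.
apply: degree_leB; first by apply: hLdeg; exact: degree_leM.
by apply: degree_leM => //; exact: hLdeg.
Qed.

Lemma gam_bound d (C : R) P P' : 0 <= C ->
  (forall P, degree_le (d + d) P -> pn (L P) <= C * pn P) ->
  degree_le d P -> degree_le d P' -> pn (gam P P') <= 2 * C * (pn P * pn P').
Proof.
move=> C0 HC dP dP'; have w : (d <= d + d)%N by rewrite leq_addr.
apply: (le_trans (pnZ _ _)).
have -> : n1 (2^-1 : CC R) = 2^-1.
  by rewrite -RtoC_nat -RtoC_inv n1_RtoC ger0_norm.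
have b1 : pn (L (P * P')) <= C * (pn P * pn P').
  apply: (le_trans (HC _ (degree_leM dP dP'))); rewrite ler_wpM2l //; exact: pnM.
have b2 : pn (L P * P') <= C * (pn P * pn P').
  apply: (le_trans (pnM _ _)); rewrite mulrA ler_wpM2r ?pn_ge0 //.
  exact: HC (degree_le_weak w dP).
have b3 : pn (P * L P') <= C * (pn P * pn P').
  apply: (le_trans (pnM _ _)); rewrite mulrCA ler_wpM2l ?pn_ge0 //.
  exact: HC (degree_le_weak w dP').
rewrite -[leRHS]mulrA.
(* Three terms of equal size times 1/2 give 3/2, rounded up to 2. *)
apply: three_halves_le b1 b2 b3 (pnB _ _) (pnB _ _) _.
by rewrite mulr_ge0 // mulr_ge0 // pn_ge0.
Qed.

Lemma gamB P1 P2 P1' P2' :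
  gam P1 P1' - gam P2 P2' = gam (P1 - P2) P1' + gam P2 (P1' - P2').
Proof.
have lL : zmod_morphism L by exact: raddfB.
rewrite !gamE (carreBl _ _ _ lL) [carre L P2 (P1' - P2')]carreC (carreBl _ _ _ lL).
rewrite [carre L P1' P2]carreC [carre L P2' P2]carreC.
by rewrite addrA subrK.
Qed.

Definition Aop (e : R) : {linear Pol -> Pol} := (D \+ (RtoC e \*: L))%R.

Lemma AopE e P : Aop e P = D P + RtoC e *: L P. Proof. exact: erefl. Qed.

Lemma Aop_degree e : degree_nonincreasing (Aop e).
Proof. by move=> d P dP; apply: degree_leD; [exact: hDdeg|apply: degree_leZ; exact: hLdeg]. Qed.

Arguments Aop_degree : clear implicits.

Lemma Aop_cst e (c : CC R) : Aop e (c *: 1) = 0.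
Proof.
have L1 : L 1 = 0 := second_order_one hL.
have D1 : D 1 = 0 := derivation_one hD.
have sD : scalable D by move=> x X; exact: linZ.
have sL : scalable L by move=> x X; exact: linZ.
rewrite AopE.
have H := (@generator_cst _ Pol L D (RtoC e) c sD sL D1 L1).
exact: H.
Qed.

(** The constant holds for all [e] in [0, 1] at once; this is where uniformity in N starts. *)
Lemma Aop_bounded d : exists2 C : R, 0 <= C & forall e P, 0 <= e <= 1 -> degree_le d P ->
  pn (Aop e P) <= C * pn P /\ pn (D P) <= C * pn P /\ pn (Aop e P - D P) <= e * C * pn P.
Proof.
have [C1 C10 H1] := linear_bounded D d; have [C2 C20 H2] := linear_bounded L d.
exists (C1 + C2) => [|e P /andP[e0 e1] dP]; first exact: addr_ge0.
have h1 := H1 P dP; have h2 := H2 P dP; have p0 := pn_ge0 P.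
have h3 : pn (RtoC e *: L P) <= e * (C2 * pn P).
  by apply: (le_trans (pnZ _ _)); rewrite n1_RtoC ger0_norm // ler_wpM2l.
have h4 : e * (C2 * pn P) <= C2 * pn P by rewrite -[leRHS]mul1r ler_wpM2r // mulr_ge0.
split; last split.
- by rewrite mulrDl; apply: (le_trans (pnD _ _)); apply: lerD => //; exact: le_trans h4.
- by rewrite mulrDl; apply: (le_trans h1); rewrite lerDl mulr_ge0.
- rewrite AopE (addDB (D P)); apply: (le_trans h3).
  by rewrite -mulrA ler_wpM2l // mulrDl lerDr mulr_ge0.
Qed.

(** Algebraic counterpart of the expectation of [P]_N at time t when e = N^-2; the two are
    identified at t = 1 by [mexp_Phi]. *)
Definition Phi (e t : R) P : CC R := peval1 (EX (Aop e) t P).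

Lemma Phi_linear e t c P P' : Phi e t (c *: P + P') = c * Phi e t P + Phi e t P'.
Proof. by rewrite /Phi (EX_linear t (Aop_degree e)) /peval1 pevalD pevalZ. Qed.

Lemma PhiZ e t c P : Phi e t (c *: P) = c * Phi e t P.
Proof. by rewrite /Phi -[c *: P]addr0 (EX_linear t (Aop_degree e)) EX_zero ?addr0 /peval1 ?pevalZ //; exact: Aop_degree. Qed.

Lemma PhiD e t P P' : Phi e t (P + P') = Phi e t P + Phi e t P'.
Proof. by have := Phi_linear e t 1 P P'; rewrite scale1r mul1r. Qed.

Lemma Phi_sum e t I (r : seq I) (p : pred I) (f : I -> Pol) :
  Phi e t (\sum_(i <- r | p i) f i) = \sum_(i <- r | p i) Phi e t (f i).
Proof.
apply: big_morph; first exact: PhiD.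
by rewrite /Phi (EX_zero t (Aop_degree e)) /peval1 /peval; exact: mmap0.
Qed.

Lemma Phi1 e t c : 0 <= t -> Phi e t (c *: 1) = c.
Proof.
move=> t0; rewrite /Phi (EX_fixed (Aop_degree e) t0 (Aop_cst e c)) /peval1 pevalZ peval_1.
exact: mulr1.
Qed.

Lemma Phi_bound d : exists2 C : R, 0 <= C & forall e t P, 0 <= e <= 1 -> `|t| <= 1 ->
  degree_le d P -> pn (EX (Aop e) t P) <= C * pn P /\ n1 (Phi e t P) <= C * pn P.
Proof.
have [C C0 HC] := Aop_bounded d.
exists (@nmon R J d * (2 * expR C)) => [|e t P e01 t1 dP].
  by rewrite mulr_ge0 ?ler0n // mulr_ge0 // expR_ge0.
have H : pn (EX (Aop e) t P) <= @nmon R J d * (2 * expR C) * pn P.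
  apply: (EX_bound (Aop_degree e) C0 _ dP t1) => P' dP'.
  by have [] := HC e P' e01 dP'.
by split=> //; apply: le_trans H; exact: n1_peval1.
Qed.

Definition epsN (N : nat) : R := (N%:R ^+ 2)^-1.

Lemma epsN01 N : (0 < N)%N -> 0 <= epsN N <= 1.
Proof.
move=> N0; rewrite /epsN invr_ge0 exprn_ge0 //= invf_le1 ?exprn_gt0 ?ltr0n //.
by rewrite exprn_ege1 // ler1n.
Qed.

Definition centered e t Q (i : K) : Pol := Q i - Phi e t (Q i) *: 1.

Definition cmoment (N : nat) t S Q : CC R :=
  N%:R ^+ #|S| * Phi (epsN N) t (\prod_(i in S) centered (epsN N) t Q i).

Definition backward e (c : R) Q (s : R) (i : K) : Pol := EX (Aop e) (c - s) (Q i).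

(** The subtracted mean does not depend on s, so the derivative of the curve is -A applied to the
    curve itself. *)
Definition centered_back e c Q (i : K) (s : R) : Pol := backward e c Q s i - Phi e c (Q i) *: 1.

Lemma Aop_shift e P c : Aop e (P - c *: 1) = Aop e P.
Proof.
apply: etrans (raddfB (Aop e) P (c *: 1)) _.
exact: etrans (congr1 (fun x => Aop e P - x) (Aop_cst e c)) (subr0 _).
Qed.

Lemma pderiv_centered e c Q i s :
  pderiv (centered_back e c Q i) s (- Aop e (centered_back e c Q i s)).
Proof.
apply: (pderiv_eq (pderivB (pderiv_EX_rev c s (Q i) (Aop_degree e)) (pderiv_cst (Phi e c (Q i) *: 1) s))).
by rewrite subr0 /centered_back Aop_shift.
Qed.

Lemma centered_back_degree d e c Q i : degree_le d (Q i) -> dbounded d (centered_back e c Q i).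
Proof.
move=> dQ s; apply: degree_leB; last exact: degree_leC.
exact: (EX_degree (Aop_degree e) dQ).
Qed.

(** The exponential contributes A of the product, and the backward evolution subtracts A from each
    factor; [generator_product] leaves the pair terms. *)
Lemma cderiv_centered_product e c d Q S s : (forall i, degree_le d (Q i)) ->
  cderiv (fun s => Phi e s (\prod_(i in S) centered_back e c Q i s)) s
    (RtoC e * Phi e s (\sum_(i in S) \sum_(j in S :\ i)
       gam (backward e c Q s i) (backward e c Q s j) *
       \prod_(k in S :\ i :\ j) centered_back e c Q k s)).
Proof.
move=> dQ; have bF i : dbounded d (centered_back e c Q i) by exact: centered_back_degree.
have bP : dbounded (size (enum S) * d) (fun s => \prod_(i <- enum S) centered_back e c Q i s).
  by move=> u; apply: degree_le_prod => i; exact: bF.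
have bE : dbounded (size (enum S) * d)
    (fun s => EX (Aop e) s (\prod_(i <- enum S) centered_back e c Q i s)).
  by move=> u; apply: EX_degree; [exact: Aop_degree|exact: bP].
have H := pderiv_EX (Aop_degree e) bP (pderiv_prod (enum_uniq S) bF
  (fun i => pderiv_centered e c Q i s)).
have := cderiv_peval1 bE H; move=> {}H.
apply: (cderiv_eq (l := Phi e s (Aop e (\prod_(i <- enum S) centered_back e c Q i s) +
  \sum_(i <- enum S) - Aop e (centered_back e c Q i s) *
    \prod_(j <- enum S | j != i) centered_back e c Q j s))).
  by apply: cderiv_ext H => u; exact: (congr1 (Phi e u) (big_enum _ _ _ _)).
rewrite -PhiZ; congr (Phi e s _).
have -> : \prod_(i <- enum S) centered_back e c Q i s = \prod_(i in S) centered_back e c Q i s.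
  exact: big_enum.
rewrite (sum_enum_set (centered_back e c Q ^~ s) (fun i => - Aop e (centered_back e c Q i s))).
have hg i j : carre (S := Pol) L (centered_back e c Q i s) (centered_back e c Q j s) =
    gam (backward e c Q s i) (backward e c Q s j).
  by rewrite -gamE gam_shift.
have H' := @generator_product _ Pol L K D (Aop e) (RtoC e) (fun i => centered_back e c Q i s)
  (fun i j => gam (backward e c Q s i) (backward e c Q s j)) S (AopE e) hD hL hg.
exact: H'.
Qed.

(** By the semigroup law, the mean at time s of the backward evolution is the mean of [Q i] at time
    c. Hence the curve passes through genuine centred moments, to which an induction hypothesis
    applies. *)
Lemma centered_backE e c Q i s : 0 <= s ->
  centered_back e c Q i s = centered e s (backward e c Q s) i.
Proof.
move=> s0; rewrite /centered_back /centered /backward {2}/Phi.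
by rewrite (EX_semigroup c (Q i) (Aop_degree e) s0).
Qed.

Definition override Q (i : K) P : K -> Pol := fun k => if k == i then P else Q k.

(** Split P into its centred part and its mean. The centred part takes the place of factor i in a
    moment of |S| - 1 factors, and the mean multiplies a moment of |S| - 2 factors. As e = N^-2, the
    prefactor N^(|S|-2) leaves 1/N for the former and 1 for the latter. *)
Lemma cmoment_step N s S Q i j P : (0 < N)%N -> i \in S -> j \in S :\ i ->
  N%:R ^+ #|S| * (RtoC (epsN N) *
    Phi (epsN N) s (P * \prod_(k in S :\ i :\ j) centered (epsN N) s Q k)) =
  N%:R^-1 * cmoment N s (S :\ j) (override Q i P) +
  Phi (epsN N) s P * cmoment N s (S :\ i :\ j) Q.
Proof.
move=> N0 iS jS; set e := epsN N; set n := #|S :\ i :\ j|.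
have [ji jS'] : j != i /\ j \in S by move: jS; rewrite in_setD1 => /andP.
have iSj : i \in S :\ j by rewrite in_setD1 eq_sym ji.
have ES : (S :\ j :\ i = S :\ i :\ j)%SET by apply/setP => k; rewrite !in_setD1 andbCA.
have c1 : #|S :\ j| = n.+1 by rewrite (cardsD1 i) iSj ES.
have c2 : #|S| = n.+2 by rewrite (cardsD1 j) jS' c1.
have -> : cmoment N s (S :\ j) (override Q i P) = N%:R ^+ n.+1 *
    (Phi e s (P * \prod_(k in S :\ i :\ j) centered e s Q k) -
     Phi e s P * Phi e s (\prod_(k in S :\ i :\ j) centered e s Q k)).
  rewrite /cmoment c1 -/e; congr (_ * _).
  have E : \prod_(k in S :\ j) centered e s (override Q i P) k =
      (P - Phi e s P *: 1) * \prod_(k in S :\ i :\ j) centered e s Q k.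
    apply: prod_setD1 iSj ES _ _ => [|k].
      by rewrite /centered /override eqxx.
    by rewrite in_setD1 => /andP[_]; rewrite in_setD1 /centered /override => /andP[/negbTE -> _].
  apply: (etrans (congr1 (Phi e s) (etrans E (shift_mul _ _ _)))).
  by rewrite Phi_linear mulNr addrC.
have Nn : (N%:R : CC R) != 0 by rewrite pnatr_eq0 -lt0n.
have -> : RtoC e = N%:R^-1 * N%:R^-1.
  by rewrite /e /epsN RtoC_inv rmorphXn /= RtoC_nat expr2 invfM.
rewrite /cmoment -/n c2 -/e; move: (Phi e s _) (Phi e s P) (Phi e s _) => x y z.
rewrite !exprS; field.
exact: Nn.
Qed.

Lemma n1_natV N : n1 (N%:R^-1 : CC R) = N%:R^-1.
Proof. by rewrite -RtoC_nat -RtoC_inv n1_RtoC ger0_norm // invr_ge0. Qed.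

Definition mcurve (N : nat) c Q S (s : R) : CC R :=
  N%:R ^+ #|S| * Phi (epsN N) s (\prod_(i in S) centered_back (epsN N) c Q i s).

Lemma mcurve_end N c Q S : mcurve N c Q S c = cmoment N c S Q.
Proof.
congr (_ * _); apply: (congr1 (Phi (epsN N) c)); apply: eq_bigr => i _.
rewrite /centered_back /backward subrr (EX0 _ (Aop_degree (epsN N))); exact: erefl.
Qed.

(** At time 0 the functional is evaluation at the identity. It is multiplicative and kills each
    factor, since the mean of [Q i] is by definition the evaluation of e^{cA} [Q i]. *)
Lemma mcurve_start N c Q S x : x \in S -> mcurve N c Q S 0 = 0.
Proof.
move=> xS; rewrite /mcurve /Phi (EX0 _ (Aop_degree (epsN N))) /peval1 peval_prod.
have E : peval (fun=> 1) (centered_back (epsN N) c Q x 0) = 0.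
  rewrite /centered_back /backward pevalB pevalZ peval_1 mulr1 subr0.
  exact: subrr.
exact: (mul_prod_eq0 (f := fun i => peval (fun=> 1) (centered_back (epsN N) c Q i 0)) _ xS E).
Qed.

Definition mcurve_d (N : nat) c Q S (s : R) : CC R :=
  N%:R ^+ #|S| * (RtoC (epsN N) * Phi (epsN N) s (\sum_(i in S) \sum_(j in S :\ i)
       gam (backward (epsN N) c Q s i) (backward (epsN N) c Q s j) *
       \prod_(k in S :\ i :\ j) centered_back (epsN N) c Q k s)).

Lemma cderiv_mcurve N c d Q S s : (forall i, degree_le d (Q i)) ->
  cderiv (mcurve N c Q S) s (mcurve_d N c Q S s).
Proof. by move=> dQ; apply: cderivZ; exact: cderiv_centered_product. Qed.

Lemma mcurve_dE N c Q S s : (0 < N)%N -> 0 <= s ->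
  let b := backward (epsN N) c Q s in
  mcurve_d N c Q S s = \sum_(i in S) \sum_(j in S :\ i)
    (N%:R^-1 * cmoment N s (S :\ j) (override b i (gam (b i) (b j))) +
     Phi (epsN N) s (gam (b i) (b j)) * cmoment N s (S :\ i :\ j) b).
Proof.
move=> N0 s0 b; rewrite /mcurve_d Phi_sum mulr_sumr mulr_sumr; apply: eq_bigr => i iS.
rewrite Phi_sum mulr_sumr mulr_sumr; apply: eq_bigr => j jS.
apply: etrans _ (cmoment_step s b (gam (b i) (b j)) N0 iS jS).
apply: (congr1 (fun X => N%:R ^+ #|S| * (RtoC (epsN N) * Phi (epsN N) s (gam (b i) (b j) * X)))).
by apply: eq_bigr => k _; exact: centered_backE.
Qed.

Lemma n1_sum_pairs (S : {set K}) (f : K -> K -> CC R) (C : R) : 0 <= C ->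
  (forall i j, i \in S -> j \in S :\ i -> n1 (f i j) <= C) ->
  n1 (\sum_(i in S) \sum_(j in S :\ i) f i j) <= #|K|%:R * (#|K|%:R * C).
Proof.
move=> C0 H; have G (A : {set K}) (g : K -> CC R) (M : R) : 0 <= M ->
    (forall i, i \in A -> n1 (g i) <= M) -> n1 (\sum_(i in A) g i) <= #|K|%:R * M.
  move=> M0 Hg; apply: (le_trans (n1_sum _ _ _)).
  apply: (@le_trans _ _ (\sum_(i in A) M)); first exact: ler_sum.
  by rewrite sumr_const -[leLHS]mulr_natl ler_wpM2r // ler_nat max_card.
apply: (G S) => [|i iS]; first by rewrite mulr_ge0.
by apply: (G (S :\ i)) => // j jS; exact: H.
Qed.

(* Integrating the derivative of the curve, centred moments of order n+1 are
   controlled by those of orders n and n-1 of polynomials of higher degree. *)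
Lemma cmoment_bound n : forall (d : nat) (rho : R), exists2 C : R, 0 <= C &
  forall N t S Q, (0 < N)%N -> 0 <= t <= 1 -> (#|S| <= n)%N ->
    (forall k, degree_le d (Q k) /\ pn (Q k) <= rho) -> n1 (cmoment N t S Q) <= C.
Proof.
have cm0 N t Q : 0 <= t -> cmoment N t finset.set0 Q = 1.
  move=> t0; rewrite /cmoment cards0 expr0 mul1r; have := Phi1 (epsN N) 1 t0.
  rewrite scale1r => E; apply: etrans E; apply: (congr1 (Phi (epsN N) t)).
  exact: finset.big_set0.
elim: n => [|n IH] d rho.
  exists 1 => // N t S Q _ /andP[t0 _]; rewrite leqn0 cards_eq0 => /eqP -> _.
  by rewrite cm0 // n11.
have [CK CK0 HK] := Phi_bound d; have [CL CL0 HL] := linear_bounded L (d + d).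
have [CG CG0 HG] := Phi_bound (d + d).
pose r1 := CK * `|rho|; pose r2 := 2 * CL * (r1 * r1).
have r10 : 0 <= r1 by rewrite mulr_ge0.
have r20 : 0 <= r2 by rewrite !mulr_ge0.
(* Gamma of two factors has degree up to 2d and norm up to r2, so the induction hypothesis is needed
   for larger parameters than those of the claim. *)
have [C C0 HC] := IH (d + d)%N (r1 + r2).
pose b := C + CG * r2 * C.
have b0 : 0 <= b by rewrite addr_ge0 // !mulr_ge0.
pose B := #|K|%:R * (#|K|%:R * b).
have B0 : 0 <= B by rewrite !mulr_ge0.
(* The 1 is the moment of the empty set, and 2B comes from integrating a derivative bounded by B. *)
exists (1 + 2 * B) => [|N t S Q N0 /andP[t0 t1] Sn HQ]; first by rewrite addr_ge0 // mulr_ge0.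
have [->|/finset.set0Pn[x xS]] := eqVneq S finset.set0.
  by rewrite cm0 // n11 lerDl mulr_ge0.
have e01 := epsN01 N0.
have := cderiv_global_bound t0 (fun s => cderiv_mcurve N t S s (fun i => (HQ i).1)) (M := B).
rewrite (mcurve_start N t Q xS) !subr0 mcurve_end => H.
apply: (le_trans (H _)); last first.
  have : 2 * (B * t) <= 2 * B by rewrite ler_wpM2l // -[leRHS]mulr1 ler_wpM2l.
  by move=> h; apply: (le_trans h); rewrite lerDr.
move=> s /andP[s0 st]; rewrite (mcurve_dE t Q S N0 s0) /=.
set bk := backward (epsN N) t Q s.
have s1 := le_trans st t1.
have as1 : `|s| <= 1 by rewrite ger0_norm.
have ts1 : `|t - s| <= 1.
  by rewrite ger0_norm ?subr_ge0 // lerBlDr; apply: (le_trans t1); rewrite lerDl.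
have dbk k : degree_le d (bk k) by apply: EX_degree; [exact: Aop_degree|exact: (HQ k).1].
have pbk k : pn (bk k) <= r1.
  have [h _] := HK (epsN N) (t - s) (Q k) e01 ts1 (HQ k).1.
  apply: (le_trans h); rewrite ler_wpM2l //.
  exact: le_trans (HQ k).2 (ler_norm _).
have dg i j : degree_le (d + d) (gam (bk i) (bk j)) by exact: gam_degree.
have pg i j : pn (gam (bk i) (bk j)) <= r2.
  apply: (le_trans (gam_bound CL0 HL (dbk i) (dbk j))).
  rewrite ler_wpM2l ?mulr_ge0 //; apply: ler_pM => //; exact: pn_ge0.
have dbk' k : degree_le (d + d) (bk k) := degree_le_weak (leq_addr d d) (dbk k).
apply: n1_sum_pairs => // i j iS jS; apply: (le_trans (n1D _ _)); apply: lerD.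
  apply: (le_trans (n1M _ _)); rewrite n1_natV.
  have Cm : n1 (cmoment N s (S :\ j) (override bk i (gam (bk i) (bk j)))) <= C.
    apply: HC => //; first by rewrite s0 s1.
      have jS' : j \in S by move: jS; rewrite in_setD1 => /andP[].
      by move: Sn; rewrite (cardsD1 j) jS' add1n ltnS.
    move=> k; rewrite /override; case: (k == i).
      by split; [exact: dg|apply: (le_trans (pg i j)); rewrite lerDr].
    by split; [exact: dbk'|apply: (le_trans (pbk k)); rewrite lerDl].
  rewrite -[leRHS]mul1r; apply: ler_pM => //; first exact: n1_ge0.
  by rewrite invf_le1 ?ltr0n // ler1n.
apply: (le_trans (n1M _ _)); apply: ler_pM; [exact: n1_ge0|exact: n1_ge0| |].
  have [_ h] := HG (epsN N) s _ e01 as1 (dg i j).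
  by apply: (le_trans h); rewrite ler_wpM2l.
apply: HC => //; first by rewrite s0 s1.
  have jS' : j \in S by move: jS; rewrite in_setD1 => /andP[].
  have iSn : (#|S :\ i| <= n)%N by move: Sn; rewrite (cardsD1 i) iS add1n ltnS.
  by apply: leq_trans iSn; rewrite subset_leq_card // subD1set.
move=> k; split; first exact: dbk'.
by apply: (le_trans (pbk k)); rewrite lerDl.
Qed.

(** Duhamel's formula with A - D = e L; the constant depends on the degree only. *)
Lemma EX_compare d : exists2 C : R, 0 <= C & forall e t P, 0 <= e <= 1 -> 0 <= t <= 1 ->
  degree_le d P -> [/\ pn (EX (Aop e) t P) <= C * pn P, pn (EX D t P) <= C * pn P &
    pn (EX (Aop e) t P - EX D t P) <= e * (C * pn P)].
Proof.
have [C0 C00 H0] := Aop_bounded d.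
pose k := @nmon R J d * (2 * expR C0).
have k0 : 0 <= k by rewrite mulr_ge0 ?ler0n // mulr_ge0 // expR_ge0.
pose q := @nmon R J d * (2 * (k * (C0 * k))).
have q0 : 0 <= q by rewrite mulr_ge0 ?ler0n // !mulr_ge0.
exists (k + q) => [|e t P e01 t01 dP]; first exact: addr_ge0.
have e0 : 0 <= e by case/andP: e01.
have t1 : `|t| <= 1 by case/andP: t01 => t0 t1; rewrite ger0_norm.
have p0 := pn_ge0 P.
have w : k * pn P <= (k + q) * pn P by rewrite ler_wpM2r // lerDl.
have hA P' : degree_le d P' -> pn (Aop e P') <= C0 * pn P' by move=> dP'; have [] := H0 e P' e01 dP'.
have hDb P' : degree_le d P' -> pn (D P') <= C0 * pn P' by move=> dP'; have [_ []] := H0 e P' e01 dP'.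
have hAD P' : degree_le d P' -> pn (Aop e P' - D P') <= e * C0 * pn P'.
  by move=> dP'; have [_ []] := H0 e P' e01 dP'.
split.
- by apply: le_trans w; apply: (EX_bound (Aop_degree e) C00 hA dP t1).
- by apply: le_trans w; apply: (EX_bound hDdeg C00 hDb dP t1).
have h := EX_diff (Aop_degree e) hDdeg C00 (mulr_ge0 e0 C00) hA hDb hAD dP t01.
apply: (le_trans h); rewrite -/k.
have -> : @nmon R J d * (2 * (k * (e * C0 * (k * pn P)))) = e * (q * pn P) by rewrite /q; exact: rearrange5.
by rewrite ler_wpM2l // ler_wpM2r // lerDr.
Qed.

(** The integrand of [sigma_T], in which D has replaced A. *)
Definition limit_cov P P' (s : R) : CC R :=
  peval1 (EX D s (gam (EX D (1 - s) P) (EX D (1 - s) P'))).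

(** First the outer exponential is exchanged, then the two arguments of Gamma one at a time by
    [gamB]; each exchange costs O(e). *)
Lemma limit_cov_compare d (rho : R) : exists2 C : R, 0 <= C &
  forall e s P P', 0 <= e <= 1 -> 0 <= s <= 1 ->
    degree_le d P -> degree_le d P' -> pn P <= rho -> pn P' <= rho ->
    n1 (Phi e s (gam (EX (Aop e) (1 - s) P) (EX (Aop e) (1 - s) P')) - limit_cov P P' s) <= e * C
    /\ n1 (limit_cov P P' s) <= C.
Proof.
have [C1 C10 H1] := EX_compare d; have [C2 C20 H2] := EX_compare (d + d).
have [CL CL0 HL] := linear_bounded L (d + d).
pose r := C1 * `|rho|; have r0 : 0 <= r by rewrite mulr_ge0.
pose g := 2 * CL * (r * r); have g0 : 0 <= g by rewrite !mulr_ge0.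
exists (C2 * g + C2 * (g + g)) => [|e s P P' e01 s01 dP dP' nP nP'].
  by rewrite addr_ge0 // mulr_ge0 // addr_ge0.
have e0 : 0 <= e by case/andP: e01.
have u01 : 0 <= 1 - s <= 1 by case/andP: s01 => s0 s1; rewrite subr_ge0 s1 lerBlDr lerDl.
set X := EX (Aop e) (1 - s) P; set Y := EX (Aop e) (1 - s) P'.
rewrite /limit_cov; set X0 := EX D (1 - s) P; set Y0 := EX D (1 - s) P'.
have le_r (Z : Pol) : pn Z <= rho -> C1 * pn Z <= r.
  by move=> nZ; rewrite ler_wpM2l //; exact: le_trans nZ (ler_norm _).
have dX : degree_le d X by apply: EX_degree => //; exact: Aop_degree.
have dY : degree_le d Y by apply: EX_degree => //; exact: Aop_degree.
have dX0 : degree_le d X0 by apply: EX_degree.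
have dY0 : degree_le d Y0 by apply: EX_degree.
have [x1 x2 x3] := H1 e (1 - s) P e01 u01 dP; have [y1 y2 y3] := H1 e (1 - s) P' e01 u01 dP'.
have nX := le_trans x1 (le_r _ nP); have nX0 := le_trans x2 (le_r _ nP).
have nY := le_trans y1 (le_r _ nP'); have nY0 := le_trans y2 (le_r _ nP').
have dX' : pn (X - X0) <= e * r by apply: (le_trans x3); rewrite ler_wpM2l // le_r.
have dY' : pn (Y - Y0) <= e * r by apply: (le_trans y3); rewrite ler_wpM2l // le_r.
have gb (Z Z' : Pol) (a b : R) : degree_le d Z -> degree_le d Z' -> pn Z <= a -> pn Z' <= b ->
    pn (gam Z Z') <= 2 * CL * (a * b).
  move=> dZ dZ' nZ nZ'; apply: (le_trans (gam_bound CL0 HL dZ dZ')).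
  by rewrite ler_wpM2l ?mulr_ge0 //; apply: ler_pM => //; exact: pn_ge0.
have ng : pn (gam X Y) <= g by exact: gb.
have ng0 : pn (gam X0 Y0) <= g by exact: gb.
have ngg : pn (gam X Y - gam X0 Y0) <= e * (g + g).
  rewrite gamB; apply: (le_trans (pnD _ _)); rewrite mulrDr; apply: lerD.
    have := gb _ _ _ _ (degree_leB dX dX0) dY dX' nY.
    by rewrite (_ : 2 * CL * (e * r * r) = e * g) //; exact: rearrange3.
  have := gb _ _ _ _ dX0 (degree_leB dY dY0) nX0 dY'.
  by rewrite (_ : 2 * CL * (r * (e * r)) = e * g) //; exact: rearrange3'.
have dg : degree_le (d + d) (gam X Y) by exact: gam_degree.
have dg0 : degree_le (d + d) (gam X0 Y0) by exact: gam_degree.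
have [z1 z2 z3] := H2 e s _ e01 s01 dg.
have [_ v2 _] := H2 e s _ e01 s01 dg0.
have [_ w2 _] := H2 e s _ e01 s01 (degree_leB dg dg0).
have B0 : EX D s (gam X Y - gam X0 Y0) = EX D s (gam X Y) - EX D s (gam X0 Y0).
  exact: (linear_sub (V := Pol) _ _ (EX_linear s hDdeg)).
have B1 : peval1 (EX (Aop e) s (gam X Y) - EX D s (gam X Y)) =
    Phi e s (gam X Y) - peval1 (EX D s (gam X Y)) by exact: pevalB.
have B2 : peval1 (EX D s (gam X Y - gam X0 Y0)) =
    peval1 (EX D s (gam X Y)) - peval1 (EX D s (gam X0 Y0)).
  exact: etrans (congr1 (@peval1 R J) B0) (pevalB _ _ _).
have E := etrans (split_sub (Phi e s (gam X Y)) (peval1 (EX D s (gam X Y)))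
  (peval1 (EX D s (gam X0 Y0)))) (esym (congr2 +%R B1 B2)).
split.
  rewrite E mulrDr; apply: le_trans (n1D _ _) _; apply: lerD.
    exact: le_trans (n1_peval1 _) (le_trans z3 (ler_wpM2l e0 (ler_wpM2l C20 ng))).
  rewrite mulrCA; exact: le_trans (n1_peval1 _) (le_trans w2 (ler_wpM2l C20 ngg)).
have h : C2 * g <= C2 * g + C2 * (g + g) by rewrite lerDl mulr_ge0 // addr_ge0.
exact: le_trans (n1_peval1 _) (le_trans v2 (le_trans (ler_wpM2l C20 ng0) h)).
Qed.

Lemma mcurveE N c Q S s : 0 <= s ->
  mcurve N c Q S s = cmoment N s S (backward (epsN N) c Q s).
Proof.
move=> s0; apply: (congr1 (fun X => N%:R ^+ #|S| * Phi (epsN N) s X)).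
by apply: eq_bigr => i _; exact: centered_backE.
Qed.

Lemma backward_bound d (rho : R) : exists2 r : R, 0 <= r & forall N Q s, (0 < N)%N ->
  0 <= s <= 1 -> (forall k, degree_le d (Q k) /\ pn (Q k) <= rho) ->
  forall k, degree_le d (backward (epsN N) 1 Q s k) /\ pn (backward (epsN N) 1 Q s k) <= r.
Proof.
have [C C0 H] := EX_compare d; exists (C * `|rho|) => [|N Q s N0 /andP[s0 s1] HQ k].
  by rewrite mulr_ge0.
have u01 : 0 <= 1 - s <= 1 by rewrite subr_ge0 s1 lerBlDr lerDl.
split; first by apply: EX_degree; [exact: Aop_degree|exact: (HQ k).1].
have [h _ _] := H _ _ _ (epsN01 N0) u01 (HQ k).1.
by apply: (le_trans h); rewrite ler_wpM2l //; exact: le_trans (HQ k).2 (ler_norm _).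
Qed.

(** * Comparison of the moments with a solution of the limiting system *)

Section Comparison.
Variables (d : nat) (rho : R) (Q : K -> Pol).
Hypothesis HQ : forall k, degree_le d (Q k) /\ pn (Q k) <= rho.
Variable H : {set K} -> R -> CC R.
Hypothesis H_set0 : forall s, H finset.set0 s = 1.
Hypothesis H_0 : forall S x, x \in S -> H S 0 = 0.
Hypothesis H_cont : forall S, {within `[0, 1], continuous (fun s => re (H S s))} /\
  {within `[0, 1], continuous (fun s => im (H S s))}.
Hypothesis H_deriv : forall S s, 0 < s < 1 -> cderiv (H S) s
  (\sum_(i in S) \sum_(j in S :\ i) limit_cov (Q i) (Q j) s * H (S :\ i :\ j) s).

(** For nonempty S both curves start at 0, so it suffices that their derivatives differ by O(1/N).
    The derivatives involve only smaller sets, which allows induction on |S|. *)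
Lemma mcurve_limit n : exists2 C : R, 0 <= C & forall N t S, (0 < N)%N -> 0 <= t <= 1 ->
  (#|S| <= n)%N -> n1 (mcurve N 1 Q S t - H S t) <= N%:R^-1 * C.
Proof.
elim: n => [|n [C C0 IH]].
  exists 0 => // N t S N0 /andP[t0 t1]; rewrite leqn0 cards_eq0 => /eqP ->.
  rewrite H_set0 /mcurve cards0 expr0 mul1r.
  have E : Phi (epsN N) t (\prod_(i in finset.set0) centered_back (epsN N) 1 Q i t) = 1.
    have := Phi1 (epsN N) 1 t0; rewrite scale1r => E; apply: etrans E.
    by apply: (congr1 (Phi (epsN N) t)); exact: finset.big_set0.
  by rewrite E subrr n10 mulr0.
have [r r0 Hr] := backward_bound d rho.
have [CL CL0 HL] := linear_bounded L (d + d).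
pose g := 2 * CL * (r * r); have g0 : 0 <= g by rewrite !mulr_ge0.
have [CM CM0 HM] := cmoment_bound n (d + d) (r + g).
have [CV CV0 HV] := limit_cov_compare d rho.
(* Up to 1/N, these bound the moment with the new centred factor, the error in the covariance times
   a moment, and the covariance times the error for the smaller set. *)
pose b := CM + (CV * CM + CV * C).
have b0 : 0 <= b by rewrite addr_ge0 // addr_ge0 // mulr_ge0.
pose W := #|K|%:R * (#|K|%:R * b).
have W0 : 0 <= W by rewrite !mulr_ge0.
exists (2 * W) => [|N t S N0 t01 Sn]; first by rewrite mulr_ge0.
have /andP[t0 t1] := t01.
have V0 : 0 <= (N%:R^-1 : R) by rewrite invr_ge0.
have V1 : (N%:R^-1 : R) <= 1 by rewrite invf_le1 ?ltr0n // ler1n.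
have [->|/finset.set0Pn[x xS]] := eqVneq S finset.set0.
  rewrite H_set0 mcurveE //; have := mcurveE N 1 Q finset.set0 t0 => <-.
  rewrite /mcurve cards0 expr0 mul1r.
  have E : Phi (epsN N) t (\prod_(i in finset.set0) centered_back (epsN N) 1 Q i t) = 1.
    have := Phi1 (epsN N) 1 t0; rewrite scale1r => E; apply: etrans E.
    by apply: (congr1 (Phi (epsN N) t)); exact: finset.big_set0.
  by rewrite E subrr n10 mulr_ge0 // mulr_ge0.
have e01 := epsN01 N0; have /andP[e0 e1] := e01.
(* The covariance error of order N^-2 is weakened to the common rate 1/N. *)
have eV : epsN N <= N%:R^-1.
  rewrite /epsN expr2 invfM -[leRHS]mulr1; exact: ler_wpM2l.
pose dF s := mcurve_d N 1 Q S s -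
  \sum_(i in S) \sum_(j in S :\ i) limit_cov (Q i) (Q j) s * H (S :\ i :\ j) s.
have sub : (`[0, t] `<=` `[0, 1])%classic.
  by move=> u /=; rewrite !in_itv /= => /andP[-> h]; exact: le_trans h t1.
have cG := cderiv_within 0 t (fun s => cderiv_mcurve N 1 S s (fun i => (HQ i).1)).
have cr : {within `[0, t], continuous (fun s => re (mcurve N 1 Q S s - H S s))}.
  rewrite (_ : (fun s => _) = fun s => re (mcurve N 1 Q S s) - re (H S s)); last first.
    by apply/funext => s; rewrite reD reN.
  have h := continuous_subspaceW sub (H_cont S).1.
  exact: within_continuousB cG.1 h.
have ci : {within `[0, t], continuous (fun s => im (mcurve N 1 Q S s - H S s))}.
  rewrite (_ : (fun s => _) = fun s => im (mcurve N 1 Q S s) - im (H S s)); last first.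
    by apply/funext => s; rewrite imD imN.
  have h := continuous_subspaceW sub (H_cont S).2.
  exact: within_continuousB cG.2 h.
have := cderiv_bound t0 cr ci (dF := dF) (M := N%:R^-1 * W).
rewrite (mcurve_start N 1 Q xS) (H_0 xS) !subr0 => Hb.
apply: (le_trans (Hb _ _)); last first.
  have : 2 * (N%:R^-1 * W * t) <= 2 * (N%:R^-1 * W).
    by rewrite ler_wpM2l // -[leRHS]mulr1 ler_wpM2l // mulr_ge0.
  by move=> h; apply: (le_trans h); rewrite mulrCA.
- move=> s /andP[s0 st]; have s01 : 0 <= s <= 1 by rewrite (ltW s0) (ltW (lt_le_trans st t1)).
  have s1 : 0 < s < 1 by rewrite s0 (lt_le_trans st t1).
  rewrite /dF (mcurve_dE 1 Q S N0 (ltW s0)) /=.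
  set bk := backward (epsN N) 1 Q s.
  have HB := Hr N Q s N0 s01 HQ; rewrite -/bk in HB.
  rewrite -sumrB (eq_bigr (fun i => \sum_(j in S :\ i) (
     N%:R^-1 * cmoment N s (S :\ j) (override bk i (gam (bk i) (bk j))) +
     ((Phi (epsN N) s (gam (bk i) (bk j)) - limit_cov (Q i) (Q j) s) * mcurve N 1 Q (S :\ i :\ j) s +
      limit_cov (Q i) (Q j) s * (mcurve N 1 Q (S :\ i :\ j) s - H (S :\ i :\ j) s))))); last first.
    move=> i _; rewrite -sumrB; apply: eq_bigr => j _; rewrite (mcurveE N 1 Q _ (ltW s0)) -/bk.
    exact: split_error.
  have -> : N%:R^-1 * W = #|K|%:R * (#|K|%:R * (N%:R^-1 * b)) by rewrite /W; exact: rearrange4.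
  have Sn1 i : i \in S -> (#|S :\ i| <= n)%N.
    by move=> iS; move: Sn; rewrite (cardsD1 i) iS add1n ltnS.
  have Sn2 i j : i \in S -> (#|S :\ i :\ j| <= n)%N.
    by move=> iS; apply: leq_trans (Sn1 i iS); rewrite subset_leq_card // subD1set.
  have dg i j : degree_le (d + d) (gam (bk i) (bk j)).
    by apply: gam_degree; [exact: (HB i).1|exact: (HB j).1].
  have pg i j : pn (gam (bk i) (bk j)) <= g.
    apply: (le_trans (gam_bound CL0 HL (HB i).1 (HB j).1)).
    rewrite ler_wpM2l ?mulr_ge0 //; apply: ler_pM; rewrite ?pn_ge0 //; [exact: (HB i).2|exact: (HB j).2].
  have wb k : degree_le (d + d) (bk k) /\ pn (bk k) <= r + g.
    split; first exact: degree_le_weak (leq_addr d d) (HB k).1.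
    by apply: (le_trans (HB k).2); rewrite lerDl.
  apply: n1_sum_pairs => [|i j iS jS]; first by rewrite mulr_ge0.
  rewrite /b [leRHS]mulrDr [X in _ <= _ + X]mulrDr.
  apply: (le_trans (n1D _ _)); apply: lerD.
    apply: (le_trans (n1M _ _)); rewrite n1_natV ler_wpM2l //; apply: HM => //.
      by apply: Sn1; move: jS; rewrite in_setD1 => /andP[].
    move=> k; rewrite /override; case: (k == i) => //; split; first exact: dg.
    by apply: (le_trans (pg i j)); rewrite lerDr.
  have [v1 v2] := HV (epsN N) s (Q i) (Q j) e01 s01 (HQ i).1 (HQ j).1 (HQ i).2 (HQ j).2.
  apply: (le_trans (n1D _ _)); apply: lerD.
    rewrite [leRHS]mulrA; apply: (le_trans (n1M _ _)); apply: ler_pM; rewrite ?n1_ge0 //.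
      by apply: (le_trans v1); rewrite ler_wpM2r.
    by rewrite (mcurveE N 1 Q _ (ltW s0)); apply: HM => //; exact: Sn2.
  rewrite [leRHS]mulrCA; apply: (le_trans (n1M _ _)); apply: ler_pM; rewrite ?n1_ge0 //.
  by apply: IH => //; exact: Sn2.
- move=> s /andP[s0 st]; have s1 : 0 < s < 1 by rewrite s0 (lt_le_trans st t1).
  have := cderivD (cderiv_mcurve N 1 S s (fun i => (HQ i).1)) (cderivZ (-1) (H_deriv S s1)).
  rewrite mulN1r => h; apply: cderiv_ext h => u; by rewrite mulN1r.
Qed.

End Comparison.

End Fluctuations.

(** * Pairing sums *)

Section Primitives.
Context {R : realType}.
Local Notation leb := (@lebesgue_measure R).

(** The integral is started at -1 so that 0 is an interior point, where a two-sided derivative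
    exists. *)
Lemma primitive (f : R -> R) : continuous f -> exists F : R -> R,
  [/\ forall t : R, -1 < t -> is_derive t 1 F (f t), F 0 = 0 & F 1 = Rintegral leb `[0, 1] f].
Proof.
move=> cf; pose G (t : R) := Rintegral leb `[-1, t] f.
have intf (a b : R) : leb.-integrable `[a, b] (EFin \o f).
  apply: continuous_compact_integrable; first exact: segment_compact.
  exact: continuous_subspaceT.
exists (fun t => G t - G 0); split=> [t t1||]; last 2 first.
- by rewrite subrr.
- rewrite /G Rintegral_itvB ?bnd_simp ?lerN10 //.
  rewrite Rintegral_itv_obnd_cbnd //.
  by apply: integrableS (intf 0 1) => //; apply: subset_itvr; rewrite bnd_simp.
have tt : t < t + 1 by rewrite ltrDl.
have [d1 d2] := continuous_FTC1_closed tt (intf (-1) (t + 1)) t1 (cf t).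
have h : is_derive t 1 G (f t).
  apply: DeriveDef; first exact: d1.
  by rewrite -derive1E.
have := is_deriveB' h (is_derive_cst (G 0) t 1).
by rewrite subr0.
Qed.

Lemma cprimitive (f : R -> CC R) :
  continuous (fun t => re (f t)) -> continuous (fun t => im (f t)) ->
  exists F : R -> CC R,
  [/\ forall t, -1 < t -> cderiv F t (f t), F 0 = 0 & F 1 = cintegral leb `[0, 1] f].
Proof.
move=> cr ci; have [Fr [r1 r2 r3]] := primitive cr; have [Fi [i1 i2 i3]] := primitive ci.
exists (fun t => cplx (Fr t) (Fi t)); split=> [t t1||].
- by split; [exact: r1|exact: i1].
- by rewrite r2 i2.
- by rewrite r3 i3.
Qed.

Lemma cderiv_prod_set (I : finType) (A : {set I}) (f : I -> R -> CC R) (l : I -> CC R) (t : R) :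
  (forall i, i \in A -> cderiv (f i) t (l i)) ->
  cderiv (fun s => \prod_(i in A) f i s) t (\sum_(i in A) l i * \prod_(j in A :\ i) f j t).
Proof.
move=> H; rewrite -(sum_enum_set (fun i => f i t)).
apply: (@cderiv_ext _ (fun s => \prod_(i <- enum A) f i s)); first by move=> s; rewrite big_enum.
have {}H i : i \in enum A -> cderiv (f i) t (l i) by rewrite mem_enum; exact: H.
elim: (enum A) (enum_uniq A) H => [_ _|i r IH /= /andP[ir ur] H].
  rewrite big_nil; apply: cderiv_ext (cderiv_cst 1 t) => s; by rewrite big_nil.
have {}IH := IH ur (fun j jr => H j (mem_behead (s := i :: r) jr)).
have := cderivM (H i (mem_head _ _)) IH.
rewrite (leibniz_cons (fun j => f j t) l ir) => h.
by apply: cderiv_ext h => s; rewrite big_cons.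
Qed.

End Primitives.

Section PairingSums.
Context {k : nat}.
Local Notation K := 'I_k.
Implicit Types (S b : {set K}) (p : {set {set K}}).

Definition pairing_of S p : bool := finset.partition p S && [forall b in p, #|b| == 2%N].

Lemma pairing_of_block S p b : pairing_of S p -> b \in p -> (b \subset S) && (#|b| == 2%N).
Proof.
move=> /andP[pS /forall_inP H] bp; rewrite H // andbT.
by rewrite -(cover_partition pS); apply: (finset.bigcup_max b).
Qed.

Lemma pairing_of_set0 p : pairing_of finset.set0 p = (p == finset.set0).
Proof.
rewrite /pairing_of finset.partition_set0; case: eqP => //= ->.
by apply/forall_inP => b; rewrite finset.in_set0.
Qed.

Lemma pairing_of_setU1 S b p : b \subset S -> #|b| == 2%N ->
  pairing_of S (b |: p) && (b \in b |: p) && ((b |: p) :\ b == p) = pairing_of (S :\: b) p.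
Proof.
move=> bS b2; rewrite finset.setU11 andbT.
have bn0 : b != finset.set0 by rewrite -cards_eq0 (eqP b2).
apply/andP/idP => [[/andP[pS /forall_inP H] /eqP E]|/andP[pS /forall_inP H]].
  have := finset.partitionD1 pS (finset.setU11 b p); rewrite E => pS'.
  by apply/andP; split=> //; apply/forall_inP => c cp; apply: H; rewrite in_setU1 cp orbT.
have bp : b \notin p.
  apply/negP => bp; have cS : b \subset S :\: b.
    by rewrite -(cover_partition pS); apply: (finset.bigcup_max b).
  have /finset.set0Pn[x xb] := bn0; have := fintype.subsetP cS x xb.
  by rewrite finset.in_setD xb.
split; last by rewrite setU1K.
apply/andP; split; last first.
  by apply/forall_inP => c; rewrite in_setU1 => /orP[/eqP ->|/H].
have dis : fintype.disjoint (mem b) (mem (S :\: b)%SET).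
  by rewrite -finset.setI_eq0; apply/eqP/setP => x; rewrite !inE; case: (x \in b); rewrite ?andbF.
have := finset.partitionU1 pS bn0 dis.
suff -> : (b :|: S :\: b = S)%SET by [].
by rewrite -[RHS](finset.setID S b) (finset.setIidPr bS).
Qed.

(** Double counting: a pairing with a marked block amounts to a block together with a pairing of its
    complement. *)
Lemma sum_pairing_blocks (V : nmodType) S (F : {set K} -> {set {set K}} -> V) :
  \sum_(p | pairing_of S p) \sum_(b in p) F b (p :\ b) =
  \sum_(b : {set K} | (b \subset S) && (#|b| == 2%N)) \sum_(p | pairing_of (S :\: b) p) F b p.
Proof.
rewrite (exchange_big_dep (fun b : {set K} => (b \subset S) && (#|b| == 2%N))) /=; last first.
  by move=> p b; exact: pairing_of_block.
apply: eq_bigr => b /andP[bS b2].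
rewrite (reindex_onto (fun p => b |: p) (fun p => p :\ b)) /=; last first.
  by move=> p /andP[_ bp]; rewrite finset.setD1K.
rewrite (eq_bigl (pairing_of (S :\: b))); last by move=> p; exact: pairing_of_setU1.
apply: eq_bigr => p; rewrite -(pairing_of_setU1 p bS b2) => /andP[_ /eqP E].
by rewrite E.
Qed.

(** Each two-element block arises from exactly its two orderings. *)
Lemma sum_pairs_blocks (V : nmodType) S (G : K -> K -> {set K} -> V) :
  \sum_(i in S) \sum_(j in S :\ i) G i j [set i; j]%SET =
  \sum_(b : {set K} | (b \subset S) && (#|b| == 2%N)) \sum_(i in b) \sum_(j in b :\ i) G i j b.
Proof.
apply/esym; rewrite (exchange_big_dep (fun i => i \in S)) /=; last first.
  by move=> b i /andP[/fintype.subsetP bS _]; exact: bS.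
apply: eq_bigr => i iS; rewrite (exchange_big_dep (fun j => j \in S :\ i)) /=; last first.
  move=> b j /andP[/andP[/fintype.subsetP bS _] _]; rewrite !in_setD1 => /andP[-> jb].
  exact: bS.
apply: eq_bigr => j; rewrite in_setD1 => /andP[ji jS].
rewrite (big_pred1 [set i; j]%SET) // => b /=.
apply/andP/eqP => [[/andP[/andP[bS b2] ib] jb]|->].
  apply/eqP; rewrite eq_sym eqEcard (eqP b2) cards2 eq_sym ji andbT.
  by rewrite finset.subUset !finset.sub1set ib; move: jb; rewrite in_setD1 => /andP[].
have ij : i != j by rewrite eq_sym.
rewrite in_setD1 ji finset.set22 finset.set21 cards2 ij eqxx !andbT.
by rewrite finset.subUset !finset.sub1set iS jS.
Qed.

End PairingSums.

Section PairingFunction.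
Context {R : realType} {k : nat}.
Local Notation K := 'I_k.
Implicit Types (S b : {set K}) (p : {set {set K}}).
Variables (s ds : K -> K -> R -> CC R).
Hypothesis s_deriv : forall i j t, -1 < t -> cderiv (s i j) t (2 * ds i j t).
Hypothesis s_0 : forall i j, s i j 0 = 0.
Hypothesis dsC : forall i j t, ds i j t = ds j i t.

Definition block_fun (f : K -> K -> R -> CC R) b (t : R) : CC R :=
  \prod_(i in b) \prod_(j in b | (i < j)%N) f i j t.

Definition pairing_fun S (t : R) : CC R :=
  \sum_(p | pairing_of S p) \prod_(b in p) block_fun s b t.

Lemma block_fun_pair f (i j : K) t : (i < j)%N -> block_fun f [set i; j]%SET t = f i j t.
Proof.
move=> ij; have nij : i != j by apply: contraTneq ij => ->; rewrite ltnn.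
rewrite /block_fun finset.big_setU1 ?finset.in_set1 //= finset.big_set1.
rewrite (big_pred1 j) => [|x]; last first.
  rewrite /= finset.in_set2; have [->|xj] := eqVneq x j; first by rewrite orbT ij.
  by rewrite orbF; case: eqP => // ->; rewrite ltnn.
rewrite [X in _ * X]big_pred0 ?mulr1 // => x.
by rewrite finset.in_set2; case: eqP => [->|_]; rewrite /= ?ltnNge ?(ltnW ij) //; case: eqP => //= ->; rewrite leqnn.
Qed.

Lemma card2_ltn b : #|b| == 2%N -> exists i j : K, (i < j)%N /\ b = [set i; j]%SET.
Proof.
move=> /cards2P[x [y [xy ->]]]; case: (ltngtP x y) => h.
- by exists x, y.
- by exists y, x; rewrite finset.setUC.
- by move: xy; rewrite (val_inj h) eqxx.
Qed.

(** The factor 2 in [s_deriv] accounts for the two orderings of the block, [ds] being symmetric. *)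
Lemma cderiv_block b t : #|b| == 2%N -> -1 < t ->
  cderiv (block_fun s b) t (\sum_(i in b) \sum_(j in b :\ i) ds i j t).
Proof.
move=> /card2_ltn[i [j [ij ->]]] t1; have nij : i != j by apply: contraTneq ij => ->; rewrite ltnn.
have -> : \sum_(x in [set i; j]%SET) \sum_(y in ([set i; j] :\ x)%SET) ds x y t = 2 * ds i j t.
  rewrite finset.big_setU1 ?finset.in_set1 //= finset.big_set1.
  rewrite (_ : [set i; j] :\ i = [set j])%SET; last by rewrite setU1K // finset.in_set1.
  rewrite (_ : [set i; j] :\ j = [set i])%SET; last first.
    by rewrite finset.setUC setU1K // finset.in_set1 eq_sym.
  by rewrite !finset.big_set1 [ds j i t]dsC mulr_natl mulr2n.
by apply: cderiv_ext (s_deriv i j t1) => u; rewrite block_fun_pair.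
Qed.

Lemma pairing_fun_set0 t : pairing_fun finset.set0 t = 1.
Proof.
rewrite /pairing_fun (big_pred1 finset.set0) ?finset.big_set0 // => p.
exact: pairing_of_set0.
Qed.

(** In any pairing of S, the block containing x contributes a factor that vanishes at 0. *)
Lemma pairing_fun_0 S x : x \in S -> pairing_fun S 0 = 0.
Proof.
move=> xS; apply: big1 => p pS; have /andP[pp _] := pS.
have : x \in finset.cover p by rewrite (cover_partition pp).
move=> /finset.bigcupP[b bp xb]; rewrite (big_setD1 b bp) /=.
have /andP[_ b2] := pairing_of_block pS bp; have [i [j [ij ->]]] := card2_ltn b2.
by rewrite block_fun_pair // s_0 mul0r.
Qed.

(** The product rule marks the differentiated block and leaves a pairing of the other indices, so
    the system closes on itself and has the form required in the limit of the moments. *)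
Lemma cderiv_pairing_fun S t : -1 < t -> cderiv (pairing_fun S) t
  (\sum_(i in S) \sum_(j in S :\ i) ds i j t * pairing_fun (S :\ i :\ j) t).
Proof.
move=> t1.
have := @cderiv_sum R {set {set K}} (index_enum {set {set K}}) (pairing_of S)
  (fun p t => \prod_(b in p) block_fun s b t) t
  (fun p => \sum_(b in p) (\sum_(i in b) \sum_(j in b :\ i) ds i j t) *
     \prod_(c in p :\ b) block_fun s c t).
move=> H; apply: cderiv_eq (H _) _ => {H} [p pS|].
  apply: cderiv_prod_set => b bp; apply: cderiv_block => //.
  by have /andP[] := pairing_of_block pS bp.
rewrite (sum_pairing_blocks S (fun b p => (\sum_(i in b) \sum_(j in b :\ i) ds i j t) *
     \prod_(c in p) block_fun s c t)).
transitivity (\sum_(i in S) \sum_(j in S :\ i) ds i j t * pairing_fun (S :\: [set i; j]%SET) t).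
  rewrite (sum_pairs_blocks S (fun i j b => ds i j t * pairing_fun (S :\: b) t)).
  apply: eq_bigr => b _; rewrite -mulr_sumr mulr_suml; apply: eq_bigr => i _.
  by rewrite mulr_suml.
apply: eq_bigr => i _; apply: eq_bigr => j _; congr (_ * pairing_fun _ t).
by apply/setP => x; rewrite !inE negb_or andbCA andbA.
Qed.

Lemma pairing_fun_continuous S :
  {within `[0, 1], continuous (fun t => re (pairing_fun S t))} /\
  {within `[0, 1], continuous (fun t => im (pairing_fun S t))}.
Proof.
split; apply: continuous_in_subspaceT => t; rewrite inE /= in_itv /= => /andP[t0 _];
  have t1 : -1 < t by apply: lt_le_trans t0; rewrite ltrN10.
  by have [h _] := cderiv_pairing_fun S t1; exact: is_derive_continuous h.
by have [_ h] := cderiv_pairing_fun S t1; exact: is_derive_continuous h.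
Qed.

End PairingFunction.

(** * Convergence of the centred moments *)

Section ExpectationCurve.
Context {R : realType} {J : finType} {N : nat}.
Local Notation Pol := (trpoly R J).
Local Notation M := ('M[CC R]_N).
Variables (T : J -> R) (beta : seq M) (D L : {linear Pol -> Pol}).
Hypothesis hT : forall j, 0 <= T j.
Hypothesis N0 : (0 < N)%N.
Hypotheses (hDdeg : degree_nonincreasing D) (hLdeg : degree_nonincreasing L).
Hypothesis hDL : forall (P : Pol) (A : J -> M), (forall j, A j \in unitmx) ->
  T_laplacian beta T (trace_eval P) A = trace_eval (D P + (N%:R ^+ 2)^-1 *: L P) A.
Context {d : measure_display} {Omega : measurableType d}.
Variables (Pr : probability Omega R) (B : J -> R -> Omega -> M).
Hypothesis hB : forall j, brownian_motion Pr beta (B j).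
Hypothesis hind : independent_processes Pr B.

Local Notation A := (Aop D L (@epsN R N)).
Let hA : degree_nonincreasing A := @Aop_degree R J D L hDdeg hLdeg (@epsN R N).

Lemma trace_eval1 (Q : Pol) : trace_eval Q (fun=> 1%:M : M) = peval1 Q.
Proof.
rewrite /trace_eval /peval1; congr (peval _ Q); apply/funext => e.
have -> : word_mx (fun=> 1%:M : M) e = 1%:M.
  rewrite /word_mx; elim: (sval e) => [|l s IH]; first by rewrite big_nil.
  rewrite big_cons IH; have -> : (if l.2 then adjmx (1%:M : M) else 1%:M) = 1%:M.
    case: l.2 => //; rewrite /adjmx trmx1; apply/matrixP => i j; rewrite !mxE.
    by case: (i == j); rewrite ?mulr1n ?mulr0n ?rmorph1 ?rmorph0.
  exact: mul1mx.
by rewrite /ntr mxtrace1 mulVf // pnatr_eq0 -lt0n.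
Qed.

Lemma re_T_laplacian (F : (J -> M) -> CC R) (X : J -> M) :
  re (T_laplacian beta T F X) = tlap T beta (fun Y => re (F Y)) X /\
  im (T_laplacian beta T F X) = tlap T beta (fun Y => im (F Y)) X.
Proof.
have h2 : (2%:R^-1 : CC R) = RtoC 2^-1 by rewrite RtoC_inv RtoC_nat.
rewrite /T_laplacian /tlap h2 re_RtoCM im_RtoCM re_sum im_sum.
by split; congr (_ * _); apply: eq_bigr => j _; rewrite ?re_RtoCM ?im_RtoCM.
Qed.

Definition mexp (Q : Pol) (t : R) : CC R :=
  cplx (Ejoint Pr T B (fun X => re (trace_eval Q X)) t)
       (Ejoint Pr T B (fun X => im (trace_eval Q X)) t).

Lemma mexp_integrable Q t : 0 <= t ->
  cintegrable Pr setT (fun w => trace_eval Q (joint T B t w)).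
Proof.
move=> t0; have [tr ti] := @tensor_trace_eval R J N Q.
by split; [apply: (Ejoint_integrable hT hB hind tr)|apply: (Ejoint_integrable hT hB hind ti)].
Qed.

Lemma mexp0 Q : mexp Q 0 = peval1 Q.
Proof. by rewrite /mexp !(Ejoint0 T hB) trace_eval1; apply: CC_eq. Qed.

Lemma Rintegral_lin3 (f g h : Omega -> R) (a b : R) :
  Pr.-integrable setT (EFin \o f) -> Pr.-integrable setT (EFin \o g) ->
  Pr.-integrable setT (EFin \o h) ->
  Rintegral Pr setT (fun w => a * f w + b * g w + h w) =
  a * Rintegral Pr setT f + b * Rintegral Pr setT g + Rintegral Pr setT h.
Proof.
move=> fi gi hi; pose F n := nth h [:: f; g] n; pose c n := nth 1 [:: a; b] n.
have H n : n \in [:: 0%N; 1%N; 2%N] -> Pr.-integrable setT (EFin \o F n).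
  by rewrite !inE => /or3P[] /eqP ->.
have [_ E] := integrable_lincomb c H.
rewrite !big_cons big_nil /F /c /= mul1r addr0 in E.
rewrite addrA in E; rewrite -E; congr (Rintegral Pr setT _); apply/funext => w.
by rewrite !big_cons big_nil /F /c /= mul1r addr0 addrA.
Qed.

Lemma mexp_linear t (c : CC R) (P Q : Pol) : 0 <= t ->
  mexp (c *: P + Q) t = c * mexp P t + mexp Q t.
Proof.
move=> t0; have [pr pi] := mexp_integrable P t0; have [qr qi] := mexp_integrable Q t0.
have E w : trace_eval (c *: P + Q) (joint T B t w) =
    c * trace_eval P (joint T B t w) + trace_eval Q (joint T B t w).
  by rewrite /trace_eval pevalD pevalZ.
apply: CC_eq; rewrite ?reD ?imD ?reM ?imM /= /Ejoint.
  rewrite (_ : (fun w => _) = fun w => re c * re (trace_eval P (joint T B t w)) +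
      (- im c) * im (trace_eval P (joint T B t w)) + re (trace_eval Q (joint T B t w))).
    by rewrite (Rintegral_lin3 _ _ pr pi qr) mulNr.
  by apply/funext => w; rewrite E reD reM mulNr.
rewrite (_ : (fun w => _) = fun w => re c * im (trace_eval P (joint T B t w)) +
    im c * re (trace_eval P (joint T B t w)) + im (trace_eval Q (joint T B t w))).
  exact: (Rintegral_lin3 _ _ pi pr qi).
by apply/funext => w; rewrite E imD imM.
Qed.

Lemma mexp_expand n t (Q : Pol) : 0 <= t -> degree_le n Q ->
  mexp Q t = \sum_(m <- monomials n) mcoeff m Q * mexp (Umon m) t.
Proof.
move=> t0 dQ; rewrite {1}(poly_expand dQ).
have z : mexp 0 t = 0.
  have := mexp_linear (-1) 0 0 t0; rewrite scaler0 addr0 mulN1r => ->; exact: addNr.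
elim: (enum_fset (monomials n)) => [|m s IH]; first by rewrite !big_nil.
by rewrite !big_cons mexp_linear // IH.
Qed.

Lemma mexp_derive t (Q : Pol) : 0 < t -> cderiv (mexp Q) t (mexp (A Q) t).
Proof.
move=> t0; have [tr ti] := @tensor_trace_eval R J N Q.
have eE : RtoC (@epsN R N) = (N%:R ^+ 2)^-1 :> CC R by rewrite /epsN RtoC_inv rmorphXn /= RtoC_nat.
(* [hDL] speaks of invertible matrices only, and the process never leaves them. *)
have U w j : joint T B t w j \in unitmx.
  by have [_ u _ _ _] := hB j; apply: u; rewrite mulr_ge0 // ltW.
have E w : T_laplacian beta T (trace_eval Q) (joint T B t w) = trace_eval (A Q) (joint T B t w).
  apply: etrans (hDL Q (U w)) _; apply: (congr1 (fun X => trace_eval X (joint T B t w))).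
  by rewrite -eE; exact: erefl.
split; rewrite /mexp /=.
  have -> : Ejoint Pr T B (fun X => re (trace_eval (A Q) X)) t =
      Ejoint Pr T B (tlap T beta (fun X => re (trace_eval Q X))) t.
    congr (Rintegral Pr setT _); apply/funext => w; rewrite -E.
    exact: (re_T_laplacian _ _).1.
  exact: Ejoint_derive.
have -> : Ejoint Pr T B (fun X => im (trace_eval (A Q) X)) t =
    Ejoint Pr T B (tlap T beta (fun X => im (trace_eval Q X))) t.
  congr (Rintegral Pr setT _); apply/funext => w; rewrite -E.
  exact: (re_T_laplacian _ _).2.
exact: Ejoint_derive.
Qed.

Definition ccont (F : R -> CC R) : Prop :=
  {within `[0, 1], continuous (fun t => re (F t))} /\
  {within `[0, 1], continuous (fun t => im (F t))}.

Lemma ccont_mexp Q : ccont (mexp Q).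
Proof.
have [tr ti] := @tensor_trace_eval R J N Q.
by split; [apply: (Ejoint_continuous hT hB hind tr)|apply: (Ejoint_continuous hT hB hind ti)].
Qed.

Lemma ccontM F G : ccont F -> ccont G -> ccont (fun t => F t * G t).
Proof.
move=> [/subspace_continuousP fr /subspace_continuousP fi].
move=> [/subspace_continuousP gr /subspace_continuousP gi]; split.
  rewrite (_ : (fun t => _) = fun t => re (F t) * re (G t) - im (F t) * im (G t)); last first.
    by apply/funext => t; rewrite reM.
  by apply/subspace_continuousP => t h; apply: cvgB; apply: cvgM;
    [exact: fr|exact: gr|exact: fi|exact: gi].
rewrite (_ : (fun t => _) = fun t => re (F t) * im (G t) + im (F t) * re (G t)); last first.
  by apply/funext => t; rewrite imM.
by apply/subspace_continuousP => t h; apply: cvgD; apply: cvgM;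
  [exact: fr|exact: gi|exact: fi|exact: gr].
Qed.

Lemma ccont_sum (I : Type) (s : seq I) (F : I -> R -> CC R) :
  (forall i, ccont (F i)) -> ccont (fun t => \sum_(i <- s) F i t).
Proof.
move=> H; elim: s => [|i s [IHr IHi]].
  rewrite (_ : (fun t => _) = fun=> 0); last by apply/funext => t; rewrite big_nil.
  by split; apply: continuous_subspaceT; exact: cst_continuous.
have [fr fi] := H i.
rewrite (_ : (fun t => _) = fun t => F i t + \sum_(j <- s) F j t); last first.
  by apply/funext => t; rewrite big_cons.
split.
  rewrite (_ : (fun t => _) = fun t => re (F i t) + re (\sum_(j <- s) F j t)); last first.
    by apply/funext => t; rewrite reD.
  move: fr IHr => /subspace_continuousP fr /subspace_continuousP gr.
  by apply/subspace_continuousP => t h; apply: cvgD; [exact: fr|exact: gr].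
rewrite (_ : (fun t => _) = fun t => im (F i t) + im (\sum_(j <- s) F j t)); last first.
  by apply/funext => t; rewrite imD.
move: fi IHi => /subspace_continuousP fi /subspace_continuousP gi.
by apply/subspace_continuousP => t h; apply: cvgD; [exact: fi|exact: gi].
Qed.

(** The expectation at time s of e^{(1-s)A} Q is constant in s: the generator contributes A and the
    backward evolution -A. Its ends are the two sides. *)
Lemma mexp_Phi (Q : Pol) : mexp Q 1 = Phi D L (@epsN R N) 1 Q.
Proof.
have [n dQ] := degree_exists Q.
pose X (s : R) := EX A (1 - s) Q.
have dX s : degree_le n (X s) by exact: EX_degree.
(* The polynomial and the law both move with s; expanding over monomials separates them into
   products of scalar functions. *)
pose phi s := \sum_(m <- monomials n) mcoeff m (X s) * mexp (Umon m) s.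
have phiE s : 0 <= s -> phi s = mexp (X s) s by move=> s0; rewrite (mexp_expand s0 (dX s)).
have cX m : ccont (fun s => mcoeff m (X s)).
  exact: (cderiv_within 0 1 (fun s => pderiv_EX_rev 1 s Q hA m)).
have [cr ci] : ccont phi by apply: ccont_sum => m; apply: ccontM; [exact: cX|exact: ccont_mexp].
have dphi s : 0 < s < 1 -> cderiv phi s 0.
  move=> /andP[s0 s1].
  have H := @cderiv_sum R _ (enum_fset (monomials n)) xpredT
    (fun m s => mcoeff m (X s) * mexp (Umon m) s) s _
    (fun m _ => cderivM (pderiv_EX_rev 1 s Q hA m) (mexp_derive (Umon m) s0)).
  apply: cderiv_eq H _; rewrite big_split /=.
  have dAX : degree_le n (A (X s)) by exact: hA.
  have -> : \sum_(m <- monomials n) mcoeff m (- A (EX A (1 - s) Q)) * mexp (Umon m) s =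
      - mexp (A (X s)) s.
    rewrite (mexp_expand (ltW s0) dAX) -sumrN; apply: eq_bigr => m _.
    by rewrite mcoeffN mulNr.
  have -> : \sum_(m <- monomials n) mcoeff m (EX A (1 - s) Q) * mexp (A (Umon m)) s =
      mexp (A (X s)) s.
    have z : mexp 0 s = 0.
      have := mexp_linear (-1) 0 0 (ltW s0); rewrite scaler0 addr0 mulN1r => ->; exact: addNr.
    rewrite (linear_expand A (dX s)).
    elim: (enum_fset (monomials n)) => [|m r IH]; first by rewrite !big_nil.
    by rewrite !big_cons (mexp_linear _ _ _ (ltW s0)) -IH.
  exact: addNr.
have h := @cderiv_bound R phi (fun=> 0) 0 1 0 ler01 cr ci dphi (fun s _ => ltac:(by rewrite n10)).
have e : phi 1 = phi 0.
  move: h; rewrite mul0r mulr0 => h0; apply: CC_eq; apply/eqP; rewrite -subr_eq0 -normr_le0.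
    by have := le_trans (re_le_n1 _) h0; rewrite reD reN.
  by have := le_trans (im_le_n1 _) h0; rewrite imD imN.
have e1 : mexp Q 1 = phi 1 by rewrite phiE // /X subrr (EX0 _ hA).
by rewrite e1 e phiE // /X subr0 mexp0.
Qed.

End ExpectationCurve.

Section LimitCovariance.
Context {R : realType} {J : finType}.
Local Notation Pol := (trpoly R J).
Local Notation leb := (@lebesgue_measure R).
Variables (D L : {linear Pol -> Pol}).
Hypotheses (hDdeg : degree_nonincreasing D) (hLdeg : degree_nonincreasing L).

(** The derivative is left existential: only continuity in s is drawn from it, to obtain a
    primitive. *)
Lemma limit_cov_derivable (P P' : Pol) (s : R) : exists l, cderiv (limit_cov D L P P') s l.
Proof.
have [d0 dP0] := degree_exists P; have [d1 dP1] := degree_exists P'.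
have dP := degree_le_weak (leq_maxl d0 d1) dP0; have dP' := degree_le_weak (leq_maxr d0 d1) dP1.
set d := maxn d0 d1 in dP dP'.
pose X (u : R) := EX D (1 - u) P; pose Y (u : R) := EX D (1 - u) P'.
have bX : dbounded d X by move=> u; exact: EX_degree.
have bY : dbounded d Y by move=> u; exact: EX_degree.
have hX := pderiv_EX_rev 1 s P hDdeg; have hY := pderiv_EX_rev 1 s P' hDdeg.
have lL : linear L by move=> c a b; exact: linearP.
have bLX : dbounded d (fun u => L (X u)) by move=> u; exact: hLdeg.
have bLY : dbounded d (fun u => L (Y u)) by move=> u; exact: hLdeg.
have bXY : dbounded (d + d) (fun u => X u * Y u) by move=> u; exact: degree_leM.
have h1 := pderiv_lin lL bXY (pderivM bX bY hX hY).
have h2 := pderivM bLX bY (pderiv_lin lL bX hX) hY.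
have h3 := pderivM bX bLY hX (pderiv_lin lL bY hY).
have h := pderivB (pderivB h1 h2) h3.
have lh : linear (fun Q : Pol => 2^-1 *: Q).
  by move=> c a b; rewrite scalerDr !scalerA mulrC.
have bG : dbounded (d + d) (fun u => L (X u * Y u) - L (X u) * Y u - X u * L (Y u)).
  move=> u; apply: degree_leB; last by apply: degree_leM; [exact: bX|exact: bLY].
  apply: degree_leB; first exact: hLdeg (bXY u).
  by apply: degree_leM; [exact: bLX|exact: bY].
have hG := pderiv_lin lh bG h.
have bC : dbounded (d + d) (fun u => carre_du_champ L (X u) (Y u)).
  by move=> u; exact: degree_leZ (bG u).
have bE : dbounded (d + d) (fun u => EX D u (carre_du_champ L (X u) (Y u))).
  by move=> u; exact: EX_degree.
by eexists; exact: cderiv_peval1 bE (pderiv_EX hDdeg bC hG).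
Qed.

Lemma limit_covC (P P' : Pol) (s : R) : limit_cov D L P P' s = limit_cov D L P' P s.
Proof. exact: (congr1 (fun X => peval1 (EX D s X)) (carreC (S := Pol) L _ _)). Qed.

Lemma limit_cov_primitive (P P' : Pol) : exists F : R -> CC R,
  [/\ forall t, -1 < t -> cderiv F t (2 * limit_cov D L P P' t), F 0 = 0 & F 1 = sigma_T D L P P'].
Proof.
have cr : continuous (fun t => re (limit_cov D L P P' t)).
  by move=> t; have [l [h _]] := limit_cov_derivable P P' t; exact: is_derive_continuous h.
have ci : continuous (fun t => im (limit_cov D L P P' t)).
  by move=> t; have [l [_ h]] := limit_cov_derivable P P' t; exact: is_derive_continuous h.
have [F [F1 F2 F3]] := cprimitive cr ci.
exists (fun t => 2 * F t); split=> [t t1||].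
- exact/cderivZ/F1.
- by rewrite F2 mulr0.
rewrite F3 /sigma_T /= set_mem_itv; apply: (congr1 (fun f => 2 * cintegral leb `[0, 1] f)).
by apply/funext => t; rewrite /limit_cov !EXE.
Qed.

End LimitCovariance.

Section Reduction.
Context {R : realType} {J : finType} {N : nat}.
Local Notation Pol := (trpoly R J).
Local Notation M := ('M[CC R]_N).
Variables (T : J -> R) (beta : seq M) (D L : {linear Pol -> Pol}).
Hypothesis hT : forall j, 0 <= T j.
Hypothesis N0 : (0 < N)%N.
Hypotheses (hDdeg : degree_nonincreasing D) (hLdeg : degree_nonincreasing L).
Hypothesis hDL : forall (P : Pol) (A : J -> M), (forall j, A j \in unitmx) ->
  T_laplacian beta T (trace_eval P) A = trace_eval (D P + (N%:R ^+ 2)^-1 *: L P) A.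
Context {d : measure_display} {Omega : measurableType d}.
Variables (Pr : probability Omega R) (B : J -> R -> Omega -> M).
Hypothesis hB : forall j, brownian_motion Pr beta (B j).
Hypothesis hind : independent_processes Pr B.

(** Evaluation is a homomorphism, so the product of the fluctuations is the evaluation of one
    polynomial. This gives integrability, and [mexp_Phi] computes the expectation. *)
Lemma fluctuation_moment (k : nat) (P : 'I_k -> Pol) :
  let BT := fun (w : Omega) (j : J) => B j (T j) w in
  let X := fun w : Omega => \prod_(i < k) fluctuation Pr BT (P i) w in
  cintegrable Pr setT X /\ cexpectation Pr X = cmoment D L N 1 [set: 'I_k]%SET P.
Proof.
move=> BT X; pose e : R := epsN N.
pose Q : Pol := N%:R ^+ k *: \prod_(i < k) centered D L e 1 P i.
have BTE w : BT w = joint T B 1 w by apply/funext => j; rewrite /joint mul1r.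
have E (S : Pol) : cexpectation Pr (fun w => trace_eval S (BT w)) = Phi D L e 1 S.
  rewrite -(mexp_Phi hT N0 hDdeg hLdeg hDL hB hind).
  by apply: (congr1 (cexpectation Pr)); apply/funext => w; rewrite BTE.
have XE : X = fun w => trace_eval Q (joint T B 1 w).
  apply/funext => w; rewrite -BTE /X /Q /trace_eval pevalZ peval_prod.
  have -> : N%:R ^+ k = \prod_(i < k) (N%:R : CC R) by rewrite prodr_const card_ord.
  rewrite -big_split; apply: eq_bigr => i _ /=.
  rewrite /fluctuation E /centered pevalB pevalZ peval_1 mulr1; exact: erefl.
split; first by rewrite XE; exact: (mexp_integrable hT hB hind).
rewrite XE; have -> : cexpectation Pr (fun w => trace_eval Q (joint T B 1 w)) = Phi D L e 1 Q.
  exact: (mexp_Phi hT N0 hDdeg hLdeg hDL hB hind).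
rewrite /Q (PhiZ hDdeg hLdeg) /cmoment cardsT card_ord -/e.
apply: (congr1 (fun Y => N%:R ^+ k * Phi D L e 1 Y)).
by apply: eq_bigl => i; rewrite finset.in_setT.
Qed.

End Reduction.

Local Close Scope classical_set_scope.

Theorem theorem3p3 (R : realType) (r s : R) (hr : 0 < r) (hs : 0 < s)
    (J : finType) (T : J -> R) (hT : forall j, 0 <= T j)
    (beta : forall N : nat, seq 'M[CC R]_N)
    (hbeta : forall N : nat, (0 < N)%N -> orthonormal_basis_rs r s (beta N))
    (D L : {linear trpoly R J -> trpoly R J})
    (hDdeg : degree_nonincreasing D) (hLdeg : degree_nonincreasing L)
    (hD : forall P Q : trpoly R J, D (P * Q) = D P * Q + P * D Q)
    (hL : forall P Q S : trpoly R J,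
      L (P * Q * S) = L (P * Q) * S + P * L (Q * S) + L (P * S) * Q
                      - L P * Q * S - P * L Q * S - P * Q * L S)
    (hDL : forall (N : nat) (P : trpoly R J) (A : J -> 'M[CC R]_N),
      (0 < N)%N -> (forall j, A j \in unitmx) ->
      T_laplacian (beta N) T (trace_eval P) A
      = trace_eval (D P + (N%:R ^+ 2)^-1 *: L P) A)
    (k : nat) (hk : (0 < k)%N) (P : 'I_k -> trpoly R J) :
  exists K : R,
    forall (N : nat) (hN : (0 < N)%N)
      (d : measure_display) (Omega : measurableType d) (Pr : probability Omega R)
      (B : J -> R -> Omega -> 'M[CC R]_N),
    (forall j, brownian_motion Pr (beta N) (B j)) ->
    independent_processes Pr B ->
    let BT := fun (w : Omega) (j : J) => B j (T j) w in
    let X := fun w : Omega => \prod_(i < k) fluctuation Pr BT (P i) w in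
    cintegrable Pr setT X /\
    `| cexpectation Pr X - pairing_sum (fun i j => sigma_T D L (P i) (P j)) |
      <= RtoC (K / N%:R).
Proof.
(* One primitive of twice the limiting covariance for each pair of indices, with value [sigma_T] at
   1. *)
have /boolp.choice[F HF] : forall x : 'I_k * 'I_k, exists Fx : R -> CC R,
    [/\ forall t, -1 < t -> cderiv Fx t (2 * limit_cov D L (P x.1) (P x.2) t),
     Fx 0 = 0 & Fx 1 = sigma_T D L (P x.1) (P x.2)].
  by move=> x; exact: limit_cov_primitive.
pose sg i j := F (i, j); pose ds i j t := limit_cov D L (P i) (P j) t.
have sg_deriv i j t : -1 < t -> cderiv (sg i j) t (2 * ds i j t) by have [h _ _] := HF (i, j); exact: h.
have sg0 i j : sg i j 0 = 0 by have [] := HF (i, j).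
have dsC i j t : ds i j t = ds j i t by exact: limit_covC.
have /boolp.choice[dd Hdd] : forall i, exists n, degree_le n (P i).
  by move=> i; exact: degree_exists.
(* The moment estimates ask for one degree and one norm bound for the whole family; sums over the
   finite index set provide them. *)
have HQ i : degree_le (\sum_i dd i) (P i) /\ pn (P i) <= \sum_i pn (P i).
  split; first by apply: degree_le_weak (Hdd i); rewrite (bigD1 i) //= leq_addr.
  by rewrite (bigD1 i) //= lerDl; apply: sumr_ge0 => j _; exact: pn_ge0.
have dH S t : 0 < t < 1 -> cderiv (pairing_fun sg S) t
    (\sum_(i in S) \sum_(j in S :\ i) ds i j t * pairing_fun sg (S :\ i :\ j) t).
  by move=> /andP[t0 _]; apply: cderiv_pairing_fun => //; apply: lt_trans t0; rewrite ltrN10.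
have [C C0 HC] := mcurve_limit hDdeg hLdeg hD hL HQ (pairing_fun_set0 sg)
  (pairing_fun_0 sg0) (pairing_fun_continuous sg_deriv dsC) dH k.
exists C => N hN d Omega Pr B hB hind BT X.
have hDLN (Q : trpoly R J) (A : J -> 'M[CC R]_N) : (forall j, A j \in unitmx) ->
    T_laplacian (beta N) T (trace_eval Q) A = trace_eval (D Q + (N%:R ^+ 2)^-1 *: L Q) A.
  exact: hDL.
have [iX EX] := fluctuation_moment hT hN hDdeg hLdeg hDLN hB hind P.
split; first exact: iX.
have -> : cexpectation Pr X = mcurve D L N 1 P [set: 'I_k]%SET 1.
  exact: etrans EX (esym (mcurve_end hDdeg hLdeg N 1 P _)).
(* At time 1 the primitives take the values [sigma_T], and [is_pairing] agrees with [pairing_of] on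
   the full set by conversion. *)
have -> : pairing_sum (fun i j => sigma_T D L (P i) (P j)) = pairing_fun sg [set: 'I_k]%SET 1.
  apply: eq_bigr => p _; apply: eq_bigr => b _; apply: eq_bigr => i _; apply: eq_bigr => j _.
  by rewrite /sg; have [_ _ ->] := HF (i, j).
apply: le_trans (norm_le_n1 _) _; apply: lecR; rewrite mulrC.
by apply: HC => //; rewrite ?ler01 ?lexx // cardsT card_ord.
Qed.
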